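(* There exist a codimension-$1$ foliation $\mathcal{F}$ on the $4$-manifold $\mathbb{S}^2\times\mathbb{S}^1\times\mathbb{S}^1$ (with the last factor $\mathbb{S}^1=\mathbb{R}/2\pi\mathbb{Z}$), a foliated contact structure $\xi\subset T\mathcal{F}$ of rank $2$, and a defining $1$-form $\alpha$ for an extension of $\xi$, with Reeb vector field $R$, such that: (1) $\mathcal{F}$ has exactly two compact leaves, $\mathbb{S}^2\times\mathbb{S}^1\times\{0\}$ and $\mathbb{S}^2\times\mathbb{S}^1\times\{\pi\}$, and every other leaf accumulates on both of them; (2) every leaf of $\mathcal{F}$, endowed with the restriction of $\xi$, is an overtwisted contact manifold; (3) $R$ has closed orbits only in the two compact leaves; in particular the non-compact leaves are overtwisted and contain no closed orbit of $R$.
   Context: All objects are smooth; foliations and distributions are oriented and cooriented. A contact foliation is a triple $(M^{3+m},\mathcal{F}^{3},\xi^{2})$ where $\mathcal{F}$ is a foliation of $M$ with $3$-dimensional leaves and $\xi\subset T\mathcal{F}$ is a rank-$2$ distribution whose restriction to each leaf is a contact structure (a foliated contact structure). An extension of $\xi$ is a distribution $\Theta\subset TM$ of rank $2+m$ with $\Theta\cap T\mathcal{F}=\xi$; a defining $1$-form for $\Theta$ is $\alpha\in\Omega^1(M)$ with $\ker\alpha=\Theta$. The Reeb vector field of $\alpha$ is the unique $R\in\Gamma(T\mathcal{F})$ with $(i_Rd\alpha)|_{T\mathcal{F}}=0$ and $\alpha(R)=1$. A leaf accumulates on another leaf if its closure contains it. A contact $3$-manifold $(W,\xi)$ is overtwisted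 if it contains an embedded closed $2$-disc $D$ having a neighbourhood contactomorphic, by a map taking $D$ to $\Delta$, to a neighbourhood of the disc $\Delta=\{z=0,\ r\le\pi\}$ in $(\mathbb{R}^3,\ker(\cos(r)\,dz+r\sin(r)\,d\theta))$, where $(r,\theta,z)$ are cylindrical coordinates. *)

(* Defs.v *)
From HB Require Import structures.
From Stdlib Require Import Relation_Operators.
From mathcomp Require Import all_boot all_order all_algebra.
From mathcomp Require Import all_classical all_reals all_analysis.
Set Implicit Arguments.
Unset Strict Implicit.
Unset Printing Implicit Defensive.
Import Order.TTheory GRing.Theory Num.Theory numFieldNormedType.Exports.
Local Open Scope classical_set_scope.
Local Open Scope ring_scope.

(* Manifolds are subsets of a finite-dimensional normed space V, and
   smoothness is the extrinsic one: a map on an arbitrary subset is smooth when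
   it extends locally to a C^infinity map of open sets. *)

Section Smooth.
Context {R : realType} {V W : normedModType R}.

Fixpoint iterD (s : seq V) (f : V -> W) : V -> W :=
  if s is v :: s' then fun x => 'D_v (iterD s' f) x else f.

(* C^infinity on an open set U. *)
Definition smooth_on (U : set V) (f : V -> W) :=
  forall s x, U x -> differentiable (iterD s f) x.

Definition smooth (S : set V) (f : V -> W) :=
  forall x, S x -> exists (U : set V) (g : V -> W),
    [/\ open U, U x, smooth_on U g & forall y, (S `&` U) y -> f y = g y].

End Smooth.

Section Tangent.
Context {R : realType} {V : normedModType R}.

(* T_p S: velocities at p of smooth curves in S. *)
Definition tangent (S : set V) (p : V) : set V :=
  [set v | exists (J : set R) (g : R -> V),
    [/\ open J, J 0, smooth_on J g, forall t, J t -> S (g t) &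
        g 0 = p /\ 'D_1 g 0 = v]].

Definition lin_indep (k : nat) (X : 'I_k -> V) :=
  forall a : 'I_k -> R, \sum_i a i *: X i = 0 -> forall i, a i = 0.

Definition lin_span (k : nat) (X : 'I_k -> V) : set V :=
  [set v | exists a : 'I_k -> R, v = \sum_i a i *: X i].

(* D is a smooth rank-k distribution on the manifold S. *)
Definition distribution (S : set V) (k : nat) (D : V -> set V) :=
  forall p, S p -> exists (U : set V) (X : 'I_k -> V -> V),
    [/\ open U, U p, forall i, smooth (S `&` U) (X i) &
        forall q, (S `&` U) q ->
          [/\ forall i, tangent S q (X i q), lin_indep (fun i => X i q) &
              D q = lin_span (fun i => X i q)]].

(* A 1-form on an embedded submanifold S of V is the restriction to TS of a
   smooth 1-form defined on an open subset of V containing S; its exterior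
   derivative is the restriction of the ambient one, below (v and w being
   extended to constant vector fields). *)
Definition smooth_form (U : set V) (a : V -> {linear V -> R}) :=
  forall v, smooth_on U (fun x => a x v : R).

Definition dext (a : V -> {linear V -> R}) (x v w : V) : R :=
  'D_v (fun y => a y w : R) x - 'D_w (fun y => a y v : R) x.

Definition wedge_d (a : V -> {linear V -> R}) (x u v w : V) : R :=
  a x u * dext a x v w + a x v * dext a x w u + a x w * dext a x u v.

End Tangent.

Section Foliation.
Context {R : realType} {V : normedModType R}.

(* A foliated chart is a diffeomorphism cphi, with inverse cpsi, from cdom onto
   the product cA x cB; the plaques are the sets on which the second component
   of cphi is constant. *)
Record fchart := FChart {
  cdom : set V ;
  cA : set 'rV[R]_3 ;
  cB : set R ;
  cphi : V -> 'rV[R]_3 * R ;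
  cpsi : 'rV[R]_3 * R -> V }.

Definition is_fchart (M : set V) (c : fchart) :=
  [/\ exists2 U : set V, open U & cdom c = M `&` U,
      (open (cA c) /\ connected (cA c)) /\ (open (cB c) /\ connected (cB c)),
      smooth (cdom c) (cphi c) /\ smooth_on (cA c `*` cB c) (cpsi c),
      forall p, cdom c p ->
        (cA c `*` cB c) (cphi c p) /\ cpsi c (cphi c p) = p &
      forall u, (cA c `*` cB c) u ->
        cdom c (cpsi c u) /\ cphi c (cpsi c u) = u].

Definition transition (c c' : fchart) : 'rV[R]_3 * R -> 'rV[R]_3 * R :=
  cphi c' \o cpsi c.

(* Changes of charts have the local form (x, y) |-> (f (x, y), g y); F is
   oriented by det (df/dx) > 0 and cooriented by g' > 0. *)
Definition fcompatible (c c' : fchart) :=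
  forall u, (cA c `*` cB c) u -> cdom c' (cpsi c u) ->
    0 < \det ('J (fun x => (transition c c' (x, u.2)).1) u.1) /\
    exists g : R -> R,
      (\forall w \near u, (transition c c' w).2 = g w.2) /\ 0 < 'D_1 g u.2.

(* F is a foliated atlas of an oriented and cooriented codimension-1 foliation
   with 3-dimensional leaves on the manifold M. *)
Definition foliation (M : set V) (F : set fchart) :=
  [/\ forall c, F c -> is_fchart M c,
      forall p, M p -> exists2 c, F c & cdom c p &
      forall c c', F c -> F c' -> fcompatible c c'].

Definition plaque (c : fchart) (p : V) : set V :=
  [set q | cdom c q /\ (cphi c q).2 = (cphi c p).2].

Definition same_plaque (F : set fchart) (p q : V) : Prop :=
  exists c, [/\ F c, cdom c p & plaque c p q].

(* same_plaque is reflexive on M and symmetric, hence leaves are equivalence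
   classes. *)
Definition leaf_of (F : set fchart) (p : V) : set V :=
  [set q | clos_trans V (same_plaque F) p q].

Definition is_leaf (M : set V) (F : set fchart) (L : set V) :=
  exists2 p, M p & L = leaf_of F p.

(* The leaf topology, which is finer than the topology of M: A is open when it
   meets every plaque in a relatively open subset of the plaque. *)
Definition leaf_open (M : set V) (F : set fchart) (A : set V) :=
  A `<=` M /\
  forall p c, A p -> F c -> cdom c p ->
    exists U : set V, [/\ open U, U p & plaque c p `&` U `<=` A].

Definition leaf_compact (M : set V) (F : set fchart) (L : set V) :=
  forall G : set (set V), (forall A, G A -> leaf_open M F A) ->
    L `<=` \bigcup_(A in G) A ->
    exists G' : set (set V),
      [/\ finite_set G', G' `<=` G & L `<=` \bigcup_(A in G') A].

(* L accumulates on L' *)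
Definition adheres_to (L L' : set V) := L' `<=` closure L.

(* The fibre of TF at p. *)
Definition tangentF (F : set fchart) (p : V) : set V :=
  [set v | exists c, [/\ F c, cdom c p & tangent (plaque c p) p v]].

(* The restriction of xi to each leaf is a contact structure: in the leaf, it
   is locally the kernel of a 1-form b such that b /\ db does not vanish. *)
Definition leafwise_contact (M : set V) (F : set fchart) (xi : V -> set V) :=
  forall p c, M p -> F c -> cdom c p ->
    exists (U : set V) (b : V -> {linear V -> R}),
      [/\ open U, U p, smooth_form U b &
          forall q, (plaque c p `&` U) q ->
            xi q = tangentF F q `&` [set v | b q v = 0] /\
            exists u v w, [/\ tangentF F q u, tangentF F q v, tangentF F q w &
                              wedge_d b q u v w != 0]].

Definition foliated_contact (M : set V) (F : set fchart) (xi : V -> set V) :=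
  [/\ distribution M 2 xi,
      forall p, M p -> xi p `<=` tangentF F p &
      leafwise_contact M F xi].

(* The rank of an extension is 2 + m with m = 1 the codimension of F. *)
Definition extension (M : set V) (F : set fchart) (xi Theta : V -> set V) :=
  distribution M 3 Theta /\
  forall p, M p -> Theta p `&` tangentF F p = xi p.

(* Together with the orientation of F, alpha also coorients xi in TF and Theta
   in TM, and orients both. *)
Definition defining_form (M : set V) (Theta : V -> set V)
    (alpha : V -> {linear V -> R}) :=
  (exists U : set V, [/\ open U, M `<=` U & smooth_form U alpha]) /\
  forall p, M p -> Theta p = tangent M p `&` [set v | alpha p v = 0].

Definition is_reeb (M : set V) (F : set fchart) (alpha : V -> {linear V -> R})
    (X : V -> V) :=
  smooth M X /\
  forall p, M p ->
    [/\ tangentF F p (X p), alpha p (X p) = 1 &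
        forall v, tangentF F p v -> dext alpha p (X p) v = 0].

Definition closed_orbit (M : set V) (X : V -> V) (C : set V) :=
  exists (g : R -> V) (T : R),
    [/\ 0 < T, forall t, M (g t), forall t : R, is_derive t (1 : R) g (X (g t)),
        forall t, g (t + T) = g t & C = range g].

End Foliation.

Section Overtwisted.
Context {R : realType}.

Definition cx (p : 'rV[R]_3) : R := p 0 (inord 0).
Definition cy (p : 'rV[R]_3) : R := p 0 (inord 1).
Definition cz (p : 'rV[R]_3) : R := p 0 (inord 2).

Definition cyl_radius (p : 'rV[R]_3) : R := Num.sqrt (cx p ^+ 2 + cy p ^+ 2).

(* The kernel of cos r dz + r sin r dtheta, with
   r sin r dtheta = (sin r / r) (x dy - y dx); on the axis r = 0 the second term
   vanishes, as it should, whatever the value of sin r / r is. *)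
Definition ot_model (p : 'rV[R]_3) : set 'rV[R]_3 :=
  let r := cyl_radius p in
  [set v | cos r * cz v + sin r / r * (cx p * cy v - cy p * cx v) = 0].

Definition ot_disc : set 'rV[R]_3 :=
  [set p | cz p = 0 /\ cyl_radius p <= pi].

Context {V : normedModType R}.

(* Smoothness for the manifold structure of the leaves, whose charts are the
   first components of the foliated charts restricted to plaques: of a map from
   an open subset O of R^3 to the leaves, and of a map from an open subset A of
   the leaves to R^3. *)
Definition smooth_to_leaf (F : set (@fchart R V)) (O : set 'rV[R]_3)
    (h : 'rV[R]_3 -> V) :=
  forall c (y : R), F c ->
    let N := [set x | [/\ O x, cdom c (h x) & (cphi c (h x)).2 = y]] in
    open N /\ smooth_on N (fun x => (cphi c (h x)).1).

Definition smooth_from_leaf (F : set (@fchart R V)) (A : set V)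
    (k : V -> 'rV[R]_3) :=
  forall c (y : R), F c -> cB c y ->
    smooth_on [set x | cA c x /\ A (cpsi c (x, y))]
              (fun x => k (cpsi c (x, y))).

(* The contact manifold (L, xi) is overtwisted: h is a contactomorphism, with
   inverse k, from a neighbourhood O of ot_disc onto an open subset of L; the
   overtwisted disc of L is h @` ot_disc. *)
Definition overtwisted (M : set V) (F : set (@fchart R V)) (xi : V -> set V)
    (L : set V) :=
  exists (O : set 'rV[R]_3) (h : 'rV[R]_3 -> V) (k : V -> 'rV[R]_3),
    [/\ open O /\ ot_disc `<=` O,
        h @` O `<=` L /\ leaf_open M F (h @` O),
        forall x, O x -> k (h x) = x,
        smooth_to_leaf F O h /\ smooth_from_leaf F (h @` O) k &
        forall x v, O x -> (ot_model x v <-> xi (h x) ('D_v h x))].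

End Overtwisted.

Section Example.
Variable R : realType.

Definition sphere (n : nat) : set 'rV[R]_n.+1 :=
  [set x | \sum_i x 0 i ^+ 2 = 1].
Arguments sphere n : clear implicits.

(* The ambient space R^3 x R^2 x R^2 of S^2 x S^1 x S^1. *)
Definition E7 : normedModType R := ('rV[R]_3 * 'rV[R]_2 * 'rV[R]_2)%type.

Definition S2S1S1 : set E7 := sphere 2 `*` sphere 1 `*` sphere 1.

(* The identification of R / 2 pi Z with the unit circle. *)
Definition circ (t : R) : 'rV[R]_2 :=
  \row_(i < 2) (if i == 0 then cos t else sin t).

(* S^2 x S^1 x {t} *)
Definition slice (t : R) : set E7 := sphere 2 `*` sphere 1 `*` [set circ t].

End Example.

(* Main.v *)
Require Import Defs.
From mathcomp Require Import all_boot all_order all_algebra.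
From mathcomp Require Import all_classical all_reals all_analysis.
From HB Require Import structures.
From Stdlib Require Import Relation_Operators.
From mathcomp Require Import ring lra finmap.
Import Order.TTheory GRing.Theory Num.Theory numFieldNormedType.Exports.
Local Open Scope classical_set_scope.
Local Open Scope ring_scope.
Set Implicit Arguments.
Unset Strict Implicit.
Unset Printing Implicit Defensive.

(** A point of S^2 x S^1 x S^1 is given by its coordinates x, y, z on the sphere
    and by two angles s and t, with ([co_u], [co_v]) = (cos s, sin s) and
    ([co_c], [co_s]) = (cos t, sin t).

    The foliation is the kernel of dt - sin t ds, a suspension over the circle
    of the angle s, times the sphere. Where sin t <> 0 it has the first integral
    tan (t / 2) e^(-s), and -1 / (tan (t / 2) e^(-s)) is one near t = pi. So the
    leaves [Leaf k c] are: the spheres times circles t = 0 and t = pi (c = 0),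
    and, for c <> 0, the graphs tan (t / 2) = c e^s over S^2 x R, which spiral
    onto t = 0 as s goes to -oo and onto t = pi as s goes to +oo. Each point lies
    in one of eight charts, a stereographic projection for each of the three
    factors (signs e, d, k), with the first integral as transverse coordinate;
    a change of charts acts on the latter, locally, by y |-> K y or
    y |-> - K / y with K > 0 constant ([transE], [trans_shift_near],
    [foliation_atlas]). Leaves are identified in [leaf_ofE] and [is_leafP];
    [Leaf_adheres], [Leaf_noncompact] and [Leaf0_leaf_compact] give their closures
    and tell which of them are compact.

    The contact structure is the kernel on each leaf of
      lambda = h(z) ds + kappa(z) (x dy - y dx),
    with w = 2 pi^2 (1 - z), h = cos (sqrt w) and
    (1 - z^2) kappa = sqrt w sin (sqrt w) ([lam_s], [lam_xy], [lam_theta]). In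
    terms of r = sqrt w it reads lambda = cos r ds + r sin r dtheta, the standard
    overtwisted form, r going from 0 at the north pole to 2 pi at the south pole.
    It is smooth at the two poles because cos (sqrt w) and
    sin (sqrt w) / sqrt w are entire functions of w, and because r sin r vanishes
    at r = 2 pi; it is a contact form because
    h h2' - h' h2 = - pi^2 (1 + cos r sin r / r) < 0 where
    h2 = (1 - z^2) kappa ([wronskian_lt0]). The sphere without its south pole
    being the disc r < 2 pi, each leaf contains the part r < 2 pi, |s| < pi of
    the overtwisted model, hence the disc r <= pi ([Leaf_overtwisted]).

    The form alpha = (2 + cos t) lambda has the same kernel on TM, an extension
    of xi. The factor 2 + cos t destroys the closed orbits in the noncompact
    leaves. Indeed H = alpha (d/dtheta) = (2 + cos t) h2 (z) is constant along
    Reeb orbits, and the Reeb field satisfies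
      z' = rho sin^2 t h2 (z) / (2 + cos t),
      (cos t)' = - rho sin^2 t h2' (z), with rho < 0.
    If H <> 0, then h2 (z) has the sign of H and z is monotone; if H = 0, then
    h2 (z) = 0, z is constant, h2' (z) <> 0 by the inequality above, and cos t is
    monotone. On a closed orbit the monotone function is constant, which
    forces sin t = 0 ([orbit_co_s0]). Finally, the circles over the north pole
    in t = 0 and t = pi are closed orbits ([pole_orbit]). *)

(** * Maps of class C^n *)
Section Ck.
Context {R : realType} {V W : normedModType R}.

(** The derivative taken first is split off here, the one taken last in [iterD];
    the order used here is the one for which the product and chain rules are
    proved by induction. *)
Fixpoint Ck (n : nat) (U : set V) (f : V -> W) : Prop :=
  (forall x, U x -> differentiable f x) /\
  if n is n'.+1 then forall v, Ck n' U ('D_v f) else True.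

Lemma iterD_rcons (s : seq V) v (f : V -> W) :
  Defs.iterD (rcons s v) f = Defs.iterD s ('D_v f).
Proof. by elim: s => //= a s ->. Qed.

Lemma smooth_onP (U : set V) (f : V -> W) :
  smooth_on U f <-> forall n, Ck n U f.
Proof.
split=> [sf n|Cf s].
  elim: n f sf => [|n IHn] f sf; (split; first exact: (sf [::])) => //= v.
  by apply: IHn => s x Ux; rewrite -iterD_rcons; exact: sf.
elim/last_ind: s f Cf => [|s v IHs] f Cf x Ux.
  by have [+ _] := Cf 0; apply.
rewrite iterD_rcons; apply: IHs => // n.
by have [_ +] := Cf n.+1; apply.
Qed.

Lemma Ck_diff n U f x : Ck n U f -> U x -> differentiable f x.
Proof. by case: n => [|n] [+ _]; apply. Qed.

Lemma Ck_derive n U f v : Ck n.+1 U f -> Ck n U ('D_v f).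
Proof. by case=> _ +; apply. Qed.

Lemma CkW n U f : Ck n.+1 U f -> Ck n U f.
Proof.
elim: n f => [|n IHn] f [df Df]; (split; first exact: df); first by [].
by move=> v; apply: IHn; exact: Df.
Qed.

(** Differentiability depends only on the germ; this makes [Ck] local in
    [Ck_local], although [Ck] mentions the derivative as a function on all of V. *)
Lemma differentiable_near (f g : V -> W) x :
  {near x, f =1 g} -> differentiable f x -> differentiable g x.
Proof.
move=> fg df; have [cdf dfE] := (diff_locallyP _ _).1 df.
have gE : g \o shift x = cst (g x) + 'd f x +o_ 0 id.
  apply/eqaddoP => _/posnumP[e].
  move/eqaddoP : dfE => /(_ e%:num (gt0 e)) dfE.
  have fg0 : \forall h \near 0, f (h + x) = g (h + x).
    by have := fg; rewrite (near_shift 0) subr0.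
  near=> h.
  rewrite !fctE /= -(nbhs_singleton fg).
  have <- : f (h + x) = g (h + x) by near: h.
  by near: h.
apply/diff_locallyP; rewrite (diff_unique cdf gE); split=> //.
Unshelve. all: by end_near. Qed.

Lemma Ck_local n (U : set V) f :
  (forall x, U x -> exists U' g, [/\ open U', U' x, Ck n U' g &
     forall y, U' y -> f y = g y]) -> Ck n U f.
Proof.
have nearE U' x g : open U' -> U' x -> (forall y, U' y -> f y = g y) ->
    {near x, f =1 g}.
  by move=> oU' Ux' fg; apply: filterS (open_nbhs_nbhs (conj oU' Ux')).
elim: n f U nearE => [|n IHn] f U nearE loc.
  split=> // x /loc [U' [g [oU' Ux' [Cg _] fg]]].
  apply: (@differentiable_near g); last exact: Cg.
  by apply: filterS (open_nbhs_nbhs (conj oU' Ux')) => y /fg.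
split=> [x /loc [U' [g [oU' Ux' Cg fg]]]|v].
  apply: (@differentiable_near g); last exact: Ck_diff Cg Ux'.
  by apply: filterS (open_nbhs_nbhs (conj oU' Ux')) => y /fg.
apply: IHn => [U' x g oU' Ux' fg|x /loc [U' [g [oU' Ux' Cg fg]]]].
  by apply: filterS (open_nbhs_nbhs (conj oU' Ux')).
exists U', ('D_v g); split=> //; first exact: Ck_derive.
move=> y Uy; apply: near_eq_derive.
by apply: filterS (open_nbhs_nbhs (conj oU' Uy)) => z /fg.
Qed.

Lemma Ck_eq n (U : set V) f g : open U -> (forall x, U x -> f x = g x) ->
  Ck n U g -> Ck n U f.
Proof. by move=> oU fg Cg; apply: Ck_local => x Ux; exists U, g. Qed.

Lemma Ck_cst n U (a : W) : Ck n U (cst a).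
Proof.
elim: n a => [|n IHn] a; (split; first by move=> x _; exact: differentiable_cst).
  by [].
move=> v.
have -> : 'D_v (cst a) = cst 0 by apply/funext => x; rewrite derive_cst.
exact: IHn.
Qed.

Lemma Ck_lin n U (f : {linear V -> W}) : continuous f -> Ck n U f.
Proof.
move=> cf; case: n => [|n]; (split; first by move=> x _; exact: linear_differentiable).
  by [].
move=> v.
have -> : 'D_v f = cst (f v).
  apply/funext => x; rewrite deriveE; last exact: linear_differentiable.
  by rewrite diff_lin.
exact: Ck_cst.
Qed.

Lemma CkD n U f g : open U -> Ck n U f -> Ck n U g -> Ck n U (f + g).
Proof.
move=> oU; elim: n f g => [|n IHn] f g [df Df] [dg Dg];
  (split; first by move=> x Ux; apply: differentiableD; [exact: df|exact: dg]).
  by [].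
move=> v.
apply: (@Ck_eq _ _ _ ('D_v f + 'D_v g)) => // [x Ux|].
  by rewrite deriveD //; apply: diff_derivable; [exact: df|exact: dg].
by apply: IHn; [exact: Df|exact: Dg].
Qed.

End Ck.

Lemma Ck_linl (R : realType) (V W X : normedModType R) n (U : set V)
    (f : V -> W) (L : {linear W -> X}) : open U -> continuous L ->
  Ck n U f -> Ck n U (fun x => L (f x)).
Proof.
move=> oU cL; elim: n f => [|n IHn] f Cf;
  (split; first by move=> x Ux; apply: differentiable_comp;
    [exact: Ck_diff Cf Ux|exact: linear_differentiable]).
  by [].
move=> v.
apply: (@Ck_eq _ _ _ _ _ _ (fun x => L ('D_v f x))) => // [x Ux|]; last first.
  by apply: IHn; exact: Ck_derive.
have df := Ck_diff Cf Ux; have dL y := linear_differentiable y cL.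
rewrite !deriveE //; last exact: differentiable_comp.
by rewrite diff_comp //= diff_lin.
Qed.

Section CkReal.
Context {R : realType} {V : normedModType R}.
Implicit Types (f g : V -> R) (U : set V).

Lemma CkM n U f g : open U -> Ck n U f -> Ck n U g -> Ck n U (f * g).
Proof.
move=> oU; elim: n f g => [|n IHn] f g Cf Cg;
  (split; first by move=> x Ux; apply: differentiableM;
    [exact: Ck_diff Cf Ux|exact: Ck_diff Cg Ux]).
  by [].
move=> v.
apply: (@Ck_eq _ _ _ _ _ _ (f * 'D_v g + g * 'D_v f)) => // [x Ux|].
  by rewrite deriveM //; apply: diff_derivable;
    [exact: Ck_diff Cf Ux|exact: Ck_diff Cg Ux].
by apply: CkD => //; apply: IHn => //;
  [exact: CkW|exact: Ck_derive|exact: CkW|exact: Ck_derive].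
Qed.

Lemma CkZ (W : normedModType R) n U f (a : W) : open U ->
  Ck n U f -> Ck n U (fun x => f x *: a).
Proof.
move=> oU; elim: n f => [|n IHn] f Cf;
  (split; first by move=> x Ux; apply: differentiableZl; exact: Ck_diff Cf Ux).
  by [].
move=> v.
apply: (@Ck_eq _ _ _ _ _ _ (fun x => 'D_v f x *: a)) => // [x Ux|].
  have df := Ck_diff Cf Ux.
  by rewrite deriveE ?diffZl //; [rewrite deriveE|exact: differentiableZl].
by apply: IHn; exact: Ck_derive.
Qed.

Lemma derive_comp1 (phi : R -> R) f x v : differentiable f x ->
  differentiable phi (f x) -> 'D_v (phi \o f) x = 'D_1 phi (f x) * 'D_v f x.
Proof.
move=> df dphi; rewrite deriveE; last exact: differentiable_comp.
rewrite diff_comp //= diff1E // derive1E -deriveE //.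
by rewrite mulrC.
Qed.

Lemma Ck_comp n U (D : set R) (phi : R -> R) f : open U ->
  Ck n D phi -> Ck n U f -> (forall x, U x -> D (f x)) -> Ck n U (phi \o f).
Proof.
move=> oU; elim: n phi f => [|n IHn] phi f Cphi Cf fD;
  (split; first by move=> x Ux; apply: differentiable_comp;
    [exact: Ck_diff Cf Ux|exact/(Ck_diff Cphi)/fD]).
  by [].
move=> v.
apply: (@Ck_eq _ _ _ _ _ _ ((('D_1 phi) \o f) * 'D_v f)) => // [x Ux|].
  by rewrite derive_comp1 //; [exact: Ck_diff Cf Ux|exact/(Ck_diff Cphi)/fD].
apply: CkM => //; last exact: Ck_derive.
by apply: IHn; [exact: Ck_derive|exact: CkW|].
Qed.

(** Pointwise forms of [Ck_comp], [CkD] and [CkM], for functions given as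
    abstractions. *)
Lemma Ck_compl n U (D : set R) (phi : R -> R) f : open U ->
  Ck n D phi -> Ck n U f -> (forall x, U x -> D (f x)) ->
  Ck n U (fun x => phi (f x)).
Proof. exact: Ck_comp. Qed.

Lemma CkDl n U f g : open U -> Ck n U f -> Ck n U g ->
  Ck n U (fun x => f x + g x).
Proof. exact: CkD. Qed.

Lemma CkMl n U f g : open U -> Ck n U f -> Ck n U g ->
  Ck n U (fun x => f x * g x).
Proof. exact: CkM. Qed.

End CkReal.

Lemma scaleRE (R : realType) (a b : R) : a *: b = a * b. Proof. by []. Qed.

Section Ck1.
Context {R : realType}.
Implicit Types (f g : R -> R) (U : set R).

Lemma derive_line f x v : derivable f x 1 -> 'D_v f x = v * 'D_1 f x.
Proof.
move=> /derivable1_diffP df.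
by rewrite deriveE // diff1E // derive1E.
Qed.

(** Smoothness of an elementary function follows from its differential equation:
    the right-hand side is a polynomial in functions already known to be C^n. *)
Lemma Ck_ode n U f g : open U ->
  (forall x, U x -> is_derive x (1 : R) f (g x)) -> Ck n U g -> Ck n.+1 U f.
Proof.
move=> oU fg Cg; split=> [x Ux|v].
  by apply/derivable1_diffP; have [] := fg x Ux.
apply: (@Ck_eq _ _ _ _ _ _ (cst v * g)) => // [x Ux|].
  have [df fE] := fg x Ux.
  by rewrite derive_line // fE.
by apply: CkM => //; exact: Ck_cst.
Qed.

Lemma Ck0_ode U f g : open U ->
  (forall x, U x -> is_derive x (1 : R) f (g x)) -> Ck 0 U f.
Proof.
by move=> oU fg; split=> // x Ux; apply/derivable1_diffP; have [] := fg x Ux.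
Qed.

Lemma Ck_id n U : Ck n U id.
Proof.
case: n => [|n]; (split; first by move=> x _; exact: ex_diff).
  by [].
move=> v.
have -> : 'D_v (@id R) = cst v by apply/funext => x; rewrite derive_id.
exact: Ck_cst.
Qed.

Lemma Ck_inv n : Ck n [set x : R | x != 0] (fun x => x^-1).
Proof.
have o0 : open [set x : R | x != 0] by exact: open_neq.
have D x : x != 0 -> is_derive x (1 : R) (fun x : R => x^-1) (- (x^-1 * x^-1)).
  move=> x0; apply: is_derive_eq; first exact: is_deriveV.
  by rewrite scaler1 expr2 invfM.
elim: n => [|n IHn]; first exact: (Ck0_ode o0 D).
apply: (Ck_ode o0 D).
pose i := (fun x : R => x^-1).
apply: (@Ck_eq _ _ _ _ _ _ (cst (-1) * (i * i))) => // [x _|].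
  by rewrite /= !fctE mulN1r.
by apply: CkM => //; [exact: Ck_cst|exact: CkM].
Qed.

End Ck1.

(** * Elementary functions, cos (sqrt w) and sin (sqrt w) / sqrt w *)
Section OneVariable.
Context {R : realType}.

Lemma Ck_sin_cos n : Ck n setT (@sin R) /\ Ck n setT (@cos R).
Proof.
have Ds (x : R) : setT x -> is_derive x (1 : R) sin (cos x).
  by move=> _; exact: is_derive_sin.
have Dc (x : R) : setT x -> is_derive x (1 : R) cos ((cst (-1) * sin) x).
  by move=> _; apply: is_derive_eq; rewrite fctE /= mulN1r.
elim: n => [|n [IHs IHc]].
  by split; [exact: (Ck0_ode openT Ds)|exact: (Ck0_ode openT Dc)].
split; first exact: (Ck_ode openT Ds IHc).
apply: (Ck_ode openT Dc).
by apply: CkM; [exact: openT|exact: Ck_cst|].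
Qed.

Lemma Ck_sin n : Ck n setT (@sin R). Proof. exact: (Ck_sin_cos n).1. Qed.
Lemma Ck_cos n : Ck n setT (@cos R). Proof. exact: (Ck_sin_cos n).2. Qed.

Lemma Ck_expR n : Ck n setT (@expR R).
Proof.
have D (x : R) : setT x -> is_derive x (1 : R) expR (expR x).
  by move=> _; exact: is_derive_expR.
elim: n => [|n IHn]; first exact: (Ck0_ode openT D).
exact: (Ck_ode openT D IHn).
Qed.

Lemma Ck_atan n : Ck n setT (@atan R).
Proof.
have D (x : R) : setT x -> is_derive x (1 : R) atan (1 + x ^+ 2)^-1.
  by move=> _; exact: is_derive1_atan.
apply: CkW; apply: (Ck_ode openT D).
apply: (Ck_compl openT (@Ck_inv R n)) => [|x _ /=].
  apply: (CkDl openT); first exact: Ck_cst.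
  by apply: (CkMl openT); exact: Ck_id.
by rewrite gt_eqF // ltr_pwDl // sqr_ge0.
Qed.

Lemma Ck_sqrt n : Ck n [set x : R | 0 < x] Num.sqrt.
Proof.
have o0 : open [set x : R | 0 < x] by exact: open_gt.
have D (x : R) : 0 < x -> is_derive x (1 : R) Num.sqrt (2 * Num.sqrt x)^-1.
  exact: is_derive1_sqrt.
elim: n => [|n IHn]; first exact: (Ck0_ode o0 D).
apply: (Ck_ode o0 D).
apply: (Ck_compl o0 (@Ck_inv R n)) => [|x /= x0].
  by apply: (CkMl o0) => //; exact: Ck_cst.
by rewrite mulf_neq0 // gt_eqF // sqrtr_gt0.
Qed.

(** Domination by the exponential series: such a power series converges
    everywhere, and the condition is stable under termwise differentiation, which
    yields smoothness by induction. *)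
Definition expbound (c : R^nat) :=
  exists A B : R, [/\ 0 <= A, 0 <= B & forall n, `|c n| <= A * (B ^+ n / n`!%:R)].

Lemma expbound_diffs c : expbound c -> expbound (pseries_diffs c).
Proof.
move=> [A [B [A0 B0 cAB]]]; exists (A * B), B; split=> // [|n].
  exact: mulr_ge0.
rewrite /pseries_diffs normrM ger0_norm ?ler0n //.
apply: le_trans (ler_wpM2l _ (cAB n.+1)) _; first exact: ler0n.
rewrite factS natrM exprS le_eqVlt; apply/orP; left; apply/eqP.
have n0 : (n.+1%:R : R) != 0 by rewrite pnatr_eq0.
have f0 : (n`!%:R : R) != 0 by rewrite pnatr_eq0 -lt0n fact_gt0.
by move: n0 f0; move: (n.+1%:R : R) (n`!%:R : R) => a b a0 b0; field; rewrite a0 b0.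
Qed.

Lemma expbound_cvg c x : expbound c -> cvgn (pseries c x).
Proof.
move=> [A [B [A0 B0 cAB]]]; apply: normed_cvg.
apply: (@series_le_cvg _ _ (fun n => A * exp_coeff (B * `|x|) n)) => [n|n|n|].
- exact: normr_ge0.
- by rewrite mulr_ge0 // /exp_coeff /= divr_ge0 // exprn_ge0 // mulr_ge0.
- rewrite /= normrM normrX; apply: le_trans (ler_wpM2r _ (cAB n)) _.
    by rewrite exprn_ge0.
  by rewrite /exp_coeff /= exprMn -!mulrA [X in B ^+ n * X]mulrC.
have -> : series (fun n => A * exp_coeff (B * `|x|) n) =
    (fun n => A * series (exp_coeff (B * `|x|)) n).
  by apply/funext => n; rewrite /series /= mulr_sumr.
by apply: is_cvgMr; exact: is_cvg_series_exp_coeff.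
Qed.

Definition psum (c : R^nat) (x : R) : R := limn (pseries c x).

Lemma is_derive_psum c x : expbound c ->
  is_derive x (1 : R) (psum c) (psum (pseries_diffs c) x).
Proof.
move=> bc; apply: (@pseries_snd_diffs _ c (`|x| + 1)).
- exact: expbound_cvg.
- exact/expbound_cvg/expbound_diffs.
- exact/expbound_cvg/expbound_diffs/expbound_diffs.
- by rewrite [ltRHS]ger0_norm ?ltrDl // addr_ge0.
Qed.

Lemma Ck_psum n c : expbound c -> Ck n setT (psum c).
Proof.
elim: n c => [|n IHn] c bc.
  by apply: (Ck0_ode openT) => x _; exact: is_derive_psum.
apply: (Ck_ode openT) => [x _|]; first exact: is_derive_psum.
exact/IHn/expbound_diffs.
Qed.

(** The power series in w of cos (sqrt w) and sin (sqrt w) / sqrt w. *)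
Definition cos_sqrt_coef (n : nat) : R := (-1) ^+ n / n.*2`!%:R.
Definition sinc_sqrt_coef (n : nat) : R := (-1) ^+ n / n.*2.+1`!%:R.
Definition cos_sqrt := psum cos_sqrt_coef.
Definition sinc_sqrt := psum sinc_sqrt_coef.

Lemma expbound_fact (d : nat -> nat) : (forall n, n <= d n)%N ->
  expbound (fun n => (-1) ^+ n / (d n)`!%:R).
Proof.
move=> dn; exists 1, 1; split=> // n.
rewrite normrM normrX normrN1 expr1n !mul1r normfV ger0_norm ?ler0n //.
by rewrite lef_pV2 ?posrE ?ltr0n ?fact_gt0 // ler_nat leq_fact.
Qed.

Lemma expbound_cos_sqrt : expbound cos_sqrt_coef.
Proof. by apply: expbound_fact => n; rewrite -addnn leq_addr. Qed.

Lemma expbound_sinc_sqrt : expbound sinc_sqrt_coef.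
Proof. by apply: (@expbound_fact (fun n => n.*2.+1)) => n; rewrite -addnn leqW // leq_addr. Qed.

Lemma Ck_cos_sqrt n : Ck n setT cos_sqrt. Proof. exact/Ck_psum/expbound_cos_sqrt. Qed.
Lemma Ck_sinc_sqrt n : Ck n setT sinc_sqrt. Proof. exact/Ck_psum/expbound_sinc_sqrt. Qed.

Lemma cos_sqrt_sqr (x : R) : cos_sqrt (x ^+ 2) = cos x.
Proof.
apply/cvg_lim => //; apply: cvg_trans (@cvg_cos_coeff' _ x).
rewrite [X in _ --> X @ _](_ : _ = pseries cos_sqrt_coef (x ^+ 2)) //.
apply/funext => n; apply: eq_bigr => i _.
by rewrite /cos_coeff' /cos_sqrt_coef /= -exprM mul2n -exprnP mulrAC.
Qed.

Lemma sinc_sqrt_sqr (x : R) : x * sinc_sqrt (x ^+ 2) = sin x.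
Proof.
have H : series (sin_coeff' x) @ \oo --> x * sinc_sqrt (x ^+ 2).
  rewrite [X in X @ _ --> _](_ : _ = (fun n => x * pseries sinc_sqrt_coef (x ^+ 2) n)).
    by apply: cvgMr; exact/expbound_cvg/expbound_sinc_sqrt.
  apply/funext => n; rewrite /= mulr_sumr; apply: eq_bigr => i _.
  by rewrite /sin_coeff' /sinc_sqrt_coef /= -exprM mul2n exprS -exprnP; ring.
by rewrite -(cvg_lim (@Rhausdorff R) H); apply/cvg_lim => //; exact: cvg_sin_coeff'.
Qed.

Lemma psumZ c a x : expbound c -> psum (fun n => a * c n) x = a * psum c x.
Proof.
move=> bc; apply/cvg_lim => //.
rewrite [X in X @ _ --> _](_ : _ = (fun n => a * pseries c x n)); last first.
  by apply/funext => n; rewrite /= mulr_sumr; apply: eq_bigr => i _; rewrite mulrA.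
by apply: cvgMr; exact/expbound_cvg.
Qed.

Lemma is_derive_cos_sqrt x : is_derive x (1 : R) cos_sqrt (- (sinc_sqrt x / 2)).
Proof.
apply: is_derive_eq; first exact/is_derive_psum/expbound_cos_sqrt.
rewrite (_ : pseries_diffs cos_sqrt_coef = fun n => - 2^-1 * sinc_sqrt_coef n).
  by rewrite psumZ; [rewrite mulNr mulrC|exact: expbound_sinc_sqrt].
apply/funext => n; rewrite /pseries_diffs /cos_sqrt_coef /sinc_sqrt_coef doubleS.
rewrite (factS n.*2.+1) natrM exprS.
have n0 : (n.+1%:R : R) != 0 by rewrite pnatr_eq0.
have f0 : (n.*2.+1`!%:R : R) != 0 by rewrite pnatr_eq0 -lt0n fact_gt0.
have -> : (n.*2.+2%:R : R) = 2 * n.+1%:R by rewrite -doubleS -mul2n natrM.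
by move: n0 f0; move: (n.+1%:R : R) (n.*2.+1`!%:R : R) => a b a0 b0; field; rewrite a0 b0.
Qed.

Lemma cos_sqrt0 : cos_sqrt 0 = 1.
Proof. by have := cos_sqrt_sqr 0; rewrite expr0n cos0. Qed.

Lemma cos_sqrtE (w : R) : 0 <= w -> cos_sqrt w = cos (Num.sqrt w).
Proof. by move=> w0; rewrite -cos_sqrt_sqr sqr_sqrtr. Qed.

Lemma sinc_sqrtE (w : R) : 0 < w -> sinc_sqrt w = sin (Num.sqrt w) / Num.sqrt w.
Proof.
move=> w0; rewrite -sinc_sqrt_sqr sqr_sqrtr ?ltW // mulrC mulKf //.
by rewrite gt_eqF // sqrtr_gt0.
Qed.

Lemma cos_sinc_sqrt1 (w : R) : 0 <= w -> cos_sqrt w ^+ 2 + w * sinc_sqrt w ^+ 2 = 1.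
Proof.
move=> w0; rewrite cos_sqrtE // -(cos2Dsin2 (Num.sqrt w)) -[in RHS]sinc_sqrt_sqr.
by rewrite exprMn sqr_sqrtr.
Qed.

(** The derivative of x S (x^2) = sin x at x = sqrt w gives
    S + 2 w S' = cos (sqrt w), whence (w S)' = S + w S', also at w = 0. *)
Lemma is_derive_mul_sinc_sqrt (w : R) : 0 <= w ->
  is_derive w (1 : R) (fun x => x * sinc_sqrt x) ((cos_sqrt w + sinc_sqrt w) / 2).
Proof.
move=> w0; have := is_derive_psum w expbound_sinc_sqrt; rewrite -/sinc_sqrt.
move: (psum (pseries_diffs sinc_sqrt_coef) w) => S' DS.
set x := Num.sqrt w; have xw : x ^+ 2 = w by rewrite sqr_sqrtr.
have Dsin : is_derive x (1 : R) (fun x => x * sinc_sqrt (x ^+ 2)) (sinc_sqrt w + 2 * w * S').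
  have DSx : is_derive x (1 : R) (fun x => sinc_sqrt (x ^+ 2)) (S' * (2 * x)).
    apply: (@is_derive1_comp _ sinc_sqrt (fun x => x ^+ 2)); first by rewrite xw.
    apply: DeriveDef; first exact: exprn_derivable.
    by rewrite exp_derive expr1 scaler1.
  apply: is_derive_eq.
  by rewrite /= xw !scaleRE mulr1 -xw; ring.
have : sinc_sqrt w + 2 * w * S' = cos x.
  have [_ <-] := Dsin; rewrite (_ : (fun x => _) = sin).
    by have [_ ->] := is_derive_sin x.
  by apply/funext => y; exact: sinc_sqrt_sqr.
rewrite /x -cos_sqrtE // => E; apply: is_derive_eq.
by rewrite !scaleRE; lra.
Qed.

End OneVariable.

(** * Calculus rules *)
Section LinearMaps.
Context {R : realType} {V W : normedModType R}.

Lemma smooth_on_linear (U : set V) (f : V -> W) :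
  linear f -> continuous f -> smooth_on U f.
Proof.
move=> lf cf; pose fM := GRing.isLinear.Build _ _ _ _ _ lf.
pose fL : {linear V -> W} := HB.pack f fM.
by apply/smooth_onP => n; exact: (@Ck_lin _ _ _ n U fL cf).
Qed.

(** Stated for linearity as a property, since the coordinates used below are plain
    functions. *)
Lemma is_derive_linear_comp (X : normedModType R) (f : V -> W) (k : X -> V) x v dk :
  linear f -> continuous f -> is_derive x v k dk ->
  is_derive x v (fun y => f (k y)) (f dk).
Proof.
move=> lf cf [kd <-]; pose fM := GRing.isLinear.Build _ _ _ _ _ lf.
pose fL : {linear V -> W} := HB.pack f fM.
have E : (fun h : R => h^-1 *: (f (k (h *: v + x)) - f (k x))) =
    f \o (fun h : R => h^-1 *: (k (h *: v + x) - k x)).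
  apply/funext => h /=.
  have fB a b : f (a - b) = f a - f b := linearB fL a b.
  have fZ c a : f (c *: a) = c *: f a := linearZ_LR fL c a.
  by rewrite fZ fB.
have C : (fun h : R => h^-1 *: (f (k (h *: v + x)) - f (k x))) @ 0^' --> f ('D_v k x).
  by rewrite E; apply: cvg_comp kd _; exact: cf.
by apply: DeriveDef; [apply/cvg_ex; exists (f ('D_v k x))|exact/cvg_lim].
Qed.

Lemma is_derive_linear (f : V -> W) x v :
  linear f -> continuous f -> is_derive x v f (f v).
Proof. by move=> lf cf; apply: (@is_derive_linear_comp V f id) => //; exact: is_derive_id. Qed.

End LinearMaps.

Section SmoothCalculus.
Context {R : realType} {V : normedModType R} (U : set V).
Hypothesis oU : open U.
Implicit Types f g : V -> R.

Lemma smooth_on_cst (W : normedModType R) (a : W) : smooth_on U (fun _ => a).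
Proof. by apply/smooth_onP => n; exact: Ck_cst. Qed.

Lemma smooth_onD (W : normedModType R) (f g : V -> W) : smooth_on U f -> smooth_on U g ->
  smooth_on U (fun x => f x + g x).
Proof.
move=> /smooth_onP Cf /smooth_onP Cg; apply/smooth_onP => n.
exact: (CkD oU (Cf n) (Cg n)).
Qed.

Lemma smooth_onM f g : smooth_on U f -> smooth_on U g -> smooth_on U (fun x => f x * g x).
Proof.
move=> /smooth_onP Cf /smooth_onP Cg; apply/smooth_onP => n; exact: CkMl.
Qed.

Lemma smooth_onZ (W : normedModType R) f (a : W) :
  smooth_on U f -> smooth_on U (fun x => f x *: a).
Proof. by move=> /smooth_onP Cf; apply/smooth_onP => n; exact: CkZ. Qed.

Lemma smooth_on_comp (D : set R) (phi : R -> R) f : smooth_on D phi -> smooth_on U f ->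
  (forall x, U x -> D (f x)) -> smooth_on U (fun x => phi (f x)).
Proof.
move=> /smooth_onP Cp /smooth_onP Cf fD; apply/smooth_onP => n.
exact: (Ck_compl oU (Cp n) (Cf n) fD).
Qed.

Lemma smooth_onN f : smooth_on U f -> smooth_on U (fun x => - f x).
Proof.
move=> sf; rewrite (_ : (fun x => - f x) = (fun x => -1 * f x)).
  by apply: smooth_onM => //; exact: smooth_on_cst.
by apply/funext => x; rewrite mulN1r.
Qed.

Lemma smooth_onX f k : smooth_on U f -> smooth_on U (fun x => f x ^+ k).
Proof.
move=> sf; elim: k => [|k IHk].
  by rewrite (_ : (fun x => _) = fun _ => 1); [exact: smooth_on_cst|apply/funext => x].
rewrite (_ : (fun x => _) = fun x => f x * f x ^+ k); first exact: smooth_onM.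
by apply/funext => x; rewrite exprS.
Qed.

Lemma smooth_onV f : smooth_on U f -> (forall x, U x -> f x != 0) ->
  smooth_on U (fun x => (f x)^-1).
Proof.
move=> sf f0; apply: (smooth_on_comp _ sf f0).
by apply/smooth_onP; exact: Ck_inv.
Qed.

Lemma smooth_on_sin f : smooth_on U f -> smooth_on U (fun x => sin (f x)).
Proof. by move=> sf; apply: (@smooth_on_comp setT) => //; apply/smooth_onP; exact: Ck_sin. Qed.
Lemma smooth_on_cos f : smooth_on U f -> smooth_on U (fun x => cos (f x)).
Proof. by move=> sf; apply: (@smooth_on_comp setT) => //; apply/smooth_onP; exact: Ck_cos. Qed.
Lemma smooth_on_expR f : smooth_on U f -> smooth_on U (fun x => expR (f x)).
Proof. by move=> sf; apply: (@smooth_on_comp setT) => //; apply/smooth_onP; exact: Ck_expR. Qed.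
Lemma smooth_on_atan f : smooth_on U f -> smooth_on U (fun x => atan (f x)).
Proof. by move=> sf; apply: (@smooth_on_comp setT) => //; apply/smooth_onP; exact: Ck_atan. Qed.
Lemma smooth_on_cos_sqrt f : smooth_on U f -> smooth_on U (fun x => cos_sqrt (f x)).
Proof. by move=> sf; apply: (@smooth_on_comp setT) => //; apply/smooth_onP; exact: Ck_cos_sqrt. Qed.
Lemma smooth_on_sinc_sqrt f : smooth_on U f -> smooth_on U (fun x => sinc_sqrt (f x)).
Proof. by move=> sf; apply: (@smooth_on_comp setT) => //; apply/smooth_onP; exact: Ck_sinc_sqrt. Qed.
Lemma smooth_on_sqrt f : smooth_on U f -> (forall x, U x -> 0 < f x) ->
  smooth_on U (fun x => Num.sqrt (f x)).
Proof. by move=> sf f0; apply: (smooth_on_comp _ sf f0); apply/smooth_onP; exact: Ck_sqrt. Qed.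

Lemma smooth_on_subset (W : normedModType R) (U' : set V) (f : V -> W) :
  U' `<=` U -> smooth_on U f -> smooth_on U' f.
Proof. by move=> sU sf s x /sU; exact: sf. Qed.

Lemma smooth_of_smooth_on (W : normedModType R) (S : set V) (f : V -> W) :
  S `<=` U -> smooth_on U f -> Defs.smooth S f.
Proof. by move=> sU sf x Sx; exists U, f; split=> //; exact: sU. Qed.

End SmoothCalculus.

Section DeriveCalculus.
Context {R : realType} {V : normedModType R}.
Variables (x v : V).
Implicit Types f g : V -> R.

Lemma is_derive_fcst (W : normedModType R) (a : W) : is_derive x v (fun _ => a) 0.
Proof. exact: is_derive_cst. Qed.

Lemma is_derive_fD (W : normedModType R) (f g : V -> W) a b : is_derive x v f a ->
  is_derive x v g b -> is_derive x v (fun y => f y + g y) (a + b).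
Proof. by move=> ? ?; exact: is_deriveD. Qed.

Lemma is_derive_fN f a : is_derive x v f a -> is_derive x v (fun y => - f y) (- a).
Proof. by move=> ?; exact: is_deriveN. Qed.

Lemma is_derive_fM f g a b : is_derive x v f a -> is_derive x v g b ->
  is_derive x v (fun y => f y * g y) (a * g x + f x * b).
Proof.
move=> ? ?; apply: is_derive_eq.
by rewrite !scaleRE addrC mulrC.
Qed.

Lemma is_derive_fsqr f a : is_derive x v f a ->
  is_derive x v (fun y => f y ^+ 2) (2 * f x * a).
Proof.
move=> df; rewrite (_ : (fun y => _) = (fun y => f y * f y)).
  by apply: is_derive_eq (is_derive_fM df df) _; ring.
by apply/funext => y; rewrite expr2.
Qed.

Lemma is_derive_fV f a : f x != 0 -> is_derive x v f a ->
  is_derive x v (fun y => (f y)^-1) (- (a / f x ^+ 2)).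
Proof.
move=> f0 [df <-]; apply: DeriveDef; first exact: derivableV.
by rewrite deriveV // scaleRE mulNr mulrC.
Qed.

Lemma derive_alongE (W : normedModType R) (f : V -> W) :
  'D_v f x = 'D_1 (fun h : R => f (h *: v + x)) 0.
Proof.
rewrite /derive; set g1 := fun h => h^-1 *: _; set g2 := fun h => h^-1 *: _.
suff -> : g1 = g2 by [].
by rewrite funeqE /g1 /g2 => h /=; rewrite addr0 scale0r add0r [_%:A]mulr1.
Qed.

Lemma is_derive_fcomp (phi : R -> R) f a b : is_derive (f x) (1 : R) phi b ->
  is_derive x v f a -> is_derive x v (fun y => phi (f y)) (b * a).
Proof.
move=> dphi df; case: (df) => /derivable1P df1 dfE.
have -> : b * a = 'D_1 (phi \o (fun h : R => f (h *: v + x))) 0.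
  have d0 : is_derive (0:R) (1 : R) (fun h : R => f (h *: v + x)) a.
    by apply: DeriveDef => //; rewrite -dfE derive_alongE.
  have dphi' : is_derive (f (0 *: v + x)) (1 : R) phi b by rewrite scale0r add0r.
  by have [_ ->] := @is_derive1_comp _ phi (fun h : R => f (h *: v + x)) 0 b a dphi' d0.
have dc : derivable (phi \o (fun h : R => f (h *: v + x))) 0 1.
  apply/derivable1_diffP; apply: differentiable_comp; first exact/derivable1_diffP.
  by rewrite scale0r add0r; apply/derivable1_diffP; case: dphi.
apply: DeriveDef; first exact/derivable1P.
by rewrite derive_alongE.
Qed.

Lemma is_derive_fsin f a : is_derive x v f a ->
  is_derive x v (fun y => sin (f y)) (cos (f x) * a).
Proof. exact: is_derive_fcomp. Qed.
Lemma is_derive_fcos f a : is_derive x v f a ->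
  is_derive x v (fun y => cos (f y)) (- sin (f x) * a).
Proof. exact: is_derive_fcomp. Qed.
Lemma is_derive_fexpR f a : is_derive x v f a ->
  is_derive x v (fun y => expR (f y)) (expR (f x) * a).
Proof. exact: is_derive_fcomp. Qed.
Lemma is_derive_fatan f a : is_derive x v f a ->
  is_derive x v (fun y => atan (f y)) ((1 + f x ^+ 2)^-1 * a).
Proof. exact: is_derive_fcomp. Qed.
Lemma is_derive_fsqrt f a : 0 < f x -> is_derive x v f a ->
  is_derive x v (fun y => Num.sqrt (f y)) ((2 * Num.sqrt (f x))^-1 * a).
Proof. by move=> f0; apply: is_derive_fcomp; exact: is_derive1_sqrt. Qed.

End DeriveCalculus.

Lemma is_derive_fid (R : realType) (x : R) : is_derive x (1 : R) (fun y => y) 1.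
Proof. exact: is_derive_id. Qed.

(** The rules are refined without class resolution: the instances of [is_derive]
    would leave derivatives of another shape than the expected ones. *)
Ltac derive_rule := first [ eassumption
  | notypeclasses refine (is_derive_fN _) | notypeclasses refine (is_derive_fsqr _)
  | notypeclasses refine (is_derive_fV _ _) | notypeclasses refine (is_derive_fsin _)
  | notypeclasses refine (is_derive_fcos _) | notypeclasses refine (is_derive_fexpR _)
  | notypeclasses refine (is_derive_fatan _) | notypeclasses refine (is_derive_fsqrt _ _)
  | notypeclasses refine (is_derive_fid _) | notypeclasses refine (is_derive_fcst _ _ _)
  | notypeclasses refine (is_derive_fD _ _) | notypeclasses refine (is_derive_fM _ _) ].
Ltac derive_rules := repeat derive_rule.
Ltac derive_by_rules := notypeclasses refine (is_derive_eq _ _); first derive_rules.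

(** * Coordinates *)
Section LinCont.
Context {R : realType}.

Definition lincont (V W : normedModType R) (f : V -> W) := linear f /\ continuous f.

Lemma lincont_comp (V W X : normedModType R) (f : V -> W) (g : W -> X) :
  lincont f -> lincont g -> lincont (fun x => g (f x)).
Proof.
move=> [lf cf] [lg cg]; split=> [a x y|x].
  by rewrite lf lg.
by apply: (@continuous_comp _ _ _ f g); [exact: cf|exact: cg].
Qed.

Lemma lincont_fst (V W : normedModType R) : lincont (@fst V W).
Proof. by split=> // x; exact: cvg_fst. Qed.
Lemma lincont_snd (V W : normedModType R) : lincont (@snd V W).
Proof. by split=> // x; exact: cvg_snd. Qed.

Lemma lincont_coord n (i : 'I_n) : lincont (fun p : 'rV[R]_n => p 0 i : R).
Proof.
by split=> [a x y|x]; [rewrite !mxE|exact: coord_continuous].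
Qed.

Lemma lincont_scale (W : normedModType R) (a : W) : lincont (fun r : R => r *: a).
Proof.
by split=> [b x y|x]; [rewrite scalerDl scalerA|exact: scalel_continuous].
Qed.

Lemma lincont_smooth_on (V W : normedModType R) U (f : V -> W) : lincont f -> smooth_on U f.
Proof. by case; exact: smooth_on_linear. Qed.

Lemma lincont_is_derive (V W X : normedModType R) (f : V -> W) (k : X -> V) x v dk :
  lincont f -> is_derive x v k dk -> is_derive x v (fun y => f (k y)) (f dk).
Proof. by case; exact: is_derive_linear_comp. Qed.

Lemma is_derive_fZ (V W : normedModType R) (x v : V) (a : W) (k : V -> R) dk :
  is_derive x v k dk -> is_derive x v (fun y => k y *: a) (dk *: a).
Proof. exact: (lincont_is_derive (lincont_scale a)). Qed.

End LinCont.

Section Rows.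
Context {R : realType}.

Definition row3 (a b c : R) : 'rV[R]_3 := \row_(i < 3) nth 0 [:: a; b; c] i.
Definition row2 (a b : R) : 'rV[R]_2 := \row_(i < 2) nth 0 [:: a; b] i.
Definition coord0 (p : 'rV[R]_2) : R := p 0 (inord 0).
Definition coord1 (p : 'rV[R]_2) : R := p 0 (inord 1).

Lemma cx_row3 a b c : cx (row3 a b c) = a. Proof. by rewrite /cx mxE inordK. Qed.
Lemma cy_row3 a b c : cy (row3 a b c) = b. Proof. by rewrite /cy mxE inordK. Qed.
Lemma cz_row3 a b c : cz (row3 a b c) = c. Proof. by rewrite /cz mxE inordK. Qed.
Lemma coord0_row2 a b : coord0 (row2 a b) = a. Proof. by rewrite /coord0 mxE inordK. Qed.
Lemma coord1_row2 a b : coord1 (row2 a b) = b. Proof. by rewrite /coord1 mxE inordK. Qed.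
Definition rowcE := (cx_row3, cy_row3, cz_row3, coord0_row2, coord1_row2).

Lemma ord3P (P : 'I_3 -> Prop) : P (inord 0) -> P (inord 1) -> P (inord 2) -> forall i, P i.
Proof.
move=> P0 P1 P2 [m lm]; case: m lm => [|[|[|m]]] lm //.
- by rewrite (_ : Ordinal lm = inord 0) //; apply/val_inj; rewrite /= inordK.
- by rewrite (_ : Ordinal lm = inord 1) //; apply/val_inj; rewrite /= inordK.
- by rewrite (_ : Ordinal lm = inord 2) //; apply/val_inj; rewrite /= inordK.
Qed.
Lemma ord2P (P : 'I_2 -> Prop) : P (inord 0) -> P (inord 1) -> forall i, P i.
Proof.
move=> P0 P1 [m lm]; case: m lm => [|[|m]] lm //.
- by rewrite (_ : Ordinal lm = inord 0) //; apply/val_inj; rewrite /= inordK.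
- by rewrite (_ : Ordinal lm = inord 1) //; apply/val_inj; rewrite /= inordK.
Qed.

Lemma rV3P (p q : 'rV[R]_3) : cx p = cx q -> cy p = cy q -> cz p = cz q -> p = q.
Proof. by move=> ? ? ?; apply/rowP; exact: ord3P. Qed.
Lemma rV2P (p q : 'rV[R]_2) : coord0 p = coord0 q -> coord1 p = coord1 q -> p = q.
Proof. by move=> ? ?; apply/rowP; exact: ord2P. Qed.

Lemma row3_id p : row3 (cx p) (cy p) (cz p) = p.
Proof. by apply: rV3P; rewrite rowcE. Qed.
Lemma row2_id p : row2 (coord0 p) (coord1 p) = p.
Proof. by apply: rV2P; rewrite rowcE. Qed.

Lemma sum3E (V : zmodType) (F : 'I_3 -> V) : \sum_i F i = F (inord 0) + F (inord 1) + F (inord 2).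
Proof.
rewrite !big_ord_recr big_ord0 /= add0r.
by congr (F _ + F _ + F _); apply/val_inj; rewrite /= inordK.
Qed.
Lemma sum2E (V : zmodType) (F : 'I_2 -> V) : \sum_i F i = F (inord 0) + F (inord 1).
Proof.
rewrite !big_ord_recr big_ord0 /= add0r.
by congr (F _ + F _); apply/val_inj; rewrite /= inordK.
Qed.

Lemma sphere2P p : @sphere R 2 p <-> cx p ^+ 2 + cy p ^+ 2 + cz p ^+ 2 = 1.
Proof. by rewrite /sphere /= sum3E. Qed.
Lemma sphere1P p : @sphere R 1 p <-> coord0 p ^+ 2 + coord1 p ^+ 2 = 1.
Proof. by rewrite /sphere /= sum2E. Qed.

Lemma sphere_e1 : @sphere R 2 (row3 1 0 0).
Proof. by apply/sphere2P; rewrite !rowcE expr1n expr0n !addr0. Qed.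

Lemma circE t : circ t = row2 (cos t) (sin t) :> 'rV[R]_2.
Proof.
apply: rV2P; rewrite !rowcE /coord0 /coord1 mxE.
  by rewrite (_ : inord 0 = ord0) ?eqxx //; apply/val_inj; rewrite /= inordK.
by case: eqP => // /(congr1 val); rewrite /= inordK.
Qed.

Lemma lincont_cx : lincont (@cx R). Proof. exact: lincont_coord. Qed.
Lemma lincont_cy : lincont (@cy R). Proof. exact: lincont_coord. Qed.
Lemma lincont_cz : lincont (@cz R). Proof. exact: lincont_coord. Qed.
Lemma lincont_coord0 : lincont coord0. Proof. exact: lincont_coord. Qed.
Lemma lincont_coord1 : lincont coord1. Proof. exact: lincont_coord. Qed.

End Rows.

Section E7.
Context {R : realType}.
Local Notation E := (E7 R).

Definition co_x (P : E) : R := cx P.1.1.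
Definition co_y (P : E) : R := cy P.1.1.
Definition co_z (P : E) : R := cz P.1.1.
Definition co_u (P : E) : R := coord0 P.1.2.
Definition co_v (P : E) : R := coord1 P.1.2.
Definition co_c (P : E) : R := coord0 P.2.
Definition co_s (P : E) : R := coord1 P.2.

Definition mk7 (x y z u v p q : R) : E := (row3 x y z, row2 u v, row2 p q).

Lemma co_x_mk7 x y z u v p q : co_x (mk7 x y z u v p q) = x. Proof. exact: cx_row3. Qed.
Lemma co_y_mk7 x y z u v p q : co_y (mk7 x y z u v p q) = y. Proof. exact: cy_row3. Qed.
Lemma co_z_mk7 x y z u v p q : co_z (mk7 x y z u v p q) = z. Proof. exact: cz_row3. Qed.
Lemma co_u_mk7 x y z u v p q : co_u (mk7 x y z u v p q) = u. Proof. exact: coord0_row2. Qed.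
Lemma co_v_mk7 x y z u v p q : co_v (mk7 x y z u v p q) = v. Proof. exact: coord1_row2. Qed.
Lemma co_c_mk7 x y z u v p q : co_c (mk7 x y z u v p q) = p. Proof. exact: coord0_row2. Qed.
Lemma co_s_mk7 x y z u v p q : co_s (mk7 x y z u v p q) = q. Proof. exact: coord1_row2. Qed.
Definition mk7E := (co_x_mk7, co_y_mk7, co_z_mk7, co_u_mk7, co_v_mk7, co_c_mk7, co_s_mk7).

Lemma mk7_id P : mk7 (co_x P) (co_y P) (co_z P) (co_u P) (co_v P) (co_c P) (co_s P) = P.
Proof. by case: P => [[a b] c]; rewrite /mk7 /= row3_id !row2_id. Qed.

Lemma co_inj (P Q : E) : co_x P = co_x Q -> co_y P = co_y Q -> co_z P = co_z Q -> co_u P = co_u Q ->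
  co_v P = co_v Q -> co_c P = co_c Q -> co_s P = co_s Q -> P = Q.
Proof. by move=> h1 h2 h3 h4 h5 h6 h7; rewrite -(mk7_id P) -(mk7_id Q) h1 h2 h3 h4 h5 h6 h7. Qed.

Let L1 : lincont (fun P : E => P.1.1).
Proof. exact: (lincont_comp (lincont_fst _ _) (lincont_fst _ _)). Qed.
Let L2 : lincont (fun P : E => P.1.2).
Proof. exact: (lincont_comp (lincont_fst _ _) (lincont_snd _ _)). Qed.
Let L3 : lincont (fun P : E => P.2). Proof. exact: lincont_snd. Qed.
Lemma lincont_co_x : lincont co_x. Proof. exact: (lincont_comp L1 lincont_cx). Qed.
Lemma lincont_co_y : lincont co_y. Proof. exact: (lincont_comp L1 lincont_cy). Qed.
Lemma lincont_co_z : lincont co_z. Proof. exact: (lincont_comp L1 lincont_cz). Qed.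
Lemma lincont_co_u : lincont co_u. Proof. exact: (lincont_comp L2 lincont_coord0). Qed.
Lemma lincont_co_v : lincont co_v. Proof. exact: (lincont_comp L2 lincont_coord1). Qed.
Lemma lincont_co_c : lincont co_c. Proof. exact: (lincont_comp L3 lincont_coord0). Qed.
Lemma lincont_co_s : lincont co_s. Proof. exact: (lincont_comp L3 lincont_coord1). Qed.

Lemma co_xL a P Q : co_x (a *: P + Q) = a * co_x P + co_x Q. Proof. exact: lincont_co_x.1. Qed.
Lemma co_yL a P Q : co_y (a *: P + Q) = a * co_y P + co_y Q. Proof. exact: lincont_co_y.1. Qed.
Lemma co_zL a P Q : co_z (a *: P + Q) = a * co_z P + co_z Q. Proof. exact: lincont_co_z.1. Qed.
Lemma co_uL a P Q : co_u (a *: P + Q) = a * co_u P + co_u Q. Proof. exact: lincont_co_u.1. Qed.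
Lemma co_vL a P Q : co_v (a *: P + Q) = a * co_v P + co_v Q. Proof. exact: lincont_co_v.1. Qed.
Lemma co_cL a P Q : co_c (a *: P + Q) = a * co_c P + co_c Q. Proof. exact: lincont_co_c.1. Qed.
Lemma co_sL a P Q : co_s (a *: P + Q) = a * co_s P + co_s Q. Proof. exact: lincont_co_s.1. Qed.
Definition co_linear := (co_xL, co_yL, co_zL, co_uL, co_vL, co_cL, co_sL).

Lemma S2S1S1P P : @S2S1S1 R P <-> [/\ co_x P ^+ 2 + co_y P ^+ 2 + co_z P ^+ 2 = 1,
  co_u P ^+ 2 + co_v P ^+ 2 = 1 & co_c P ^+ 2 + co_s P ^+ 2 = 1].
Proof.
split=> [[[/sphere2P h1 /sphere1P h2] /sphere1P h3]|[h1 h2 h3]]; first by split.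
by split; [split|]; [exact/sphere2P|exact/sphere1P|exact/sphere1P].
Qed.

Lemma sliceP t P : @slice R t P <-> [/\ co_x P ^+ 2 + co_y P ^+ 2 + co_z P ^+ 2 = 1,
  co_u P ^+ 2 + co_v P ^+ 2 = 1, co_c P = cos t & co_s P = sin t].
Proof.
split=> [[[/sphere2P h1 /sphere1P h2] /= h3]|[h1 h2 h3 h4]].
  by split=> //; rewrite ?/co_c ?/co_s h3 circE rowcE.
split; [split|]; [exact/sphere2P|exact/sphere1P|].
by rewrite /= circE; apply: rV2P; rewrite rowcE.
Qed.

(** Vector-valued maps are sums of scalar maps times constant vectors; this
    reduces their smoothness and derivatives to those of the components. *)
Definition basis7 (i : nat) : E := mk7 (i == 0)%:R (i == 1)%:R (i == 2)%:R (i == 3)%:R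
  (i == 4)%:R (i == 5)%:R (i == 6)%:R.

Lemma mk7_sum x y z u v p q : mk7 x y z u v p q =
  x *: basis7 0 + (y *: basis7 1 + (z *: basis7 2 + (u *: basis7 3 + (v *: basis7 4 + (p *: basis7 5 + (q *: basis7 6 + 0)))))).
Proof.
have e0 : mk7 0 0 0 0 0 0 0 = 0.
  rewrite /mk7 -[RHS]/((0, 0), 0); congr ((_, _), _);
    by [apply: rV3P; rewrite rowcE /cx /cy /cz mxE|apply: rV2P; rewrite rowcE /coord0 /coord1 mxE].
by apply: co_inj; rewrite !co_linear -e0 !mk7E /=; ring.
Qed.

Lemma smooth_on_mk7 (V : normedModType R) (U : set V) (x y z u v p q : V -> R) : open U ->
  smooth_on U x -> smooth_on U y -> smooth_on U z -> smooth_on U u ->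
  smooth_on U v -> smooth_on U p -> smooth_on U q ->
  smooth_on U (fun s => mk7 (x s) (y s) (z s) (u s) (v s) (p s) (q s)).
Proof.
move=> oU *; under eq_fun do rewrite mk7_sum.
do 7 (apply: (smooth_onD oU); first exact: smooth_onZ).
exact: smooth_on_cst.
Qed.

Lemma is_derive_mk7 (V : normedModType R) (s w : V) (x y z u v p q : V -> R)
    (x' y' z' u' v' p' q' : R) :
  is_derive s w x x' -> is_derive s w y y' -> is_derive s w z z' ->
  is_derive s w u u' -> is_derive s w v v' -> is_derive s w p p' ->
  is_derive s w q q' ->
  is_derive s w (fun s => mk7 (x s) (y s) (z s) (u s) (v s) (p s) (q s))
    (mk7 x' y' z' u' v' p' q').
Proof.
move=> *; under eq_fun do rewrite mk7_sum.
rewrite mk7_sum.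
by do 7 (apply: is_derive_fD; first exact: is_derive_fZ).
Qed.

Definition basis3 (i : nat) : 'rV[R]_3 := row3 (i == 0)%:R (i == 1)%:R (i == 2)%:R.
Lemma row3_sum a b c : row3 a b c = a *: basis3 0 + (b *: basis3 1 + (c *: basis3 2 + 0)).
Proof.
by apply: rV3P; rewrite rowcE /cx /cy /cz !mxE !inordK //=; ring.
Qed.

Lemma smooth_on_row3 (V : normedModType R) (U : set V) (a b c : V -> R) : open U ->
  smooth_on U a -> smooth_on U b -> smooth_on U c ->
  smooth_on U (fun s => row3 (a s) (b s) (c s)).
Proof.
move=> oU *; under eq_fun do rewrite row3_sum.
do 3 (apply: (smooth_onD oU); first exact: smooth_onZ).
exact: smooth_on_cst.
Qed.

Lemma is_derive_row3 (V : normedModType R) (s w : V) (a b c : V -> R) (a' b' c' : R) :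
  is_derive s w a a' -> is_derive s w b b' -> is_derive s w c c' ->
  is_derive s w (fun s => row3 (a s) (b s) (c s)) (row3 a' b' c').
Proof.
move=> *; under eq_fun do rewrite row3_sum.
rewrite row3_sum.
by do 3 (apply: is_derive_fD; first exact: is_derive_fZ).
Qed.

Lemma lincont_pairl (V W : normedModType R) : lincont (fun v : V => (v, 0 : W)).
Proof.
split=> [a x y|x]; last by apply: cvg_pair; [exact: cvg_id|exact: cvg_cst].
by rewrite -[RHS]/(_, a *: 0 + 0) scaler0 addr0.
Qed.

Lemma lincont_pairr (V W : normedModType R) : lincont (fun w : W => (0 : V, w)).
Proof.
split=> [a x y|x]; last by apply: cvg_pair; [exact: cvg_cst|exact: cvg_id].
by rewrite -[RHS]/(a *: 0 + 0, _) scaler0 addr0.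
Qed.

Lemma smooth_on_lincont (V W X : normedModType R) (U : set V) (f : V -> W) (g : W -> X) :
  open U -> lincont g -> smooth_on U f -> smooth_on U (fun x => g (f x)).
Proof.
move=> oU [lg cg] /smooth_onP Cf; apply/smooth_onP => n.
pose gM := GRing.isLinear.Build _ _ _ _ _ lg.
pose gL : {linear W -> X} := HB.pack g gM.
exact: (@Ck_linl _ _ _ _ n U f gL oU cg).
Qed.

Lemma pair_sum (V W : normedModType R) (f : V) (g : W) : (f, g) = (f, 0) + (0, g).
Proof. by rewrite -[RHS]/(f + 0, 0 + g) addr0 add0r. Qed.

Lemma smooth_on_pair (V W X : normedModType R) (U : set V) (f : V -> W) (g : V -> X) : open U ->
  smooth_on U f -> smooth_on U g -> smooth_on U (fun s => (f s, g s)).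
Proof.
move=> oU sf sg; under eq_fun do rewrite pair_sum.
by apply: (smooth_onD oU); [exact: smooth_on_lincont (lincont_pairl _ _) sf|exact: smooth_on_lincont (lincont_pairr _ _) sg].
Qed.

End E7.

(** * Stereographic projections *)
Section Stereo.
Context {R : realType}.
Implicit Types a b s u v x y z e d k : R.

Definition is_sign (e : R) := e = 1 \/ e = -1.

Lemma is_sign_neq0 e : is_sign e -> e != 0.
Proof. by case=> ->; rewrite ?oppr_eq0 oner_eq0. Qed.

Lemma is_sign_cases e e' : is_sign e -> is_sign e' -> e' = e \/ e' = - e.
Proof. by case=> ->; case=> ->; rewrite ?opprK; [left|right|right|left]. Qed.

Lemma one_sqr_neq0 s : 1 + s ^+ 2 != 0.
Proof. by rewrite gt_eqF // ltr_pwDl // sqr_ge0. Qed.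

Lemma one_sqr2_neq0 a b : 1 + (a ^+ 2 + b ^+ 2) != 0.
Proof. by rewrite gt_eqF // ltr_pwDl // addr_ge0 // sqr_ge0. Qed.

(** The circle is projected from the point (- d, 0); the slope s of the
    projection is the tangent of half the angle from (d, 0). *)
Lemma circ_of_slope d u v : is_sign d -> u ^+ 2 + v ^+ 2 = 1 -> 1 + d * u != 0 ->
  let s := d * v / (1 + d * u) in
  d * ((1 - s ^+ 2) / (1 + s ^+ 2)) = u /\ d * (2 * s / (1 + s ^+ 2)) = v.
Proof.
move=> sd uv du s.
have E : 1 + s ^+ 2 = 2 / (1 + d * u).
  apply: (mulIf (expf_neq0 2 du)); rewrite /s.
  have -> : (1 + (d * v / (1 + d * u)) ^+ 2) * (1 + d * u) ^+ 2 =
    (1 + d * u) ^+ 2 + d ^+ 2 * v ^+ 2 by field.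
  have -> : v ^+ 2 = 1 - u ^+ 2 by rewrite -uv addrC addKr.
  by case: sd du => ->; rewrite ?mul1r ?mulN1r => du; field.
have E2 : 1 - s ^+ 2 = 2 - 2 / (1 + d * u) by rewrite -E; ring.
rewrite E E2 /s; split; by case: sd du => ->; rewrite ?mul1r ?mulN1r => du; field.
Qed.

Lemma slope_of_circ d s : is_sign d ->
  let u := d * ((1 - s ^+ 2) / (1 + s ^+ 2)) in
  let v := d * (2 * s / (1 + s ^+ 2)) in
  [/\ u ^+ 2 + v ^+ 2 = 1, 1 + d * u = 2 / (1 + s ^+ 2) & d * v / (1 + d * u) = s].
Proof.
move=> sd u v; have s0 := one_sqr_neq0 s.
have E : 1 + d * u = 2 / (1 + s ^+ 2) by rewrite /u; case: sd => ->; field.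
split=> //; first by rewrite /u /v; case: sd => ->; field.
by rewrite E /v; case: sd => ->; field.
Qed.

Lemma slope_opp d s : is_sign d ->
  let u := d * ((1 - s ^+ 2) / (1 + s ^+ 2)) in
  let v := d * (2 * s / (1 + s ^+ 2)) in
  1 + - d * u = 2 * s ^+ 2 / (1 + s ^+ 2) /\ - d * v / (1 + - d * u) = - s^-1.
Proof.
move=> sd u v; have s0 := one_sqr_neq0 s.
have E : 1 + - d * u = 2 * s ^+ 2 / (1 + s ^+ 2) by rewrite /u; case: sd => ->; field.
split=> //; rewrite E /v; have [->|sn0] := eqVneq s 0.
  by rewrite invr0 !(mulr0,mul0r) oppr0.
by case: sd => ->; field; rewrite s0 sn0.
Qed.

(** The sphere is projected from the pole z = - e. The factor e in the second
    coordinate makes the changes of charts preserve the orientation. *)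
Lemma sphere_of_plane e x y z : is_sign e -> x ^+ 2 + y ^+ 2 + z ^+ 2 = 1 -> 1 + e * z != 0 ->
  let a := x / (1 + e * z) in let b := e * y / (1 + e * z) in
  let n := a ^+ 2 + b ^+ 2 in
  [/\ 2 * a / (1 + n) = x, e * (2 * b / (1 + n)) = y & e * ((1 - n) / (1 + n)) = z].
Proof.
move=> se xyz ez a b n.
have E : 1 + n = 2 / (1 + e * z).
  apply: (mulIf (expf_neq0 2 ez)); rewrite /n /a /b.
  have -> : (1 + ((x / (1 + e * z)) ^+ 2 + (e * y / (1 + e * z)) ^+ 2)) * (1 + e * z) ^+ 2 =
    (1 + e * z) ^+ 2 + (x ^+ 2 + e ^+ 2 * y ^+ 2) by field.
  have -> : x ^+ 2 = 1 - z ^+ 2 - y ^+ 2 by rewrite -xyz; ring.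
  by case: se ez => ->; rewrite ?mul1r ?mulN1r => ez; field.
have E2 : 1 - n = 2 - 2 / (1 + e * z) by rewrite -E; ring.
rewrite E E2 /a /b; split; by case: se ez => ->; rewrite ?mul1r ?mulN1r => ez; field.
Qed.

Lemma plane_of_sphere e a b : is_sign e ->
  let n := a ^+ 2 + b ^+ 2 in
  let x := 2 * a / (1 + n) in let y := e * (2 * b / (1 + n)) in
  let z := e * ((1 - n) / (1 + n)) in
  [/\ x ^+ 2 + y ^+ 2 + z ^+ 2 = 1, 1 + e * z = 2 / (1 + n), x / (1 + e * z) = a &
    e * y / (1 + e * z) = b].
Proof.
move=> se n x y z; have n0 : 1 + n != 0 := one_sqr2_neq0 a b.
have E : 1 + e * z = 2 / (1 + n) by rewrite /z; case: se => ->; field.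
split=> //.
- by move: n0; rewrite /x /y /z /n => n0; case: se => ->; field.
- by rewrite E /x; field.
- by rewrite E /y; case: se => ->; field.
Qed.

Lemma plane_opp e a b : is_sign e ->
  let n := a ^+ 2 + b ^+ 2 in
  let x := 2 * a / (1 + n) in let y := e * (2 * b / (1 + n)) in
  let z := e * ((1 - n) / (1 + n)) in
  [/\ 1 + - e * z = 2 * n / (1 + n), x / (1 + - e * z) = a / n &
    - e * y / (1 + - e * z) = - b / n].
Proof.
move=> se n x y z; have n0 : 1 + n != 0 := one_sqr2_neq0 a b.
have E : 1 + - e * z = 2 * n / (1 + n) by rewrite /z; case: se => ->; field.
have [nz|nn0] := eqVneq n 0.
  by split=> //; rewrite E nz !(mulr0,mul0r,invr0).
split=> //; rewrite E.
- by rewrite /x; field; rewrite n0 nn0.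
- by rewrite /y; case: se => ->; field; rewrite n0 nn0.
Qed.

Lemma atanV_gt0 s : 0 < s -> atan s^-1 = pi / 2 - atan s.
Proof.
move=> s0; have as0 : 0 < atan s by rewrite -atan0; exact: lt_atan.
have := atan_ltpi2 s => as1.
rewrite -[RHS]tanK; last by rewrite in_itv /=; apply/andP; split; lra.
congr atan; rewrite -[in LHS](atanK s) /tan.
have -> : sin (pi / 2 - atan s) = cos (atan s).
  by rewrite -cosN -[in RHS](opprK (atan s)) opprK -cosBpihalf; congr cos; ring.
have -> : cos (pi / 2 - atan s) = sin (atan s).
  by rewrite -cosBpihalf -cosN; congr cos; ring.
by rewrite invf_div.
Qed.

(** atan s + atan (1 / s) is pi / 2 or - pi / 2 according to the sign of s: the
    angles read in the two charts of the circle differ by a locally constant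
    amount. *)
Lemma atanV_near s : s != 0 -> \forall t \near s, atan t + atan t^-1 = atan s + atan s^-1.
Proof.
have main (t : R) : 0 < t -> \forall r \near t, atan r + atan r^-1 = pi / 2.
  move=> t0; near=> r; rewrite atanV_gt0; first ring.
  by near: r; exact: lt_nbhsr.
rewrite neq_lt => /orP[s0|s0]; last first.
  by have h := main _ s0; rewrite (nbhs_singleton h).
have h : \forall r \near s, atan r + atan r^-1 = - (pi / 2).
  near=> r; have r0 : 0 < - r by rewrite oppr_gt0; near: r; exact: lt_nbhsl.
  by have := atanV_gt0 r0; rewrite invrN !atanN; lra.
by rewrite (nbhs_singleton h).
Unshelve. all: by end_near. Qed.

End Stereo.

Section OpenSets.
Context {R : realType} {V : normedModType R}.

Lemma smooth_on_continuous (W : normedModType R) (f : V -> W) : smooth_on setT f -> continuous f.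
Proof. by move=> sf x; apply: differentiable_continuous; exact: (sf [::] x). Qed.

Lemma smooth_on_open_neq0 (f : V -> R) : smooth_on setT f -> open [set x | f x != 0].
Proof.
move=> /smooth_on_continuous cf; apply: (@open_comp _ _ f [set x | x != 0]).
  by move=> x _; exact: cf.
exact: open_neq.
Qed.

Lemma smooth_on_open_gt0 (f : V -> R) : smooth_on setT f -> open [set x | 0 < f x].
Proof.
move=> /smooth_on_continuous cf; apply: (@open_comp _ _ f [set x | 0 < x]).
  by move=> x _; exact: cf.
exact: open_gt.
Qed.

Lemma connected_setT : connected [set: V].
Proof.
have -> : [set: V] = \bigcup_(v in [set: V]) ((fun t : R => t *: v) @` setT).
  by apply/seteqP; split=> // v _; exists v => //; exists 1 => //; rewrite scale1r.
apply: bigcup_connected.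
  by exists 0 => v _; exists 0 => //; rewrite scale0r.
move=> v _; apply: connected_continuous_connected.
  by apply/connected_intervalP => x y _ _ z _.
by apply: continuous_subspaceT; exact: scalel_continuous.
Qed.

End OpenSets.

Section WCoord.
Context {R : realType}.
Let L1 : lincont (fun w : 'rV[R]_3 * R => w.1). Proof. exact: lincont_fst. Qed.
Lemma lincont_w1x : lincont (fun w : 'rV[R]_3 * R => cx w.1).
Proof. exact: (lincont_comp L1 lincont_cx). Qed.
Lemma lincont_w1y : lincont (fun w : 'rV[R]_3 * R => cy w.1).
Proof. exact: (lincont_comp L1 lincont_cy). Qed.
Lemma lincont_w1z : lincont (fun w : 'rV[R]_3 * R => cz w.1).
Proof. exact: (lincont_comp L1 lincont_cz). Qed.
Lemma lincont_w2 : lincont (fun w : 'rV[R]_3 * R => w.2 : R).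
Proof. exact: lincont_snd. Qed.
End WCoord.

Ltac smooth_coord := first
  [ exact: (lincont_smooth_on lincont_co_x) | exact: (lincont_smooth_on lincont_co_y)
  | exact: (lincont_smooth_on lincont_co_z) | exact: (lincont_smooth_on lincont_co_u)
  | exact: (lincont_smooth_on lincont_co_v) | exact: (lincont_smooth_on lincont_co_c)
  | exact: (lincont_smooth_on lincont_co_s) | exact: (lincont_smooth_on lincont_cx)
  | exact: (lincont_smooth_on lincont_cy) | exact: (lincont_smooth_on lincont_cz)
  | exact: (lincont_smooth_on lincont_w1x) | exact: (lincont_smooth_on lincont_w1y)
  | exact: (lincont_smooth_on lincont_w1z) | exact: (lincont_smooth_on lincont_w2) ].

(** The rule is selected by the syntax of the function, since unification
    against the wrong rule would unfold the ring operations; the partial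
    applications are the functions that have lost their abstraction by
    eta-contraction. *)
Ltac smooth_rules oU := repeat lazymatch goal with
  | |- smooth_on _ (fun _ => ?a) => exact: smooth_on_cst
  | |- smooth_on _ (fun x => GRing.add (@?f x) (@?g x)) => apply: (smooth_onD oU)
  | |- smooth_on _ (fun x => GRing.opp (@?f x)) => apply: (smooth_onN oU)
  | |- smooth_on _ (fun x => GRing.mul (@?f x) (@?g x)) => apply: (smooth_onM oU)
  | |- smooth_on _ (GRing.add _) => apply: (smooth_onD oU)
  | |- smooth_on _ (@GRing.opp _) => apply: (smooth_onN oU)
  | |- smooth_on _ (GRing.mul _) => apply: (smooth_onM oU)
  | |- smooth_on _ (fun x => GRing.exp (@?f x) _) => apply: (smooth_onX oU)
  | |- smooth_on _ (fun x => GRing.inv (@?f x)) => apply: (smooth_onV oU)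
  | |- smooth_on _ (fun x => sin (@?f x)) => apply: (smooth_on_sin oU)
  | |- smooth_on _ (fun x => cos (@?f x)) => apply: (smooth_on_cos oU)
  | |- smooth_on _ (fun x => expR (@?f x)) => apply: (smooth_on_expR oU)
  | |- smooth_on _ (fun x => atan (@?f x)) => apply: (smooth_on_atan oU)
  | |- smooth_on _ (fun x => cos_sqrt (@?f x)) => apply: (smooth_on_cos_sqrt oU)
  | |- smooth_on _ (fun x => sinc_sqrt (@?f x)) => apply: (smooth_on_sinc_sqrt oU)
  | |- smooth_on _ (fun x => Num.sqrt (@?f x)) => apply: (smooth_on_sqrt oU)
  | |- smooth_on _ (fun x => mk7 (@?a x) (@?b x) (@?c x) (@?d x) (@?e x) (@?f x) (@?g x)) =>
      apply: (smooth_on_mk7 oU)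
  | |- smooth_on _ (fun x => row3 (@?a x) (@?b x) (@?c x)) => apply: (smooth_on_row3 oU)
  | |- smooth_on _ (fun x => (@?f x, @?g x)) => apply: (smooth_on_pair oU)
  | |- smooth_on _ _ => first [eassumption | smooth_coord]
  end.

(** * The foliated atlas *)
Section Charts.
Context {R : realType}.
Local Notation E := (E7 R).
Local Notation M := (@S2S1S1 R).
Implicit Types e d k : R.

Definition slope d (P : E) : R := d * co_v P / (1 + d * co_u P).
(** [height 1] is tan (t / 2) and [height (-1)] is - cot (t / 2), while
    [2 * atan (slope d P)] is the angle s of P, up to a constant; the second
    component of [chart_map] is thus tan (t / 2) e^(-s) or
    - cot (t / 2) e^s, up to a constant factor. *)
Definition height k (P : E) : R := k * co_s P / (1 + k * co_c P).
Definition chart_dom e d k : set E :=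
  [set P | (1 + e * co_z P) * (1 + d * co_u P) * (1 + k * co_c P) != 0].
Definition chart_map e d k (P : E) : 'rV[R]_3 * R :=
  (row3 (co_x P / (1 + e * co_z P)) (e * co_y P / (1 + e * co_z P)) (slope d P),
   height k P * expR (- (k * (2 * atan (slope d P))))).
Definition nrm2 (x : 'rV[R]_3) : R := cx x ^+ 2 + cy x ^+ 2.
Definition inv_height k (w : 'rV[R]_3 * R) : R := w.2 * expR (k * (2 * atan (cz w.1))).
Definition chart_inv e d k (w : 'rV[R]_3 * R) : E :=
  mk7 (2 * cx w.1 / (1 + nrm2 w.1)) (e * (2 * cy w.1 / (1 + nrm2 w.1)))
    (e * ((1 - nrm2 w.1) / (1 + nrm2 w.1)))
    (d * ((1 - cz w.1 ^+ 2) / (1 + cz w.1 ^+ 2))) (d * (2 * cz w.1 / (1 + cz w.1 ^+ 2)))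
    (k * ((1 - inv_height k w ^+ 2) / (1 + inv_height k w ^+ 2)))
    (k * (2 * inv_height k w / (1 + inv_height k w ^+ 2))).
Definition chart e d k : @fchart R E :=
  FChart (M `&` chart_dom e d k) setT setT (chart_map e d k) (chart_inv e d k).
Definition atlas : set (@fchart R E) :=
  [set c | exists e d k, [/\ is_sign e, is_sign d, is_sign k & c = chart e d k]].

Lemma chart_domP e d k P : chart_dom e d k P <->
  [/\ 1 + e * co_z P != 0, 1 + d * co_u P != 0 & 1 + k * co_c P != 0].
Proof. by rewrite /chart_dom /= !mulf_eq0 !negb_or -andbA; split=> /and3P. Qed.

Lemma open_chart_dom e d k : open (chart_dom e d k).
Proof. by have oT := @openT E; apply: smooth_on_open_neq0; smooth_rules oT. Qed.

Lemma smooth_on_chart_map e d k : smooth_on (chart_dom e d k) (chart_map e d k).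
Proof.
have oU := @open_chart_dom e d k.
by rewrite /chart_map /height /slope; smooth_rules oU => P /chart_domP[].
Qed.

Lemma smooth_on_chart_inv e d k U : open U -> smooth_on U (chart_inv e d k).
Proof.
move=> oU; rewrite /chart_inv /inv_height /nrm2; smooth_rules oU => w _; try exact: one_sqr_neq0.
all: exact: one_sqr2_neq0.
Qed.

Lemma chart_inv_M e d k w : is_sign e -> is_sign d -> is_sign k -> M (chart_inv e d k w).
Proof.
move=> se sd sk; apply/S2S1S1P; rewrite /chart_inv !mk7E.
have [h1 _ _ _] := plane_of_sphere (cx w.1) (cy w.1) se.
have [h2 _ _] := slope_of_circ (cz w.1) sd.
by have [h3 _ _] := slope_of_circ (inv_height k w) sk.
Qed.

Lemma chart_inv_dom e d k w : is_sign e -> is_sign d -> is_sign k -> chart_dom e d k (chart_inv e d k w).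
Proof.
move=> se sd sk; apply/chart_domP; rewrite /chart_inv !mk7E.
have [_ -> _ _] := plane_of_sphere (cx w.1) (cy w.1) se.
have [_ -> _] := slope_of_circ (cz w.1) sd.
have [_ -> _] := slope_of_circ (inv_height k w) sk.
by split; rewrite mulf_neq0 ?pnatr_eq0 // invr_eq0 ?one_sqr_neq0 //; exact: one_sqr2_neq0.
Qed.

Lemma chart_invK e d k w : is_sign e -> is_sign d -> is_sign k -> chart_map e d k (chart_inv e d k w) = w.
Proof.
move=> se sd sk; rewrite /chart_map /height /slope /chart_inv !mk7E.
have [_ _ -> ->] := plane_of_sphere (cx w.1) (cy w.1) se.
have [_ _ ->] := slope_of_circ (cz w.1) sd.
have [_ _ ->] := slope_of_circ (inv_height k w) sk.
rewrite /inv_height -mulrA -expRD subrr expR0 mulr1 row3_id; by case: w.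
Qed.

Lemma chart_mapK e d k P : is_sign e -> is_sign d -> is_sign k -> M P -> chart_dom e d k P ->
  chart_inv e d k (chart_map e d k P) = P.
Proof.
move=> se sd sk /S2S1S1P[m1 m2 m3] /chart_domP[d1 d2 d3].
have hE : inv_height k (chart_map e d k P) = height k P.
  by rewrite /inv_height /chart_map /= rowcE -mulrA -expRD addNr expR0 mulr1.
rewrite /chart_inv hE /nrm2 /chart_map /= !rowcE.
have [-> -> ->] := sphere_of_plane se m1 d1.
have [-> ->] := circ_of_slope sd m2 d2.
have [-> ->] := circ_of_slope sk m3 d3.
exact: mk7_id.
Qed.

Lemma is_fchart_chart e d k : is_sign e -> is_sign d -> is_sign k -> is_fchart M (chart e d k).
Proof.
move=> se sd sk; split.
- by exists (chart_dom e d k) => //; exact: open_chart_dom.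
- by do !split; rewrite ?/=; try exact: openT; exact: connected_setT.
- split; first by apply: (smooth_of_smooth_on (@open_chart_dom e d k)) (@smooth_on_chart_map e d k) => P [].
  apply: (@smooth_on_subset _ _ setT) => //; exact: smooth_on_chart_inv openT.
- by move=> P [MP DP]; split=> //; exact: chart_mapK.
- by move=> w _; split; [split; [exact: chart_inv_M|exact: chart_inv_dom]|exact: chart_invK].
Qed.

(** The changes of charts; the boolean says whether the two charts have the same
    sign on the corresponding factor. *)
Definition trans_a (b : bool) (x : 'rV[R]_3) : R := if b then cx x else cx x / nrm2 x.
Definition trans_b (b : bool) (x : 'rV[R]_3) : R := if b then cy x else - cy x / nrm2 x.
Definition trans_slope (b : bool) (s : R) : R := if b then s else - s^-1.
Definition trans_shift (b : bool) (s : R) : R := atan s - atan (trans_slope b s).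
Definition trans_height (b : bool) (K y : R) : R := if b then y * expR K else - y^-1 * expR (- K).

Lemma is_sign_opp e e' : is_sign e -> is_sign e' -> e' != e -> e' = - e.
Proof. by move=> se se' ne; have [E|] := is_sign_cases se se' => //; rewrite E eqxx in ne. Qed.

Section Transition.
Variables e d k e' d' k' : R.
Hypotheses (se : is_sign e) (sd : is_sign d) (sk : is_sign k).
Hypotheses (se' : is_sign e') (sd' : is_sign d') (sk' : is_sign k').

Lemma transE w : chart_map e' d' k' (chart_inv e d k w) =
  (row3 (trans_a (e' == e) w.1) (trans_b (e' == e) w.1) (trans_slope (d' == d) (cz w.1)),
   trans_height (k' == k) (k * (2 * trans_shift (d' == d) (cz w.1))) w.2).
Proof.
have slE : slope d' (chart_inv e d k w) = trans_slope (d' == d) (cz w.1).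
  rewrite /slope /trans_slope /chart_inv !mk7E; case: eqVneq => [->|/(is_sign_opp sd sd') ->].
    by have [_ _ ->] := slope_of_circ (cz w.1) sd.
  by have [_ ->] := slope_opp (cz w.1) sd.
rewrite /chart_map slE; congr (row3 _ _ _, _).
- rewrite /trans_a /chart_inv !mk7E; case: eqVneq => [->|/(is_sign_opp se se') ->].
    by have [_ _ -> _] := plane_of_sphere (cx w.1) (cy w.1) se.
  by have [_ -> _] := plane_opp (cx w.1) (cy w.1) se.
- rewrite /trans_b /chart_inv !mk7E; case: eqVneq => [->|/(is_sign_opp se se') ->].
    by have [_ _ _ ->] := plane_of_sphere (cx w.1) (cy w.1) se.
  by have [_ _ ->] := plane_opp (cx w.1) (cy w.1) se.
rewrite /trans_height /trans_shift; set S := trans_slope _ _.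
have hE : height k' (chart_inv e d k w) = trans_slope (k' == k) (inv_height k w).
  rewrite /height /trans_slope /chart_inv !mk7E; case: eqVneq => [->|/(is_sign_opp sk sk') ->].
    by have [_ _ ->] := slope_of_circ (inv_height k w) sk.
  by have [_ ->] := slope_opp (inv_height k w) sk.
rewrite hE /trans_slope; case: eqVneq => [->|/(is_sign_opp sk sk') ->]; rewrite /inv_height.
  by rewrite -mulrA -expRD; congr (_ * expR _); ring.
rewrite invfM -expRN -!mulNr -mulrA -expRD; congr (_ * expR _); ring.
Qed.

Lemma trans_dom w : chart_dom e' d' k' (chart_inv e d k w) ->
  [/\ (e' == e) || (nrm2 w.1 != 0), (d' == d) || (cz w.1 != 0) & (k' == k) || (w.2 != 0)].
Proof.
move=> /chart_domP; rewrite /chart_inv !mk7E => -[h1 h2 h3]; split.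
- case: eqVneq => //= /(is_sign_opp se se') E; apply: contraNneq h1 => n0; rewrite E.
  have [-> _ _] := plane_opp (cx w.1) (cy w.1) se.
  by rewrite -/(nrm2 _) n0 mulr0 mul0r.
- case: eqVneq => //= /(is_sign_opp sd sd') E; apply: contraNneq h2 => n0; rewrite E.
  by have [-> _] := slope_opp (cz w.1) sd; rewrite n0 expr0n mulr0 mul0r.
- case: eqVneq => //= /(is_sign_opp sk sk') E; apply: contraNneq h3 => n0; rewrite E.
  have [-> _] := slope_opp (inv_height k w) sk.
  by rewrite /inv_height n0 mul0r expr0n mulr0 mul0r.
Qed.
End Transition.

Lemma trans_shift_near b (s : R) : b || (s != 0) -> \forall t \near s, trans_shift b t = trans_shift b s.
Proof.
rewrite /trans_shift /trans_slope; case: b => /= [_|s0]; first by near=> t; rewrite !subrr.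
by apply: filterS (atanV_near s0) => t; rewrite !atanN !opprK.
Unshelve. all: by end_near. Qed.

(** The Jacobian matrix of a change of charts has a block for the sphere and a
    block for the circle. *)
Lemma det3_block (A : 'M[R]_3) : A (inord 2) (inord 0) = 0 -> A (inord 2) (inord 1) = 0 ->
  \det A = (A (inord 0) (inord 0) * A (inord 1) (inord 1) -
    A (inord 0) (inord 1) * A (inord 1) (inord 0)) * A (inord 2) (inord 2).
Proof.
move=> h3 h4; rewrite (expand_det_row _ (inord 2)) sum3E h3 h4 !mul0r !add0r mulrC.
congr (_ * _); rewrite /cofactor (expand_det_row _ ord0) !big_ord_recl big_ord0 /cofactor !det_mx11 !mxE.
have E1 : lift (inord 2 : 'I_3) (ord0 : 'I_2) = inord 0 by apply/val_inj; rewrite /= /bump !inordK.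
have E2 : lift (inord 2 : 'I_3) (lift ord0 ord0 : 'I_2) = inord 1 by apply/val_inj; rewrite /= /bump !inordK.
have F1 : lift (lift ord0 (ord0 : 'I_1)) (0 : 'I_1) = ord0 :> 'I_2 by apply/val_inj.
have F2 : lift ord0 (0 : 'I_1) = lift ord0 ord0 :> 'I_2 by apply/val_inj.
rewrite F1 F2 E1 E2 /= /bump /= !inordK // ; ring.
Qed.

Lemma delta_basis3 (i : nat) : (i < 3)%N -> delta_mx 0 (inord i) = basis3 i :> 'rV[R]_3.
Proof.
move=> i3; apply: rV3P; rewrite rowcE /cx /cy /cz !mxE eqxx /= -!val_eqE /= !inordK //;
  by rewrite eq_sym.
Qed.

Lemma jacobian_row (f : 'rV[R]_3 -> 'rV[R]_3) u (i : nat) df : (i < 3)%N ->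
  differentiable f u -> is_derive u (basis3 i) f df ->
  forall j, 'J f u (inord i) j = df 0 j.
Proof.
by move=> i3 fu [_ <-] j; rewrite /jacobian !mxE delta_basis3 // deriveE.
Qed.

Lemma is_derive_cx (x v : 'rV[R]_3) : is_derive x v cx (cx v).
Proof. by apply: is_derive_linear; case: (@lincont_cx R). Qed.
Lemma is_derive_cy (x v : 'rV[R]_3) : is_derive x v cy (cy v).
Proof. by apply: is_derive_linear; case: (@lincont_cy R). Qed.
Lemma is_derive_cz (x v : 'rV[R]_3) : is_derive x v cz (cz v).
Proof. by apply: is_derive_linear; case: (@lincont_cz R). Qed.

(** The differential of [trans_a] and [trans_b] is that of the holomorphic map
    w |-> w, resp. w |-> 1 / w; this is the conjugate of its complex derivative. *)
Definition dtrans_ab b (u : 'rV[R]_3) : R * R :=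
  if b then (1, 0) else ((cy u ^+ 2 - cx u ^+ 2) / nrm2 u ^+ 2, - (2 * cx u * cy u) / nrm2 u ^+ 2).

Lemma is_derive_trans_a b (u v : 'rV[R]_3) : b || (nrm2 u != 0) ->
  is_derive u v (trans_a b) ((dtrans_ab b u).1 * cx v + (dtrans_ab b u).2 * cy v).
Proof.
rewrite /trans_a /dtrans_ab => /orP[->|n0]; first by apply: is_derive_eq (is_derive_cx u v) _ => /=; ring.
case: b; first by apply: is_derive_eq (is_derive_cx u v) _ => /=; ring.
have := is_derive_cx u v; have := is_derive_cy u v => hy hx.
move: n0; rewrite /nrm2 => n0; derive_by_rules => //.
by rewrite /=; field.
Qed.

Lemma is_derive_trans_b b (u v : 'rV[R]_3) : b || (nrm2 u != 0) ->
  is_derive u v (trans_b b) (- (dtrans_ab b u).2 * cx v + (dtrans_ab b u).1 * cy v).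
Proof.
rewrite /trans_b /dtrans_ab => /orP[->|n0]; first by apply: is_derive_eq (is_derive_cy u v) _ => /=; ring.
case: b; first by apply: is_derive_eq (is_derive_cy u v) _ => /=; ring.
have := is_derive_cx u v; have := is_derive_cy u v => hy hx.
move: n0; rewrite /nrm2 => n0; derive_by_rules => //.
by rewrite /=; field.
Qed.

Definition dtrans_slope b (s : R) : R := if b then 1 else (s ^+ 2)^-1.

Lemma is_derive_trans_slope b (u v : 'rV[R]_3) : b || (cz u != 0) ->
  is_derive u v (fun x => trans_slope b (cz x)) (dtrans_slope b (cz u) * cz v).
Proof.
have hz := is_derive_cz u v.
rewrite /trans_slope /dtrans_slope => /orP[->|n0]; first by rewrite mul1r.
case: b; first by rewrite mul1r.
derive_by_rules => //.
by rewrite /=; field.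
Qed.

Lemma dtrans_ab_gt0 b (u : 'rV[R]_3) : b || (nrm2 u != 0) ->
  0 < (dtrans_ab b u).1 * (dtrans_ab b u).1 - - (dtrans_ab b u).2 * (dtrans_ab b u).2.
Proof.
rewrite /dtrans_ab; case: b => /= [_|n0]; first by rewrite mulr1 mulr0 subr0.
have -> : (cy u ^+ 2 - cx u ^+ 2) / nrm2 u ^+ 2 * ((cy u ^+ 2 - cx u ^+ 2) / nrm2 u ^+ 2) -
  - (- (2 * cx u * cy u) / nrm2 u ^+ 2) * (- (2 * cx u * cy u) / nrm2 u ^+ 2) = (nrm2 u ^+ 2)^-1.
  by move: n0; rewrite /nrm2 => n0; field.
by rewrite invr_gt0 lt_neqAle eq_sym expf_neq0 //= sqr_ge0.
Qed.

Lemma trans_ab_smooth b (u : 'rV[R]_3) : b || (nrm2 u != 0) ->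
  exists U, [/\ open U, U u, smooth_on U (trans_a b) & smooth_on U (trans_b b)].
Proof.
have oT := @openT 'rV[R]_3.
rewrite /trans_a /trans_b; case: b => /= [_|n0].
  by exists setT; split=> //; smooth_rules oT.
have oU : open [set x : 'rV[R]_3 | nrm2 x != 0].
  by apply: smooth_on_open_neq0; rewrite /nrm2; smooth_rules oT.
by exists [set x | nrm2 x != 0]; split=> //; rewrite /nrm2; smooth_rules oU.
Qed.

Lemma trans_slope_smooth b (u : 'rV[R]_3) : b || (cz u != 0) ->
  exists U, [/\ open U, U u & smooth_on U (fun x => trans_slope b (cz x))].
Proof.
have oT := @openT 'rV[R]_3.
rewrite /trans_slope; case: b => /= [_|n0].
  by exists setT; split=> //; smooth_rules oT.
have oU : open [set x : 'rV[R]_3 | cz x != 0] by apply: smooth_on_open_neq0; smooth_rules oT.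
by exists [set x | cz x != 0]; split=> //; smooth_rules oU.
Qed.

Lemma trans_height_derive_gt0 b (K y : R) : b || (y != 0) -> 0 < 'D_1 (trans_height b K) y.
Proof.
have hid := is_derive_fid y.
rewrite /trans_height; case: b => /= [_|y0].
  suff [_ ->] : is_derive y (1 : R) (fun z : R => z * expR K) (expR K) by exact: expR_gt0.
  by derive_by_rules; rewrite /=; ring.
suff [_ ->] : is_derive y (1 : R) (fun z : R => - z^-1 * expR (- K)) (expR (- K) / y ^+ 2).
  by rewrite divr_gt0 ?expR_gt0 // lt_neqAle eq_sym expf_neq0 //= sqr_ge0.
by derive_by_rules => //; rewrite /=; field.
Qed.

(** The determinant is positive because the transitions of the sphere are
    conformal and those of the circle increasing; the transverse transition does
    not depend on the leaf coordinates because [trans_shift] is locally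
    constant. *)
Lemma chart_compat e d k e' d' k' : is_sign e -> is_sign d -> is_sign k -> is_sign e' -> is_sign d' ->
  is_sign k' -> fcompatible (chart e d k) (chart e' d' k').
Proof.
move=> se sd sk se' sd' sk' [u y] _ [_ /= Du].
have [/= n0 s0 y0] := trans_dom se sd sk se' sd' sk' Du.
have tE w : transition (chart e d k) (chart e' d' k') w = _ := transE se sd sk se' sd' sk' w.
split.
  have -> : (fun x => (transition (chart e d k) (chart e' d' k') (x, (u, y).2)).1) =
      fun x => row3 (trans_a (e' == e) x) (trans_b (e' == e) x) (trans_slope (d' == d) (cz x)).
    by apply/funext => x; rewrite tE.
  move: (e' == e) (d' == d) n0 s0 => b b' n0 s0.
  set f := fun x => _.
  have df : differentiable f u.
    have [A1 [op1 Vu sA sB]] := trans_ab_smooth n0.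
    have [A2 [op2 Vu2 sS]] := trans_slope_smooth s0.
    have oU := openI op1 op2.
    have sf : smooth_on (A1 `&` A2) f.
      apply: (smooth_on_row3 oU); [exact: smooth_on_subset sA|exact: smooth_on_subset sB|exact: smooth_on_subset sS].
    exact: (sf [::]).
  have d3 (i : nat) : is_derive u (basis3 i) f (row3
       ((dtrans_ab b u).1 * cx (basis3 i) + (dtrans_ab b u).2 * cy (basis3 i))
       (- (dtrans_ab b u).2 * cx (basis3 i) + (dtrans_ab b u).1 * cy (basis3 i)) (dtrans_slope b' (cz u) * cz (basis3 i))).
    by apply: is_derive_row3; [exact: is_derive_trans_a|exact: is_derive_trans_b|exact: is_derive_trans_slope].
  rewrite det3_block !(jacobian_row _ df (d3 _)) // -?/(cx _) -?/(cy _) -?/(cz _) !rowcE /= ?(mulr0, mulr1, addr0, add0r) //.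
  apply: mulr_gt0; first exact: dtrans_ab_gt0.
  rewrite /dtrans_slope; case: b' s0 {f df d3} => //= s0.
  by rewrite invr_gt0 lt_neqAle eq_sym expf_neq0 //= sqr_ge0.
pose K := k * (2 * trans_shift (d' == d) (cz u)).
exists (trans_height (k' == k) K); split.
  have ct : (cz w.1 : R) @[w --> (u, y)] --> cz u.
    by have := (@lincont_w1z R).2 (u, y); rewrite /= ; apply.
  have H : \forall w \near (u, y), trans_shift (d' == d) (cz w.1) = trans_shift (d' == d) (cz u).
    exact: ct _ (trans_shift_near s0).
  by near=> w; rewrite -[LHS]/((transition (chart e d k) (chart e' d' k') w).2) tE /= /K; congr (trans_height _ (k * (2 * _)) _); near: w.
exact: trans_height_derive_gt0.
Unshelve. all: by end_near. Qed.

Lemma exists_sign (x : R) : exists2 k, is_sign k & 1 + k * x != 0.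
Proof.
have [E|n0] := eqVneq (1 + 1 * x) 0; last by exists 1 => //; left.
exists (-1); first by right.
by apply/eqP => E'; lra.
Qed.

Lemma chart_cover P : M P -> exists e d, [/\ is_sign e, is_sign d &
  forall k, is_sign k -> 1 + k * co_c P != 0 -> chart_dom e d k P].
Proof.
have [e se he] := exists_sign (co_z P); have [d sd hd] := exists_sign (co_u P).
by exists e, d; split=> // k sk hk; apply/chart_domP.
Qed.

Lemma foliation_atlas : foliation M atlas.
Proof.
split.
- by move=> c [e [d [k [se sd sk ->]]]]; exact: is_fchart_chart.
- move=> P MP; have [e [d [se sd h]]] := chart_cover MP.
  have [k sk hk] := exists_sign (co_c P).
  exists (chart e d k); first by exists e, d, k.
  by split=> //; exact: h.
- move=> c c' [e [d [k [se sd sk ->]]]] [e' [d' [k' [se' sd' sk' ->]]]].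
  exact: chart_compat.
Qed.

End Charts.

(** * Leaves *)
Section Angles.
Context {R : realType}.
Implicit Types s t b d k : R.

Lemma cos2atan s : cos (2 * atan s) = (1 - s ^+ 2) / (1 + s ^+ 2).
Proof.
have h : cos (atan s) ^+ 2 = (1 + s ^+ 2)^-1.
  by rewrite cos_atan exprVn sqr_sqrtr // addr_ge0 // sqr_ge0.
by rewrite mulr_natl cos_mulr2n h; field; exact: one_sqr_neq0.
Qed.

Lemma sin2atan s : sin (2 * atan s) = 2 * s / (1 + s ^+ 2).
Proof.
have h : cos (atan s) ^+ 2 = (1 + s ^+ 2)^-1.
  by rewrite cos_atan exprVn sqr_sqrtr // addr_ge0 // sqr_ge0.
have c0 : cos (atan s) != 0.
  by apply: contra_neq (one_sqr_neq0 s) => c0; apply/eqP; rewrite -invr_eq0 -h c0 expr0n.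
have hs : sin (atan s) = s * cos (atan s) by rewrite -[LHS](divfK c0); congr (_ * _); exact: atanK.
by rewrite mulr_natl sin_mulr2n hs mulrCA -expr2 h mulr2n; field; exact: one_sqr_neq0.
Qed.

(** The slope determines the angle as long as the latter stays in ]-pi, pi[. *)
Lemma half_tan (s : R) : - pi < s < pi ->
  0 < 1 + cos s /\ 2 * atan (sin s / (1 + cos s)) = s.
Proof.
move=> /andP[s1 s2].
have hin : s / 2 \in `](- (pi / 2)), (pi / 2)[ by rewrite in_itv /=; apply/andP; split; lra.
have c0 : 0 < cos (s / 2) by apply: cos_gt0_pihalf; rewrite in_itv /= in hin.
have e2 : s = (s / 2) *+ 2 by rewrite mulr2n; lra.
have E : 1 + cos s = 2 * cos (s / 2) ^+ 2.
  by rewrite [in LHS]e2 cos_mulr2n mulr2n; lra.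
split; first by rewrite E mulr_gt0 // exprn_gt0.
rewrite E [in sin _]e2 sin_mulr2n mulr2n.
have -> : (cos (s / 2) * sin (s / 2) + cos (s / 2) * sin (s / 2)) / (2 * cos (s / 2) ^+ 2) = tan (s / 2).
  by rewrite /tan; field; rewrite gt_eqF.
by rewrite tanK //; lra.
Qed.

Lemma cos_sin_npi (n : nat) : exists2 d, is_sign d & cos (n%:R * pi) = d :> R /\ sin (n%:R * pi) = 0 :> R.
Proof.
elim: n => [|n [d sd [cd s0]]]; first by exists 1; [left|rewrite mul0r cos0 sin0].
exists (- d); first by case: sd => ->; [right|left; rewrite opprK].
by rewrite -addn1 natrD mulrDl mul1r cosDpi sinDpi cd s0 oppr0.
Qed.

Lemma near_multiple_pi s : exists m d, [/\ is_sign d, cos m = d, sin m = 0 & `|s - m| <= pi / 2].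
Proof.
pose j := Num.floor (s / pi + 1 / 2).
have j1 : j%:~R <= s / pi + 1 / 2 by exact: ge_floor.
have j2 : s / pi + 1 / 2 < (j + 1)%:~R by exact: floorD1_gt.
have p0 := @pi_gt0 R.
have bnd : `|s - j%:~R * pi| <= pi / 2.
  rewrite intrD in j2.
  have -> : s - j%:~R * pi = (s / pi - j%:~R) * pi by rewrite mulrBl divfK // gt_eqF.
  rewrite normrM (gtr0_norm p0) [leRHS]mulrC; apply: ler_wpM2r; first exact: ltW.
  by rewrite ler_norml; move: j1 j2; move: (j%:~R : R) (s / pi) => a b; lra.
have [n [E|E]] : exists n : nat, j = n%:Z \/ j = - n%:Z.
  by exists `|j|%N; case: (ltrP j 0) => h; [right; rewrite ltz0_abs // opprK|left; rewrite gez0_abs].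
- have [d sd [cd s0]] := cos_sin_npi n; exists (n%:R * pi), d; split=> //.
  by move: bnd; rewrite E.
- have [d sd [cd s0]] := cos_sin_npi n; exists (- (n%:R * pi)), d.
  rewrite cosN sinN cd s0 oppr0; split=> //.
  by move: bnd; rewrite E intrN mulNr.
Qed.

Lemma rotate_angle d s b b' : is_sign d -> cos s = d * cos b -> sin s = d * sin b ->
  cos (s + b' - b) = d * cos b' /\ sin (s + b' - b) = d * sin b'.
Proof.
move=> sd cs ss.
have c1 : cos (s - b) = d by rewrite cosB cs ss -!mulrA -mulrDr -!expr2 cos2Dsin2 mulr1.
have c2 : sin (s - b) = 0 by rewrite sinB cs ss; ring.
by rewrite addrAC; split; [rewrite cosD c1 c2|rewrite sinD c1 c2]; ring.
Qed.

End Angles.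

Section Leaves.
Context {R : realType}.
Local Notation E := (E7 R).
Local Notation M := (@S2S1S1 R).
Local Notation F := (@atlas R).
Implicit Types e d k c s : R.

Definition cosT t : R := (1 - t ^+ 2) / (1 + t ^+ 2).
Definition sinT t : R := 2 * t / (1 + t ^+ 2).

(** The curve t = 2 atan (c e^s) if k = 1, t = pi + 2 atan (c e^(-s)) if k = -1,
    times the sphere. *)
Definition Leaf k c : set E := [set P |
  co_x P ^+ 2 + co_y P ^+ 2 + co_z P ^+ 2 = 1 /\ exists s,
  [/\ co_u P = cos s, co_v P = sin s, co_c P = k * cosT (c * expR (k * s)) &
      co_s P = k * sinT (c * expR (k * s))]].

Lemma cosTV t : t != 0 -> cosT (- t^-1) = - cosT t.
Proof.
move=> t0; have sq := one_sqr_neq0 t; have sq' : t ^+ 2 + 1 != 0 by rewrite addrC.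
by rewrite /cosT; field; rewrite ?t0 ?sq ?sq'.
Qed.

Lemma sinTV t : t != 0 -> sinT (- t^-1) = - sinT t.
Proof.
move=> t0; have sq := one_sqr_neq0 t; have sq' : t ^+ 2 + 1 != 0 by rewrite addrC.
by rewrite /sinT; field; rewrite ?t0 ?sq ?sq'.
Qed.

Lemma cosT0 : cosT 0 = 1.
Proof. by rewrite /cosT expr0n subr0 addr0 divr1. Qed.

Lemma sinT0 : sinT 0 = 0.
Proof. by rewrite /sinT mulr0 mul0r. Qed.

(** A leaf with c <> 0 is seen from both compact leaves: tan (t / 2) = c e^s is
    equivalent to - cot (t / 2) = - c^-1 e^(-s). *)
Lemma Leaf_switch k c : c != 0 -> Leaf k c `<=` Leaf (- k) (- c^-1).
Proof.
move=> cn0 P [h [s [h1 h2 h3 h4]]]; split=> //; exists s.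
have t0 : c * expR (k * s) != 0 by rewrite mulf_neq0 // gt_eqF // expR_gt0.
have -> : - c^-1 * expR (- k * s) = - (c * expR (k * s))^-1.
  by rewrite [- k * s]mulNr expRN invfM mulNr.
by split=> //; rewrite ?cosTV ?sinTV // mulrNN.
Qed.

Lemma Leaf_switchE k c : c != 0 -> Leaf k c = Leaf (- k) (- c^-1).
Proof.
move=> c0; apply/seteqP; split; first exact: Leaf_switch.
have := @Leaf_switch (- k) (- c^-1); rewrite opprK invrN opprK invrK.
by apply; rewrite oppr_eq0 invr_eq0.
Qed.

Lemma Leaf_M k c : is_sign k -> Leaf k c `<=` M.
Proof.
move=> sk P [h [s [h1 h2 h3 h4]]]; apply/S2S1S1P; split=> //.
  by rewrite h1 h2 cos2Dsin2.
rewrite h3 h4; by have [] := slope_of_circ (c * expR (k * s)) sk.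
Qed.

(** On a plaque the transverse coordinate is constant, so the height varies as
    e^(k s), where s is followed continuously through [slope]. *)
Lemma Leaf_plaque_same k c e d P Q : is_sign e -> is_sign d -> is_sign k -> Leaf k c P ->
  cdom (chart e d k) P -> plaque (chart e d k) P Q -> Leaf k c Q.
Proof.
move=> se sd sk [_ [s [h1 h2 h3 h4]]] [MP /chart_domP[dP1 dP2 dP3]] [[MQ /chart_domP[dQ1 dQ2 dQ3]] /=].
have /S2S1S1P[mP1 mP2 mP3] := MP; have /S2S1S1P[mQ1 mQ2 mQ3] := MQ.
set sP := slope d P; set sQ := slope d Q => hE; split=> //.
exists (s + 2 * atan sQ - 2 * atan sP).
have [uP vP] := circ_of_slope sd mP2 dP2; have [uQ vQ] := circ_of_slope sd mQ2 dQ2.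
have [uE vE] : cos (s + 2 * atan sQ - 2 * atan sP) = d * cos (2 * atan sQ) /\
    sin (s + 2 * atan sQ - 2 * atan sP) = d * sin (2 * atan sQ).
  by apply: rotate_angle => //; rewrite ?cos2atan ?sin2atan -?h1 -?h2.
rewrite uE vE cos2atan sin2atan uQ vQ.
have [cQ sQ'] := circ_of_slope sk mQ3 dQ3.
suff hQ : k * co_s Q / (1 + k * co_c Q) = c * expR (k * (s + 2 * atan sQ - 2 * atan sP)).
  by split=> //; rewrite -hQ.
have hP : height k P = c * expR (k * s).
  by rewrite /height h3 h4; have [_ _ ->] := slope_of_circ (c * expR (k * s)) sk.
have -> : k * co_s Q / (1 + k * co_c Q) = height k Q * expR (- (k * (2 * atan sQ))) * expR (k * (2 * atan sQ)).
  by rewrite -[RHS]mulrA -expRD addNr expR0 mulr1.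
rewrite hE hP -!mulrA -!expRD; congr (_ * expR _); ring.
Qed.

Lemma Leaf_plaque k c e d k' P Q : is_sign e -> is_sign d -> is_sign k -> is_sign k' -> Leaf k c P ->
  cdom (chart e d k') P -> plaque (chart e d k') P Q -> Leaf k c Q.
Proof.
move=> se sd sk sk' LP DP PQ.
have [Ek|Ek] := is_sign_cases sk sk'.
  by move: DP PQ; rewrite Ek; exact: Leaf_plaque_same.
have c0 : c != 0.
  apply/eqP => c0; have [_ /chart_domP[_ _ /negP ne]] := DP; have [_ [s [_ _ hs _]]] := LP.
  (* Each compact leaf is outside the charts centred at the other one. *)
  apply: ne; rewrite hs Ek c0 mul0r cosT0 mulr1 mulNr.
  by case: sk => ->; rewrite ?mulrNN mulr1 subrr.
rewrite (Leaf_switchE k c0) -Ek in LP *.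
exact: (Leaf_plaque_same se sd sk' LP DP PQ).
Qed.

Lemma leaf_of_sub k c P : is_sign k -> Leaf k c P -> leaf_of F P `<=` Leaf k c.
Proof.
move=> sk LP Q PQ; elim: PQ LP => {P Q}.
  move=> P Q [_ [[e [d [k' [se sd sk' ->]]]] DP PQ]] LP.
  exact: (Leaf_plaque se sd sk sk' LP DP PQ).
by move=> P Q S _ IH1 _ IH2 LP; exact/IH2/IH1.
Qed.

(** The parametrization of a leaf by the sphere and the real line. *)
Definition leafpt k c (w : 'rV[R]_3) s : E :=
  mk7 (cx w) (cy w) (cz w) (cos s) (sin s) (k * cosT (c * expR (k * s))) (k * sinT (c * expR (k * s))).

Lemma leafpt_Leaf k c w s : @sphere R 2 w -> Leaf k c (leafpt k c w s).
Proof. by move=> /sphere2P sw; rewrite /Leaf /= !mk7E; split=> //; exists s. Qed.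

Lemma Leaf_leafpt k c P : Leaf k c P -> exists w s, @sphere R 2 w /\ P = leafpt k c w s.
Proof.
move=> [h [s [h1 h2 h3 h4]]]; exists P.1.1, s; split; first exact/sphere2P.
by apply: co_inj; rewrite !mk7E.
Qed.

(** Two angles at distance less than pi are both at distance less than pi from
    the multiple m of pi closest to their midpoint, hence the corresponding
    points lie in the domain of the circle chart centred at m, and in the same
    plaque. *)
Lemma leafpt_step k c w w' s s' e : is_sign k -> is_sign e -> @sphere R 2 w -> @sphere R 2 w' ->
  1 + e * cz w != 0 -> 1 + e * cz w' != 0 -> `|s - s'| < pi ->
  same_plaque F (leafpt k c w s) (leafpt k c w' s').
Proof.
move=> sk se sw sw' ew ew' ss.
have [m [d [sd cm sm mb]]] := near_multiple_pi ((s + s') / 2).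
have key r v : @sphere R 2 v -> 1 + e * cz v != 0 -> `|r - m| < pi ->
  cdom (chart e d k) (leafpt k c v r) /\ (cphi (chart e d k) (leafpt k c v r)).2 = c * expR (k * m).
  move=> sv ev rm; rewrite ltr_norml in rm.
  have [c0 a0] := half_tan rm.
  have cr : cos r = d * cos (r - m) by rewrite -[r in LHS](subrK m) cosD cm sm mulr0 subr0 mulrC.
  have sr : sin r = d * sin (r - m) by rewrite -[r in LHS](subrK m) sinD cm sm mulr0 addr0 mulrC.
  have dd x : d * (d * x) = x by case: sd => ->; rewrite ?mulN1r ?opprK ?mul1r ?opprK.
  split.
    split; first exact/(Leaf_M sk)/leafpt_Leaf.
    apply/chart_domP; rewrite !mk7E; split=> //; first by rewrite cr dd gt_eqF.
    have [_ -> _] := slope_of_circ (c * expR (k * r)) sk.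
    by rewrite mulf_neq0 ?pnatr_eq0 // invr_eq0 one_sqr_neq0.
  rewrite /= /height /slope !mk7E cr sr !dd a0.
  have [_ _ ->] := slope_of_circ (c * expR (k * r)) sk.
  by rewrite -mulrA -expRD; congr (_ * expR _); ring.
have h1 : `|s - m| < pi by rewrite ltr_norml; move: ss mb; rewrite ltr_norml ler_norml; lra.
have h2 : `|s' - m| < pi by rewrite ltr_norml; move: ss mb; rewrite ltr_norml ler_norml; lra.
have [D1 E1] := key s w sw ew h1; have [D2 E2] := key s' w' sw' ew' h2.
exists (chart e d k); split=> //; first by exists e, d, k.
by split=> //; rewrite E1 E2.
Qed.

(** The angle moves from s to s' by steps of length at most 1 < pi. *)
Lemma leafpt_conn k c s s' : is_sign k -> clos_trans E (same_plaque F)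
  (leafpt k c (row3 1 0 0) s) (leafpt k c (row3 1 0 0) s').
Proof.
move=> sk; have sw := @sphere_e1 R.
have step r r' : `|r - r'| <= 1 -> same_plaque F (leafpt k c (row3 1 0 0) r) (leafpt k c (row3 1 0 0) r').
  move=> h; apply: (@leafpt_step k c _ _ r r' 1) => //; [by left|..];
    rewrite ?rowcE ?mulr0 ?addr0 ?oner_eq0 //.
  by apply: le_lt_trans h _; apply: lt_le_trans (pi_ge2 R); rewrite ltr1n.
have [n] : exists n : nat, `|s - s'| <= n%:R.
  by exists (Num.bound `|s - s'|); apply: ltW; apply: archi_boundP.
elim: n s' => [|n IHn] s'.
  by move=> h; apply: t_step; apply: step; apply: le_trans h _.
move=> h; pose r := s + (s' - s) * (n%:R / n.+1%:R).
have n0 : (n.+1%:R : R) != 0 by rewrite pnatr_eq0.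
have p0 : (0 : R) < n.+1%:R by rewrite ltr0n.
apply: (@t_trans _ _ _ (leafpt k c (row3 1 0 0) r)).
  apply: IHn; rewrite /r opprD addrA subrr sub0r normrN normrM distrC.
  rewrite ger0_norm ?divr_ge0 // mulrA ler_pdivrMr // [leRHS]mulrC.
  by rewrite ler_wpM2r.
apply: t_step; apply: step; rewrite /r.
have -> : s + (s' - s) * (n%:R / n.+1%:R) - s' = (s - s') / n.+1%:R.
  by move: n0; rewrite -natr1 => n0; field.
by rewrite normrM normfV (@ger0_norm _ n.+1%:R) // ler_pdivrMr // mul1r.
Qed.

Lemma leaf_ofE k c P : is_sign k -> Leaf k c P -> leaf_of F P = Leaf k c.
Proof.
move=> sk LP; apply/seteqP; split; first exact: leaf_of_sub.
move=> Q LQ; rewrite /leaf_of /=.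
have [w [s [sw ->]]] := Leaf_leafpt LP; have [w' [s' [sw' ->]]] := Leaf_leafpt LQ.
have [e se hw] := exists_sign (cz w); have [e' se' hw'] := exists_sign (cz w').
have s1 := @sphere_e1 R.
apply: (@t_trans _ _ _ (leafpt k c (row3 1 0 0) s)).
  apply: t_step; apply: (@leafpt_step k c w _ s s e) => //.
    by rewrite rowcE mulr0 addr0 oner_eq0.
  by rewrite subrr normr0 pi_gt0.
apply: (@t_trans _ _ _ (leafpt k c (row3 1 0 0) s')); first exact: leafpt_conn.
apply: t_step; apply: (@leafpt_step k c _ w' s' s' e') => //.
  by rewrite rowcE mulr0 addr0 oner_eq0.
by rewrite subrr normr0 pi_gt0.
Qed.

Lemma exists_angle (u v : R) : u ^+ 2 + v ^+ 2 = 1 -> exists s, u = cos s /\ v = sin s.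
Proof.
move=> uv; have [d sd hd] := exists_sign u.
have [hu hv] := circ_of_slope sd uv hd.
set t := d * v / (1 + d * u) in hu hv.
have [E|E] : d = 1 \/ d = -1 by exact: sd.
  by exists (2 * atan t); rewrite cos2atan sin2atan; split; [rewrite -hu|rewrite -hv]; rewrite E mul1r.
exists (2 * atan t + pi); rewrite cosDpi sinDpi cos2atan sin2atan.
by split; [rewrite -hu|rewrite -hv]; rewrite E mulN1r.
Qed.

Lemma M_Leaf P : M P -> exists k c, [/\ is_sign k, k = 1 \/ c = 0 & Leaf k c P].
Proof.
move=> /S2S1S1P[m1 m2 m3]; have [s [hu hv]] := exists_angle m2.
have gen k : is_sign k -> 1 + k * co_c P != 0 -> Leaf k (height k P * expR (- (k * s))) P.
  move=> sk hk; split=> //; exists s; split=> //.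
    rewrite -mulrA -expRD addNr expR0 mulr1.
    by have [-> _] := circ_of_slope sk m3 hk.
  rewrite -mulrA -expRD addNr expR0 mulr1.
  by have [_ ->] := circ_of_slope sk m3 hk.
have [h0|h0] := eqVneq (1 + 1 * co_c P) 0; last first.
  by exists 1, (height 1 P * expR (- (1 * s))); split; [left|left|apply: gen => //; left].
have c1 : co_c P = -1 by lra.
have s0 : co_s P = 0.
  by apply/eqP; rewrite -sqrf_eq0; apply/eqP; move: m3; rewrite c1; lra.
exists (-1), (height (-1) P * expR (- (-1 * s))); split; first by right.
  by right; rewrite /height s0 mulr0 !mul0r.
by apply: gen; [right|rewrite c1 mulrNN mulr1 (_ : 1 + 1 = 2%:R) // pnatr_eq0].
Qed.

Lemma Leaf0_slice k t : cos t = k -> sin t = 0 -> Leaf k 0 = slice t.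
Proof.
move=> ct st; apply/seteqP; split=> P.
  move=> [h [s [h1 h2 h3 h4]]]; apply/sliceP; split=> //.
  - by rewrite h1 h2 cos2Dsin2.
  - by rewrite h3 mul0r cosT0 mulr1.
  - by rewrite h4 mul0r sinT0 mulr0.
move=> /sliceP[h1 h2 h3 h4]; split=> //; have [s [hu hv]] := exists_angle h2.
by exists s; rewrite mul0r cosT0 sinT0 mulr1 mulr0 h3 h4 ct st.
Qed.

Lemma Leaf10 : Leaf 1 0 = slice 0.
Proof. exact: Leaf0_slice (cos0 R) (sin0 R). Qed.

Lemma LeafN10 : Leaf (-1) 0 = slice pi.
Proof. exact: Leaf0_slice (cospi R) (sinpi R). Qed.

(** By [Leaf_switchE], the leaves with c <> 0 are all obtained with k = 1. *)
Lemma is_leafP L : is_leaf M F L <-> exists k c, [/\ is_sign k, k = 1 \/ c = 0 & L = Leaf k c].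
Proof.
split=> [[P MP ->]|[k [c [sk kc ->]]]].
  by have [k [c [sk kc LP]]] := M_Leaf MP; exists k, c; rewrite (leaf_ofE sk LP).
have sw := @sphere_e1 R.
have LP : Leaf k c (leafpt k c (row3 1 0 0) 0) by exact: leafpt_Leaf.
by exists (leafpt k c (row3 1 0 0) 0); [exact: Leaf_M LP|rewrite (leaf_ofE sk LP)].
Qed.

End Leaves.

(** * Closures and compactness of the leaves *)
Section LeafTopology.
Context {R : realType}.
Local Notation E := (E7 R).
Local Notation M := (@S2S1S1 R).
Local Notation F := (@atlas R).
Implicit Types e d k c s : R.

Lemma small_exp (A eps : R) : 0 < eps -> exists n : nat, `|A * expR (- (n%:R * (2 * pi)))| < eps.
Proof.
move=> e0; exists (Num.bound (`|A| / eps)).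
set n := Num.bound _; have hn : `|A| / eps < n%:R by apply: archi_boundP; rewrite divr_ge0 // ltW.
have hp := pi_ge2 R.
have n0 : (0 : R) <= n%:R by exact: ler0n.
have h1 : 1 + n%:R <= expR (n%:R * (2 * pi)) :> R.
  by apply: le_trans (expR_ge1Dx _); rewrite lerD2l ler_peMr //; lra.
rewrite normrM expRN normfV (ger0_norm (expR_ge0 _)) ltr_pdivrMr ?expR_gt0 //.
rewrite ltr_pdivrMr // mulrC in hn.
apply: lt_le_trans hn _; rewrite ler_wpM2l ?(ltW e0) //.
by apply: le_trans h1; rewrite lerDr.
Qed.

Lemma cos_sinBn2pi s (n : nat) : cos (s - n%:R * (2 * pi)) = cos s /\ sin (s - n%:R * (2 * pi)) = sin s.
Proof.
have e : n%:R * (2 * pi) = (pi *+ 2) *+ n :> R by rewrite -[RHS]mulr_natl -[pi *+ 2]mulr_natl.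
rewrite e; split; rewrite -[in RHS](subrK (pi *+ 2 *+ n) s).
  by rewrite (periodicn (@cosD2pi R)).
by rewrite (periodicn (@sinD2pi R)).
Qed.

(** Going around the circle in the direction of - k does not change (u, v), and
    multiplies the height by e^(- 2 pi) at each turn. *)
Lemma Leaf_adheres k c : is_sign k -> adheres_to (Leaf k c) (Leaf k 0).
Proof.
move=> sk Q LQ B nB; have [w [s [sw QE]]] := Leaf_leafpt LQ.
(* The transverse arc through Q; the leaf meets it at the heights
   c e^(k s) e^(- 2 pi n). *)
pose H (r : R) : E := mk7 (cx w) (cy w) (cz w) (cos s) (sin s) (k * cosT r) (k * sinT r).
have oT := @openT R.
have cH : continuous H.
  apply: smooth_on_continuous; rewrite /H /cosT /sinT.
  have sid : smooth_on (setT : set R) (fun r => r) by apply/smooth_onP => n; exact: Ck_id.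
  by smooth_rules oT => r _; exact: one_sqr_neq0.
have H0 : H 0 = Q by rewrite QE /leafpt mul0r.
have := cH 0; rewrite /continuous_at H0 => /(_ _ nB) /nbhs_ballP[eps e0 hB].
have [n hn] := small_exp (c * expR (k * s)) e0.
pose s' := s - k * (n%:R * (2 * pi)).
exists (leafpt k c w s'); split; first exact: leafpt_Leaf.
have -> : leafpt k c w s' = H (c * expR (k * s) * expR (- (n%:R * (2 * pi)))).
  have kk : k * k = 1 by case: sk => ->; rewrite ?mulrNN mulr1.
  have -> : c * expR (k * s) * expR (- (n%:R * (2 * pi))) = c * expR (k * s').
    by rewrite -mulrA -expRD /s' mulrBr [k * (k * _)]mulrA kk mul1r.
  rewrite /leafpt /H; congr (mk7 _ _ _ _ _ _ _); rewrite /s'.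
    case: sk => ->; first by rewrite mul1r (cos_sinBn2pi s n).1.
    by rewrite mulN1r opprK -(cos_sinBn2pi _ n).1 addrK.
  case: sk => ->; first by rewrite mul1r (cos_sinBn2pi s n).2.
  by rewrite mulN1r opprK -(cos_sinBn2pi _ n).2 addrK.
by apply: hB; rewrite /ball /= sub0r normrN.
Qed.

Lemma co_s_Leaf0 k P : Leaf k 0 P -> co_s P = 0.
Proof. by move=> [_ [s [_ _ _ ->]]]; rewrite mul0r sinT0 mulr0. Qed.

Lemma co_s_Leaf_neq0 k c P : is_sign k -> c != 0 -> Leaf k c P -> co_s P != 0.
Proof.
move=> sk c0 [_ [s [_ _ _ ->]]]; apply: mulf_neq0; first exact: is_sign_neq0.
rewrite /sinT !mulf_neq0 ?invr_eq0 ?one_sqr_neq0 ?pnatr_eq0 //.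
by rewrite gt_eqF // expR_gt0.
Qed.

Lemma Leaf_nonempty k c : exists P, @Leaf R k c P.
Proof.
by exists (leafpt k c (row3 1 0 0) 0); exact/leafpt_Leaf/sphere_e1.
Qed.

(** The open sets sin^2 t > 1 / n increase to the complement of the two compact
    leaves. *)
Definition belt (n : nat) : set E := M `&` [set P | 0 < n%:R * co_s P ^+ 2 - 1].

Lemma open_belt n : open [set P : E | 0 < n%:R * co_s P ^+ 2 - 1].
Proof. by have oT := @openT E; apply: smooth_on_open_gt0; smooth_rules oT. Qed.

Lemma beltS m n : (m <= n)%N -> belt m `<=` belt n.
Proof.
move=> mn P [MP h]; split=> //; apply: lt_le_trans h _.
by rewrite lerD2r ler_wpM2r ?sqr_ge0 // ler_nat.
Qed.

(** The belts cover the leaf; a finite number of them do not, since sin t takes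
    arbitrarily small values on the leaf by [Leaf_adheres]. *)
Lemma Leaf_noncompact k c : is_sign k -> c != 0 -> ~ leaf_compact M F (Leaf k c).
Proof.
move=> sk c0 cpt; have := cpt (range belt); case.
- move=> _ [n _ <-]; split; first by move=> P [].
  move=> P _ [MP hP] [e [d [k' [se sd sk' ->]]]] DP.
  exists [set P : E | 0 < n%:R * co_s P ^+ 2 - 1]; split=> //; first exact: open_belt.
  by move=> Q [[[MQ _] _] hQ]; split.
- move=> P LP; have e0 := co_s_Leaf_neq0 sk c0 LP.
  have e2 : 0 < co_s P ^+ 2 by rewrite lt_neqAle eq_sym sqrf_eq0 e0 sqr_ge0.
  exists (belt (Num.bound (co_s P ^+ 2)^-1)); first by exists (Num.bound (co_s P ^+ 2)^-1).
  split; first exact: Leaf_M LP.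
  rewrite /= subr_gt0 -ltr_pdivrMr // mul1r.
  by apply: archi_boundP; rewrite invr_ge0 ltW.
- move=> G [/finite_seqP[gs ->] sG LG].
  have [N hN] : exists N : nat, forall A, A \in gs -> A `<=` belt N.
    elim: gs sG {LG} => [|A gs IHgs] sG; first by exists 0%N.
    have [N hN] : exists N : nat, forall A, A \in gs -> A `<=` belt N.
      by apply: IHgs => B hB; apply: sG; rewrite /= inE; apply/orP; right.
    have [m _ hm] : range belt A by apply: sG; rewrite /= inE eqxx.
    exists (maxn m N) => B; rewrite inE => /orP[/eqP ->|/hN hB].
      by rewrite -hm; apply: beltS; rewrite leq_maxl.
    by apply: subset_trans hB _; apply: beltS; rewrite leq_maxr.
  have [Q LQ] := Leaf_nonempty k 0.
  have oB : open [set P : E | 0 < 1 - N%:R * co_s P ^+ 2].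
    by have oT := @openT E; apply: smooth_on_open_gt0; smooth_rules oT.
  have [|P [LP /= hP]] := @Leaf_adheres k c sk Q LQ [set P : E | 0 < 1 - N%:R * co_s P ^+ 2].
    apply: open_nbhs_nbhs; split=> //=.
    by rewrite (co_s_Leaf0 LQ) expr0n mulr0 subr0 ltr01.
  have [A hA AP] := LG P LP.
  have [_ /=] := hN A hA P AP.
  by move: hP; lra.
Qed.

Lemma compact_sphere n : compact (@sphere R n).
Proof.
apply: bounded_closed_compact.
  exists 1; split; first exact: num_real.
  move=> x x1 p /= sp; apply: le_trans (ltW x1).
  rewrite /Num.Def.normr /= mx_normrE; apply/bigmax_leP; split=> // -[i j] _.
  rewrite -[leRHS]sqrtr1 -[leLHS]sqrtr_sqr ler_sqrt //=.
  rewrite -[leRHS]sp (ord1 i) (bigD1 j) //= lerDl sumr_ge0 // => l _; exact: sqr_ge0.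
rewrite (_ : @sphere R n = (fun p => \sum_i p 0 i ^+ 2) @^-1` [set 1]) //.
apply: closed_comp; last exact: closed_eq.
move=> p _; apply: (@continuous_big _ _ +%R 0 xpredT add_continuous) => i _ q.
by apply: (@continuous_comp _ _ _ (fun p : 'rV[R]_n.+1 => p 0 i) (fun x => x ^+ 2));
  [exact: coord_continuous|exact: exprn_continuous].
Qed.

Lemma compact_slice t : compact (@slice R t).
Proof.
apply: compact_setX; last exact: compact_set1.
by apply: compact_setX; exact: compact_sphere.
Qed.

Lemma Leaf0_compact k : is_sign k -> compact (@Leaf R k 0).
Proof. by case=> ->; rewrite ?Leaf10 ?LeafN10; exact: compact_slice. Qed.

(** The part of a compact leaf in a chart is a single plaque, so its leaf
    topology is the subspace topology, for which it is compact. *)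
Lemma Leaf0_leaf_compact k : is_sign k -> leaf_compact M F (Leaf k 0).
Proof.
move=> sk G oG LG; have := Leaf0_compact sk; rewrite compact_cover.
pose O (A : set E) : set E := \bigcup_(U in [set U : set E | open U /\ U `&` Leaf k 0 `<=` A]) U.
move=> /(_ (set E) G O) [].
- by move=> A GA; apply: bigcup_open => U [].
- move=> P LP; have [A GA AP] := LG P LP; exists A => //.
  have [AM hA] := oG A GA.
  have MP := AM P AP; have [e [d [se sd hD]]] := chart_cover MP.
  have ekP : 1 + k * co_c P != 0.
    have [_ [s [_ _ -> _]]] := LP.
    rewrite mul0r cosT0 mulr1.
    by case: sk => ->; rewrite ?mulrNN mulr1 (_ : 1 + 1 = 2%:R) // pnatr_eq0.
  have DP : cdom (chart e d k) P by split=> //; exact: hD.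
  have [|U [oU UP hU]] := hA P (chart e d k) AP _ DP; first by exists e, d, k.
  exists (U `&` chart_dom e d k); last by split=> //; exact: hD.
  split; first by apply: openI => //; exact: open_chart_dom.
  move=> Q [[UQ DQ] LQ]; apply: hU; split=> //; split.
    by split=> //; exact: Leaf_M LQ.
  by rewrite /= /height (co_s_Leaf0 LP) (co_s_Leaf0 LQ) mulr0 !mul0r.
- move=> D' D'G cov; exists [set` D']; split.
  + exact: finite_fset.
  + by move=> A hA; exact: set_mem (D'G A hA).
  + move=> P LP; have [A hA [U [oU hU] UP]] := cov P LP.
    by exists A => //; apply: hU.
Qed.

End LeafTopology.

(** * The coefficients of the contact form *)
Section Profile.
Context {R : realType}.
Implicit Types z w : R.

(** [sqradius z] is r^2, where r is the radius in the overtwisted model. The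
    coefficient [lam_xy] is r sin r / (1 - z^2), where
    1 - z^2 = r^2 (2 pi - r) (2 pi + r) / (4 pi^4). Its singularity at the north
    pole (r = 0) is removed in [lam_xyN] with sin r = r S (r^2), where S is
    [sinc_sqrt]; the one at the south pole (r = 2 pi) in [lam_xyS] with
    sin r = - (2 pi - r) S ((2 pi - r)^2). *)
Definition sqradius z : R := 2 * pi ^+ 2 * (1 - z).
Definition lam_s z : R := cos_sqrt (sqradius z).
Definition lam_xyN z : R := 4 * pi ^+ 4 * sinc_sqrt (sqradius z) / (2 * pi ^+ 2 * (1 + z)).
Definition lam_xyS z : R := - (4 * pi ^+ 4 * sinc_sqrt ((2 * pi - Num.sqrt (sqradius z)) ^+ 2)) /
  (Num.sqrt (sqradius z) * (2 * pi + Num.sqrt (sqradius z))).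
Definition lam_xy z : R := if - (1 / 2) < z then lam_xyN z else lam_xyS z.
Definition dlam_s z : R := 'D_1 lam_s z.
Definition dlam_xy z : R := 'D_1 lam_xy z.
(** The coefficient of dtheta, since x dy - y dx = (1 - z^2) dtheta on the
    sphere. *)
Definition lam_theta z : R := (1 - z ^+ 2) * lam_xy z.
Definition dlam_theta z : R := - (2 * z * lam_xy z) + (1 - z ^+ 2) * dlam_xy z.
Definition wronskian z : R := lam_s z * dlam_theta z - dlam_s z * lam_theta z.

Let pi0 : 0 < (pi : R) := pi_gt0 R.

Lemma lam_xyN_theta z : -1 < z -> (1 - z ^+ 2) * lam_xyN z = sqradius z * sinc_sqrt (sqradius z).
Proof.
move=> z1; have z0 : 1 + z != 0 by rewrite gt_eqF //; lra.
have p0 : (pi : R) != 0 by rewrite gt_eqF.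
rewrite /lam_xyN; move: (sinc_sqrt _) => S; rewrite /sqradius.
by move: p0; move: (pi : R) => P p0; field; rewrite z0 p0.
Qed.

Lemma lam_xyS_theta z : z < 1 -> (1 - z ^+ 2) * lam_xyS z = sqradius z * sinc_sqrt (sqradius z).
Proof.
move=> z1; have p0 : (pi : R) != 0 by rewrite gt_eqF.
have w0 : 0 < sqradius z by rewrite /sqradius !mulr_gt0 ?exprn_gt0 ?subr_gt0.
have r0 : 0 < Num.sqrt (sqradius z) by rewrite sqrtr_gt0.
have rw : Num.sqrt (sqradius z) ^+ 2 = sqradius z by rewrite sqr_sqrtr // ltW.
have S1 := sinc_sqrt_sqr (2 * pi - Num.sqrt (sqradius z)).
have S2 := sinc_sqrt_sqr (Num.sqrt (sqradius z)).
have zE : z = 1 - Num.sqrt (sqradius z) ^+ 2 / (2 * pi ^+ 2).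
  by rewrite rw /sqradius; move: p0; move: (pi : R) => P p0; field.
have sinE : sin (2 * pi - Num.sqrt (sqradius z)) = - sin (Num.sqrt (sqradius z)).
  by rewrite addrC mulr_natl sinD2pi sinN.
rewrite /lam_xyS -[in RHS]rw; move: (Num.sqrt (sqradius z)) r0 S1 S2 zE sinE => r r0 S1 S2 -> sinE.
have r0' : r != 0 by rewrite gt_eqF.
have r2 : 2 * pi + r != 0 by rewrite gt_eqF // addr_gt0 // mulr_gt0.
have S3 : (2 * pi - r) * sinc_sqrt ((2 * pi - r) ^+ 2) = - (r * sinc_sqrt (r ^+ 2)) by rewrite S1 S2.
transitivity (r * - ((2 * pi - r) * sinc_sqrt ((2 * pi - r) ^+ 2))); last by rewrite S3; ring.
move: (sinc_sqrt ((2 * pi - r) ^+ 2)) => S; move: p0 r2; move: (pi : R) => P p0 r2.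
by field; rewrite r2 r0' p0.
Qed.

Lemma lam_thetaE z : lam_theta z = sqradius z * sinc_sqrt (sqradius z).
Proof.
rewrite /lam_theta /lam_xy; case: ltrP => hz; first by apply: lam_xyN_theta; lra.
by apply: lam_xyS_theta; lra.
Qed.

Lemma smooth_on_id : smooth_on (setT : set R) (fun r : R => r).
Proof. by apply/smooth_onP => n; exact: Ck_id. Qed.

Lemma smooth_on_lam_s : smooth_on setT lam_s.
Proof. by have oT := @openT R; have := smooth_on_id; rewrite /lam_s /sqradius => sid; smooth_rules oT. Qed.

(** Each formula is smooth on an open set of its own, and both agree where both
    are defined, because they agree after multiplication by 1 - z^2. *)
Lemma smooth_on_lam_xy : smooth_on setT lam_xy.
Proof.
apply/smooth_onP => n; apply: Ck_local => z _.
have p0 : (pi : R) != 0 by rewrite gt_eqF.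
have oT := @openT R.
have [hz|hz] := ltrP (- (1 / 2)) z.
  have oU : open [set x : R | - (1 / 2) < x] by exact: open_gt.
  exists [set x | - (1 / 2) < x], lam_xyN; split=> //; last by move=> y /=; rewrite /lam_xy => ->.
  move: n; apply/smooth_onP.
  have sid : smooth_on [set x : R | - (1 / 2) < x] (fun r => r) by move=> s x _; exact: smooth_on_id.
  rewrite /lam_xyN /sqradius; smooth_rules oU => x /= hx.
  by rewrite !mulf_neq0 // gt_eqF //; lra.
have oU : open [set x : R | x < 1] by exact: open_lt.
exists [set x | x < 1], lam_xyS; split=> //; first by rewrite /=; lra.
  move: n; apply/smooth_onP.
  have sid : smooth_on [set x : R | x < 1] (fun r => r) by move=> s x _; exact: smooth_on_id.
  have w0 (x : R) : x < 1 -> 0 < 2 * pi ^+ 2 * (1 - x).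
    by move=> x1; rewrite !mulr_gt0 ?exprn_gt0 ?subr_gt0.
  rewrite /lam_xyS /sqradius; smooth_rules oU => x /= hx; try exact: w0.
  have r0 : 0 < Num.sqrt (2 * pi ^+ 2 * (1 - x)) by rewrite sqrtr_gt0; exact: w0.
  by rewrite mulf_neq0 // gt_eqF // addr_gt0 // mulr_gt0.
move=> y /= y1; rewrite /lam_xy; case: ifP => // y2.
have y0 : 1 - y ^+ 2 != 0 by rewrite gt_eqF //; nra.
by apply: (mulfI y0); rewrite lam_xyN_theta ?lam_xyS_theta //; lra.
Qed.

Lemma smooth_on_derive (V W : normedModType R) (U : set V) (f : V -> W) v :
  smooth_on U f -> smooth_on U ('D_v f).
Proof. by move=> sf s x Ux; rewrite -iterD_rcons; exact: sf. Qed.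

Lemma smooth_on_dlam_s : smooth_on setT dlam_s. Proof. exact/smooth_on_derive/smooth_on_lam_s. Qed.
Lemma smooth_on_dlam_xy : smooth_on setT dlam_xy. Proof. exact/smooth_on_derive/smooth_on_lam_xy. Qed.

Lemma smooth_on_is_derive (f : R -> R) z : smooth_on setT f -> is_derive z (1 : R) f ('D_1 f z).
Proof. by move=> sf; apply: derivableP; apply: diff_derivable; exact: (sf [::]). Qed.

Lemma is_derive_lam_s z : is_derive z (1 : R) lam_s (dlam_s z).
Proof. exact/smooth_on_is_derive/smooth_on_lam_s. Qed.
Lemma is_derive_lam_xy z : is_derive z (1 : R) lam_xy (dlam_xy z).
Proof. exact/smooth_on_is_derive/smooth_on_lam_xy. Qed.

Lemma is_derive_sqradius z : is_derive z (1 : R) sqradius (- (2 * pi ^+ 2)).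
Proof. by rewrite /sqradius; have hid := is_derive_fid z; derive_by_rules; rewrite /=; ring. Qed.

Lemma dlam_sE z : dlam_s z = pi ^+ 2 * sinc_sqrt (sqradius z).
Proof.
have [_ <-] : is_derive z (1 : R) lam_s (pi ^+ 2 * sinc_sqrt (sqradius z)); last by [].
have hw := is_derive_sqradius z; notypeclasses refine (is_derive_eq _ _).
  by notypeclasses refine (is_derive_fcomp _ hw); exact: is_derive_cos_sqrt.
by field.
Qed.

Lemma dlam_thetaE z : z <= 1 -> dlam_theta z = - (pi ^+ 2) * (cos_sqrt (sqradius z) + sinc_sqrt (sqradius z)).
Proof.
move=> z1; have w0 : 0 <= sqradius z by rewrite /sqradius mulr_ge0 ?subr_ge0 // mulr_ge0 // exprn_ge0 // ltW.
have D1 : is_derive z (1 : R) lam_theta (- (pi ^+ 2) * (cos_sqrt (sqradius z) + sinc_sqrt (sqradius z))).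
  rewrite (_ : lam_theta = fun z => sqradius z * sinc_sqrt (sqradius z)); last by apply/funext => y; exact: lam_thetaE.
  have hw := is_derive_sqradius z; notypeclasses refine (is_derive_eq _ _).
    by notypeclasses refine (is_derive_fcomp (phi := fun w => w * sinc_sqrt w) _ hw); exact: is_derive_mul_sinc_sqrt.
  by field.
have D2 : is_derive z (1 : R) lam_theta (dlam_theta z).
  clear D1; have hid := is_derive_fid z; have hk := is_derive_lam_xy z.
  by rewrite /lam_theta /dlam_theta; derive_by_rules; rewrite /=; move: (lam_xy z) (dlam_xy z) => K K'; ring.
by case: D1 => _ <-; case: D2 => _ <-.
Qed.

(** The derivative of w S (w) at 0 is both S (0) and (1 + S (0)) / 2. *)
Lemma sinc_sqrt0 : sinc_sqrt (0 : R) = 1.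
Proof.
have D1 := is_derive_mul_sinc_sqrt (lexx (0 : R)).
have hS := is_derive_psum (0 : R) (expbound_sinc_sqrt (R := R)).
have D2 : is_derive (0 : R) (1 : R) (fun x => x * sinc_sqrt x) (sinc_sqrt 0).
  have hid := is_derive_fid (0 : R); rewrite -/sinc_sqrt in hS.
  notypeclasses refine (is_derive_eq (is_derive_fM hid hS) _).
  by rewrite /=; ring.
have : (cos_sqrt 0 + sinc_sqrt 0) / 2 = sinc_sqrt 0 :> R by case: D1 => _ <-; case: D2 => _ <-.
by rewrite cos_sqrt0; lra.
Qed.

(** The inequality 1 + cos r sin r / r > 0 holds by |cos r sin r / r| <= 1 / 2 if
    r >= 1, and by the positivity of cos r and sin r if 0 < r < 1. *)
Lemma one_cos_sinc_sqrt_gt0 w : 0 <= w -> 0 < 1 + cos_sqrt w * sinc_sqrt w.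
Proof.
rewrite le_eqVlt => /predU1P[<-|w0]; first by rewrite cos_sqrt0 sinc_sqrt0; lra.
have [w1|w1] := lerP 1 w.
  have h := cos_sinc_sqrt1 (ltW w0).
  have : cos_sqrt w ^+ 2 + sinc_sqrt w ^+ 2 <= 1.
    by rewrite -h lerD2l ler_peMl // sqr_ge0.
  by have := sqr_ge0 (cos_sqrt w + sinc_sqrt w); nra.
have r0 : 0 < Num.sqrt w by rewrite sqrtr_gt0.
have r1 : Num.sqrt w < 1 by rewrite -[ltRHS]sqrtr1 ltr_sqrt.
have hp := pi_ge2 R.
rewrite addr_gt0 // mulr_gt0 //.
  by rewrite cos_sqrtE ?ltW //; apply: cos_gt0_pihalf; apply/andP; split; lra.
by rewrite sinc_sqrtE // divr_gt0 //; apply: sin_gt0_pi; apply/andP; split; lra.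
Qed.

(** The contact condition. The pair (h, h2) = (cos r, r sin r) turns in a constant
    direction around the origin. *)
Lemma wronskian_lt0 z : z <= 1 -> wronskian z < 0.
Proof.
move=> z1; have w0 : 0 <= sqradius z by rewrite /sqradius mulr_ge0 ?subr_ge0 // mulr_ge0 // exprn_ge0 // ltW.
rewrite /wronskian dlam_thetaE // dlam_sE lam_thetaE /lam_s.
have -> : cos_sqrt (sqradius z) * (- pi ^+ 2 * (cos_sqrt (sqradius z) + sinc_sqrt (sqradius z))) - pi ^+ 2 * sinc_sqrt (sqradius z) * (sqradius z * sinc_sqrt (sqradius z)) =
  - (pi ^+ 2 * ((cos_sqrt (sqradius z) ^+ 2 + sqradius z * sinc_sqrt (sqradius z) ^+ 2) + cos_sqrt (sqradius z) * sinc_sqrt (sqradius z))) by ring.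
by rewrite cos_sinc_sqrt1 // oppr_lt0 mulr_gt0 ?exprn_gt0 // one_cos_sinc_sqrt_gt0.
Qed.

Lemma lam_s1 : lam_s 1 = 1.
Proof. by rewrite /lam_s /sqradius subrr mulr0 cos_sqrt0. Qed.

Lemma lam_s_w w : lam_s (1 - w / (2 * pi ^+ 2)) = cos_sqrt w.
Proof.
have p0 : (pi : R) != 0 by rewrite gt_eqF.
by rewrite /lam_s /sqradius; congr cos_sqrt; move: p0; move: (pi : R) => P p0; field.
Qed.

(** The identity (1 - z^2) kappa = w S (w) divided by w, valid at the centre of the
    disc too. *)
Lemma lam_xy_w w : 0 <= w < 4 * pi ^+ 2 ->
  lam_xy (1 - w / (2 * pi ^+ 2)) * (4 * pi ^+ 2 - w) = 4 * pi ^+ 4 * sinc_sqrt w.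
Proof.
move=> /andP[w0 w4]; have p0 : (pi : R) != 0 by rewrite gt_eqF.
have wE : sqradius (1 - w / (2 * pi ^+ 2)) = w.
  by rewrite /sqradius; move: p0; move: (pi : R) => P p0; field.
move: w0; rewrite le_eqVlt => /predU1P[<-|w0].
  have -> : 1 - 0 / (2 * pi ^+ 2) = 1 :> R by rewrite mul0r subr0.
  rewrite /lam_xy /lam_xyN (_ : - (1 / 2) < 1 = true); last by apply/idP; lra.
  by rewrite /sqradius subrr mulr0; move: (sinc_sqrt 0) => S; move: p0; move: (pi : R) => P p0; field.
have := lam_thetaE (1 - w / (2 * pi ^+ 2)); rewrite wE /lam_theta => hk.
have w0' : w != 0 by rewrite gt_eqF.
apply: (mulfI w0').
have -> : w * (lam_xy (1 - w / (2 * pi ^+ 2)) * (4 * pi ^+ 2 - w)) =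
   (1 - (1 - w / (2 * pi ^+ 2)) ^+ 2) * lam_xy (1 - w / (2 * pi ^+ 2)) * (4 * pi ^+ 4).
  by move: (lam_xy _) => K; move: p0; move: (pi : R) => P p0; field.
by rewrite hk; ring.
Qed.

End Profile.

(** * Tangent spaces *)
Section Tangent.
Context {R : realType}.
Local Notation E := (E7 R).
Local Notation M := (@S2S1S1 R).
Local Notation F := (@atlas R).
Local Notation derive_at0 := (is_derive (0 : R) (1 : R)).
Implicit Types (P v : E) (e d k : R).

Definition ds_form P v : R := co_u P * co_v v - co_v P * co_u v.

Definition TM P : set E := [set v | [/\ co_x P * co_x v + co_y P * co_y v + co_z P * co_z v = 0,
  co_u P * co_u v + co_v P * co_v v = 0 & co_c P * co_c v + co_s P * co_s v = 0]].

(** The tangent vectors with dt = sin t ds, where ds is [ds_form]. *)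
Definition TF P : set E := [set v | [/\ co_x P * co_x v + co_y P * co_y v + co_z P * co_z v = 0,
  co_u P * co_u v + co_v P * co_v v = 0, co_c v = - co_s P ^+ 2 * ds_form P v &
  co_s v = co_s P * co_c P * ds_form P v]].

Lemma TF_TM P : TF P `<=` TM P.
Proof. by move=> v [h1 h2 h3 h4]; split=> //; rewrite h3 h4; ring. Qed.

Lemma const_derive0 (J : set R) (f : R -> R) a d : open J -> J 0 ->
  (forall t, J t -> f t = a) -> derive_at0 f d -> d = 0.
Proof.
move=> oJ J0 fa [_ <-]; rewrite -[RHS](derive_cst a (0 : R) (1 : R)).
have nJ : \forall t \near (0 : R), J t by exact: open_nbhs_nbhs.
apply: near_eq_derive; near=> t; have Jt : J t by near: t; exact: nJ.
by rewrite fa.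
Unshelve. all: by end_near. Qed.

Section Curve.
Variables (J : set R) (g : R -> E) (v : E).
Hypotheses (oJ : open J) (J0 : J 0) (gv : derive_at0 g v).

Lemma is_derive_co_x : derive_at0 (fun t => co_x (g t)) (co_x v).
Proof. exact: lincont_is_derive lincont_co_x gv. Qed.
Lemma is_derive_co_y : derive_at0 (fun t => co_y (g t)) (co_y v).
Proof. exact: lincont_is_derive lincont_co_y gv. Qed.
Lemma is_derive_co_z : derive_at0 (fun t => co_z (g t)) (co_z v).
Proof. exact: lincont_is_derive lincont_co_z gv. Qed.
Lemma is_derive_co_u : derive_at0 (fun t => co_u (g t)) (co_u v).
Proof. exact: lincont_is_derive lincont_co_u gv. Qed.
Lemma is_derive_co_v : derive_at0 (fun t => co_v (g t)) (co_v v).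
Proof. exact: lincont_is_derive lincont_co_v gv. Qed.
Lemma is_derive_co_c : derive_at0 (fun t => co_c (g t)) (co_c v).
Proof. exact: lincont_is_derive lincont_co_c gv. Qed.
Lemma is_derive_co_s : derive_at0 (fun t => co_s (g t)) (co_s v).
Proof. exact: lincont_is_derive lincont_co_s gv. Qed.

Lemma curve_TM : (forall t, J t -> M (g t)) -> TM (g 0) v.
Proof.
move=> gM; have hx := is_derive_co_x; have hy := is_derive_co_y; have hz := is_derive_co_z.
have hu := is_derive_co_u; have hv := is_derive_co_v; have hc := is_derive_co_c; have hs := is_derive_co_s.
have d1 : derive_at0 (fun t => co_x (g t) ^+ 2 + co_y (g t) ^+ 2 + co_z (g t) ^+ 2)
    (2 * (co_x (g 0) * co_x v + co_y (g 0) * co_y v + co_z (g 0) * co_z v)).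
  by derive_by_rules; rewrite /=; ring.
have d2 : derive_at0 (fun t => co_u (g t) ^+ 2 + co_v (g t) ^+ 2)
    (2 * (co_u (g 0) * co_u v + co_v (g 0) * co_v v)).
  by derive_by_rules; rewrite /=; ring.
have d3 : derive_at0 (fun t => co_c (g t) ^+ 2 + co_s (g t) ^+ 2)
    (2 * (co_c (g 0) * co_c v + co_s (g 0) * co_s v)).
  by derive_by_rules; rewrite /=; ring.
have e1 := const_derive0 oJ J0 (a := 1) _ d1.
have e2 := const_derive0 oJ J0 (a := 1) _ d2.
have e3 := const_derive0 oJ J0 (a := 1) _ d3.
split.
- by apply: (mulfI (_ : (2 : R) != 0)); rewrite ?pnatr_eq0 // mulr0; apply: e1 => t /gM /S2S1S1P[].
- by apply: (mulfI (_ : (2 : R) != 0)); rewrite ?pnatr_eq0 // mulr0; apply: e2 => t /gM /S2S1S1P[].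
- by apply: (mulfI (_ : (2 : R) != 0)); rewrite ?pnatr_eq0 // mulr0; apply: e3 => t /gM /S2S1S1P[].
Qed.

Lemma rot_tangent (u w a b : R) : u ^+ 2 + w ^+ 2 = 1 -> u * a + w * b = 0 ->
  a = - w * (u * b - w * a) /\ b = u * (u * b - w * a).
Proof.
move=> uw h; split; apply/eqP; rewrite -subr_eq0; apply/eqP.
  transitivity ((1 - (u ^+ 2 + w ^+ 2)) * a + u * (u * a + w * b)); first ring.
  by rewrite uw h; ring.
transitivity ((1 - (u ^+ 2 + w ^+ 2)) * b + w * (u * a + w * b)); first ring.
by rewrite uw h; ring.
Qed.

(** Differentiate the transverse coordinate along a curve in a plaque: its
    derivative is a nonzero multiple of dt - sin t ds. *)
Lemma curve_TF e d k : is_sign e -> is_sign d -> is_sign k ->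
  cdom (chart e d k) (g 0) ->
  (forall t, J t -> plaque (chart e d k) (g 0) (g t)) -> TF (g 0) v.
Proof.
move=> se sd sk [M0 /chart_domP[n1 n2 n3]] gpl.
have [t1 t2 t3] : TM (g 0) v by apply: curve_TM => t /gpl[[]].
have /S2S1S1P[m1 m2 m3] := M0.
have [r1 r2] := rot_tangent m2 t2; have [r3 r4] := rot_tangent m3 t3.
rewrite -/(ds_form _ _) in r1 r2.
have hu := is_derive_co_u; have hv := is_derive_co_v; have hc := is_derive_co_c; have hs := is_derive_co_s.
have hE : forall t, J t -> k * co_s (g t) / (1 + k * co_c (g t)) *
     expR (- (k * (2 * atan (d * co_v (g t) / (1 + d * co_u (g t)))))) = (chart_map e d k (g 0)).2.
  by move=> t /gpl[_ /=].
set sl := d * co_v (g 0) / (1 + d * co_u (g 0)).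
have sq : 1 + sl ^+ 2 = 2 / (1 + d * co_u (g 0)).
  have [c1 _] := circ_of_slope sd m2 n2; rewrite -/sl in c1.
  have [_ + _] := slope_of_circ sl sd; rewrite c1 => ->.
  by field; rewrite one_sqr_neq0.
have hsl : derive_at0 (fun t => d * co_v (g t) / (1 + d * co_u (g t)))
    (ds_form (g 0) v / (1 + d * co_u (g 0))).
  derive_by_rules => //; rewrite /= r1 r2; move: (ds_form _ _) => D.
  transitivity (d * D * (co_u (g 0) * (1 + d * co_u (g 0)) + d * co_v (g 0) ^+ 2) / (1 + d * co_u (g 0)) ^+ 2).
    by field.
  have -> : co_v (g 0) ^+ 2 = 1 - co_u (g 0) ^+ 2 by rewrite -m2; ring.
  case: sd n2 {sl sq hE gpl} => ->; rewrite ?mul1r ?mulN1r => n2; field => //.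
have hat : derive_at0 (fun t => atan (d * co_v (g t) / (1 + d * co_u (g t)))) (ds_form (g 0) v / 2).
  notypeclasses refine (is_derive_eq (is_derive_fatan hsl) _).
  by rewrite /= -/sl sq; field.
set om := co_c (g 0) * co_s v - co_s (g 0) * co_c v in r3 r4.
have hh : derive_at0 (fun t => k * co_s (g t) / (1 + k * co_c (g t)))
    (om / (1 + k * co_c (g 0))).
  derive_by_rules => //; rewrite /= r3 r4; move: om {r3 r4} => D.
  transitivity (k * D * (co_c (g 0) * (1 + k * co_c (g 0)) + k * co_s (g 0) ^+ 2) / (1 + k * co_c (g 0)) ^+ 2).
    by field.
  have -> : co_s (g 0) ^+ 2 = 1 - co_c (g 0) ^+ 2 by rewrite -m3; ring.
  case: sk n3 {hE gpl} => ->; rewrite ?mul1r ?mulN1r => n3; field => //.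
have hf : derive_at0 (fun t => k * co_s (g t) / (1 + k * co_c (g t)) *
     expR (- (k * (2 * atan (d * co_v (g t) / (1 + d * co_u (g t)))))))
   ((om - co_s (g 0) * ds_form (g 0) v) / (1 + k * co_c (g 0)) *
     expR (- (k * (2 * atan (d * co_v (g 0) / (1 + d * co_u (g 0))))))).
  derive_by_rules; rewrite /=; move: (expR _) => X; move: (ds_form _ _) om {hh r1 r2 r3 r4 hat hsl} => D om.
  by case: sk n3 {hE gpl} => ->; rewrite ?mul1r ?mulN1r => n3; field.
have := const_derive0 oJ J0 hE hf => /eqP.
rewrite mulf_eq0 [X in _ || X]gt_eqF ?expR_gt0 // orbF mulf_eq0 invr_eq0 (negbTE n3) orbF subr_eq0 => /eqP omE.
by split=> //; [rewrite r3 omE|rewrite r4 omE]; ring.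
Qed.

End Curve.

Lemma tangentM_sub P : tangent M P `<=` TM P.
Proof.
move=> v [J [g [oJ J0 sg gM [g0 gv]]]]; rewrite -g0.
apply: (curve_TM oJ J0) => //.
by rewrite -gv; apply: derivableP; apply: diff_derivable; exact: (sg [::]).
Qed.

Lemma tangentF_sub P : tangentF F P `<=` TF P.
Proof.
move=> v [_ [[e [d [k [se sd sk ->]]]] DP [J [g [oJ J0 sg gM [g0 gv]]]]]].
rewrite -g0 in DP gM *; apply: (curve_TF oJ J0 _ se sd sk DP) => //.
by rewrite -gv; apply: derivableP; apply: diff_derivable; exact: (sg [::]).
Qed.

(** Coordinates of (x (1 - q t^2) + t v) / (1 + q t^2), a rational arc through x
    with velocity v; for q = |v|^2 / 4 it stays on the sphere when v is tangent
    to it at x. *)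
Definition sphere_arc (x v q t : R) : R := (x * (1 - q * t ^+ 2) + t * v) / (1 + q * t ^+ 2).

Lemma sphere_arc_den q (t : R) : 0 <= q -> 1 + q * t ^+ 2 != 0.
Proof. by move=> q0; rewrite gt_eqF // ltr_pwDl // mulr_ge0 // sqr_ge0. Qed.

Lemma sphere_arc_derive (x v q : R) : derive_at0 (sphere_arc x v q) v.
Proof.
rewrite /sphere_arc; have hid := is_derive_fid (0 : R); derive_by_rules; rewrite /=.
  by rewrite expr0n mulr0 addr0 oner_eq0.
by field.
Qed.

Lemma smooth_on_sphere_arc (x v q : R) : 0 <= q -> smooth_on setT (sphere_arc x v q).
Proof.
move=> q0; have oT := @openT R; have sid := @smooth_on_id R.
by rewrite /sphere_arc; smooth_rules oT => t _; exact: sphere_arc_den.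
Qed.

Lemma sphere_arc0 (x v q : R) : sphere_arc x v q 0 = x.
Proof. by rewrite /sphere_arc expr0n /=; field. Qed.

Lemma sphere_arc3 (x y z a b c t : R) : x ^+ 2 + y ^+ 2 + z ^+ 2 = 1 ->
  x * a + y * b + z * c = 0 -> let q := (a ^+ 2 + b ^+ 2 + c ^+ 2) / 4 in
  sphere_arc x a q t ^+ 2 + sphere_arc y b q t ^+ 2 + sphere_arc z c q t ^+ 2 = 1.
Proof.
move=> s1 s0 q; have q0 : 0 <= q by rewrite /q divr_ge0 // !addr_ge0 // sqr_ge0.
have n0 := sphere_arc_den t q0.
have qE : a ^+ 2 + b ^+ 2 + c ^+ 2 = 4 * q by rewrite /q; field.
rewrite /sphere_arc.
transitivity (((x ^+ 2 + y ^+ 2 + z ^+ 2) * (1 - q * t ^+ 2) ^+ 2 +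
  2 * t * (1 - q * t ^+ 2) * (x * a + y * b + z * c) + t ^+ 2 * (a ^+ 2 + b ^+ 2 + c ^+ 2)) /
  (1 + q * t ^+ 2) ^+ 2).
  by move: q n0 {q0 qE} => q n0; field.
by rewrite s1 s0 qE; move: q n0 {q0 qE} => q n0; field.
Qed.

Lemma sphere_arc2 (x y a b t : R) : x ^+ 2 + y ^+ 2 = 1 ->
  x * a + y * b = 0 -> let q := (a ^+ 2 + b ^+ 2) / 4 in
  sphere_arc x a q t ^+ 2 + sphere_arc y b q t ^+ 2 = 1.
Proof.
move=> s1 s0 q; have := @sphere_arc3 x y 0 a b 0 t; rewrite expr0n !addr0 mulr0 addr0 => /(_ s1 s0) /=.
rewrite -/q => <-; rewrite [X in _ = _ + X](_ : _ = 0) ?addr0 //.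
by rewrite /sphere_arc !(mul0r, mulr0, addr0) expr0n.
Qed.

Lemma TM_sub P : M P -> TM P `<=` tangent M P.
Proof.
move=> /S2S1S1P[m1 m2 m3] v [t1 t2 t3].
pose q1 := (co_x v ^+ 2 + co_y v ^+ 2 + co_z v ^+ 2) / 4.
pose q2 := (co_u v ^+ 2 + co_v v ^+ 2) / 4.
pose q3 := (co_c v ^+ 2 + co_s v ^+ 2) / 4.
have q10 : 0 <= q1 by rewrite /q1 divr_ge0 // !addr_ge0 // sqr_ge0.
have q20 : 0 <= q2 by rewrite /q2 divr_ge0 // !addr_ge0 // sqr_ge0.
have q30 : 0 <= q3 by rewrite /q3 divr_ge0 // !addr_ge0 // sqr_ge0.
have oT := @openT R.
exists setT, (fun t => mk7 (sphere_arc (co_x P) (co_x v) q1 t) (sphere_arc (co_y P) (co_y v) q1 t)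
  (sphere_arc (co_z P) (co_z v) q1 t) (sphere_arc (co_u P) (co_u v) q2 t) (sphere_arc (co_v P) (co_v v) q2 t)
  (sphere_arc (co_c P) (co_c v) q3 t) (sphere_arc (co_s P) (co_s v) q3 t)); split=> //.
- by apply: (smooth_on_mk7 oT); exact: smooth_on_sphere_arc.
- move=> t _; apply/S2S1S1P; rewrite !mk7E; split; first exact: sphere_arc3.
    exact: sphere_arc2.
  exact: sphere_arc2.
- split; first by rewrite !sphere_arc0 mk7_id.
  rewrite -[RHS]mk7_id; apply: derive_val.
  by apply: is_derive_mk7; exact: sphere_arc_derive.
Qed.

Lemma tangentME P : M P -> tangent M P = TM P.
Proof. by move=> MP; apply/seteqP; split; [exact: tangentM_sub|exact: TM_sub]. Qed.

(** A vector of TF is the velocity of the curve that is, in a chart, a line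
    in the leaf coordinates with constant transverse coordinate. *)
Lemma TF_sub P : M P -> TF P `<=` tangentF F P.
Proof.
move=> MP v [t1 t2 t3 t4].
have [e [d [se sd hD]]] := chart_cover MP; have [k sk hk] := exists_sign (co_c P).
have DP := hD k sk hk.
exists (chart e d k); split; first by exists e, d, k.
  by split.
have PE := chart_mapK se sd sk MP DP.
move: PE; set w := chart_map e d k P => PE.
pose a := cx w.1; pose b := cy w.1; pose s := cz w.1; pose y := w.2.
pose n := a ^+ 2 + b ^+ 2.
(* (a', b') is the image of (x', y', z') by the differential of the projection,
   written with 1 + e z = 2 / (1 + n). *)
pose a' := (1 + n) / 2 * (co_x v - e * a * co_z v).
pose b' := (1 + n) / 2 * (e * co_y v - e * b * co_z v).
pose D := ds_form P v.
pose s' := D * (1 + s ^+ 2) / 2.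
pose A (t : R) := a + t * a'; pose B (t : R) := b + t * b'; pose S (t : R) := s + t * s'.
pose N (t : R) := A t ^+ 2 + B t ^+ 2.
pose T (t : R) := y * expR (k * (2 * atan (S t))).
have gE t : chart_inv e d k (row3 (A t) (B t) (S t), y) =
  mk7 (2 * A t / (1 + N t)) (e * (2 * B t / (1 + N t))) (e * ((1 - N t) / (1 + N t)))
    (d * ((1 - S t ^+ 2) / (1 + S t ^+ 2))) (d * (2 * S t / (1 + S t ^+ 2)))
    (k * ((1 - T t ^+ 2) / (1 + T t ^+ 2))) (k * (2 * T t / (1 + T t ^+ 2))).
  by rewrite /chart_inv /inv_height /nrm2 /= !rowcE.
have A0 : A 0 = a by rewrite /A mul0r addr0.
have B0 : B 0 = b by rewrite /B mul0r addr0.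
have S0 : S 0 = s by rewrite /S mul0r addr0.
have N0 : N 0 = n by rewrite /N A0 B0.
have PE0 : mk7 (2 * a / (1 + n)) (e * (2 * b / (1 + n))) (e * ((1 - n) / (1 + n)))
    (d * ((1 - s ^+ 2) / (1 + s ^+ 2))) (d * (2 * s / (1 + s ^+ 2)))
    (k * ((1 - T 0 ^+ 2) / (1 + T 0 ^+ 2))) (k * (2 * T 0 / (1 + T 0 ^+ 2))) = P.
  by rewrite -[RHS]PE -N0 -A0 -B0 -S0 -gE A0 B0 S0 row3_id; congr chart_inv; case: (w).
have xE : co_x P = 2 * a / (1 + n) by rewrite -PE0 mk7E.
have yE : co_y P = e * (2 * b / (1 + n)) by rewrite -PE0 mk7E.
have zE : co_z P = e * ((1 - n) / (1 + n)) by rewrite -PE0 mk7E.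
have uE : co_u P = d * ((1 - s ^+ 2) / (1 + s ^+ 2)) by rewrite -PE0 mk7E.
have vE : co_v P = d * (2 * s / (1 + s ^+ 2)) by rewrite -PE0 mk7E.
have cE : co_c P = k * ((1 - T 0 ^+ 2) / (1 + T 0 ^+ 2)) by rewrite -PE0 mk7E.
have sE : co_s P = k * (2 * T 0 / (1 + T 0 ^+ 2)) by rewrite -PE0 mk7E.
have n0 : 1 + n != 0 := one_sqr2_neq0 a b.
have Np t : 1 + N t != 0 := one_sqr2_neq0 (A t) (B t).
have ee : e * e = 1 by case: se => ->; rewrite ?mulrNN mulr1.
have kk : k * k = 1 by case: sk => ->; rewrite ?mulrNN mulr1.
have /S2S1S1P[m1 m2 m3] := MP.
have [r1 r2] := rot_tangent m2 t2; rewrite -/(ds_form _ _) -/D in r1 r2 t3 t4.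
have KE : a * a' + b * b' = - e * co_z v * (1 + n) ^+ 2 / 4.
  have h : a * co_x v + e * b * co_y v = - e * (1 - n) * co_z v / 2.
    apply: (mulfI (_ : 2 / (1 + n) != 0)); first by rewrite mulf_neq0 ?pnatr_eq0 // invr_eq0.
    apply/eqP; rewrite -subr_eq0; apply/eqP; rewrite -t1 xE yE zE.
    by clear - n0; move: n n0 => n n0; field.
  transitivity ((1 + n) / 2 * ((a * co_x v + e * b * co_y v) - e * co_z v * n)); first by rewrite /a' /b' /n; ring.
  by rewrite h; clear - n0; move: n n0 => n n0; field.
have oT := @openT R; have sid := @smooth_on_id R; have hid := is_derive_fid (0 : R).
have hA : derive_at0 A a' by rewrite /A; derive_by_rules; rewrite /=; ring.
have hB : derive_at0 B b' by rewrite /B; derive_by_rules; rewrite /=; ring.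
have hS : derive_at0 S s' by rewrite /S; derive_by_rules; rewrite /=; ring.
have hN : derive_at0 N (- e * co_z v * (1 + n) ^+ 2 / 2).
  by rewrite /N; derive_by_rules; rewrite /= A0 B0 -[LHS]mulr1; transitivity (2 * (a * a' + b * b')); [ring|rewrite KE; field].
have hT : derive_at0 T (k * D * T 0).
  rewrite /T; derive_by_rules; rewrite /= S0 /s'; move: (expR _) => X.
  by have := one_sqr_neq0 s; move: (s ^+ 2) => q q0; field.
exists setT, (fun t : R => chart_inv e d k (row3 (A t) (B t) (S t), y)); split=> //.
- rewrite (funext gE) /T /N /A /B /S; apply: smooth_on_mk7 => //; smooth_rules oT => t _; first [exact: one_sqr2_neq0|exact: one_sqr_neq0].
- move=> t _; split; first by split; [exact: chart_inv_M|exact: chart_inv_dom].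
  by rewrite -[cphi _]/(chart_map e d k) chart_invK.
- split; first by rewrite gE A0 B0 S0 N0.
  rewrite (funext gE) -[RHS]mk7_id; apply: derive_val.
  have T0 := one_sqr_neq0 (T 0); have s0 := one_sqr_neq0 s.
  apply: is_derive_mk7; derive_by_rules => //; rewrite /= ?N0 ?A0 ?B0 ?S0 //.
  + by rewrite /a'; clear - n0; move: n n0 => n n0; field.
  + have -> : co_y v = e * e * co_y v by rewrite ee mul1r.
    by rewrite /b'; clear - n0; move: n n0 => n n0; field.
  + transitivity (e * e * co_z v); last by rewrite ee mul1r.
    by clear - n0; move: n n0 => n n0; field.
  + by rewrite r1 vE /s'; field.
  + by rewrite r2 uE /s'; field.
  + rewrite t3 sE; move: (T 0) T0 => q q0.
    transitivity (- (k * k) * (2 * q / (1 + q ^+ 2)) ^+ 2 * D); first by field.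
    by ring.
  + rewrite t4 sE cE; move: (T 0) T0 => q q0.
    by transitivity (k * k * (2 * q / (1 + q ^+ 2)) * ((1 - q ^+ 2) / (1 + q ^+ 2)) * D); [field|ring].
Qed.

Lemma tangentFE P : M P -> tangentF F P = TF P.
Proof. by move=> MP; apply/seteqP; split; [exact: tangentF_sub|exact: TF_sub]. Qed.

End Tangent.

(** * The contact form and its kernel *)
Section Forms.
Context {R : realType}.
Local Notation E := (E7 R).
Local Notation M := (@S2S1S1 R).
Local Notation F := (@atlas R).
Implicit Types (P v w : E).

Definition xdy_form P v : R := co_x P * co_y v - co_y P * co_x v.
Definition contact_form P v : R := lam_s (co_z P) * ds_form P v + lam_xy (co_z P) * xdy_form P v.
Definition ext_form P v : R := (2 + co_c P) * contact_form P v.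

Lemma contact_form_linear P : linear (contact_form P : E -> R).
Proof. by move=> a v w; rewrite /contact_form /ds_form /xdy_form !co_linear /GRing.scale /=; ring. Qed.
Lemma ext_form_linear P : linear (ext_form P : E -> R).
Proof.
by move=> a v w; rewrite /ext_form (contact_form_linear P a v w) /GRing.scale /=; ring.
Qed.
HB.instance Definition _ P := GRing.isLinear.Build R E R *:%R (contact_form P) (contact_form_linear P).
HB.instance Definition _ P := GRing.isLinear.Build R E R *:%R (ext_form P) (ext_form_linear P).
Definition contact_formL P : {linear E -> R} := contact_form P.
Definition ext_formL P : {linear E -> R} := ext_form P.

Definition ot_planes P : set E := TF P `&` [set v | contact_form P v = 0].
Definition ot_ext P : set E := TM P `&` [set v | contact_form P v = 0].

Lemma co_c_gtN2 P : M P -> 0 < 2 + co_c P.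
Proof. by move=> /S2S1S1P[_ _ h]; have := sqr_ge0 (co_s P); nra. Qed.

Lemma co_z_le1 P : M P -> co_z P <= 1.
Proof. by move=> /S2S1S1P[h _ _]; have := sqr_ge0 (co_x P); have := sqr_ge0 (co_y P); nra. Qed.

Lemma smooth_on_lam_s_z U : open U -> smooth_on U (fun P => lam_s (co_z P) : R).
Proof. by move=> oU; apply: (smooth_on_comp oU (@smooth_on_lam_s R)) => //; smooth_rules oU. Qed.
Lemma smooth_on_lam_xy_z U : open U -> smooth_on U (fun P => lam_xy (co_z P) : R).
Proof. by move=> oU; apply: (smooth_on_comp oU (@smooth_on_lam_xy R)) => //; smooth_rules oU. Qed.
Lemma smooth_on_dlam_s_z U : open U -> smooth_on U (fun P => dlam_s (co_z P) : R).
Proof. by move=> oU; apply: (smooth_on_comp oU (@smooth_on_dlam_s R)) => //; smooth_rules oU. Qed.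
Lemma smooth_on_dlam_xy_z U : open U -> smooth_on U (fun P => dlam_xy (co_z P) : R).
Proof. by move=> oU; apply: (smooth_on_comp oU (@smooth_on_dlam_xy R)) => //; smooth_rules oU. Qed.

Lemma smooth_contact_form : smooth_form setT contact_formL.
Proof.
move=> v; have oT := @openT E; have hh := smooth_on_lam_s_z oT; have hk := smooth_on_lam_xy_z oT.
by rewrite /contact_formL /= /contact_form /ds_form /xdy_form; smooth_rules oT.
Qed.
Lemma smooth_ext_form : smooth_form setT ext_formL.
Proof.
move=> v; have oT := @openT E; have hh := smooth_on_lam_s_z oT; have hk := smooth_on_lam_xy_z oT.
by rewrite /ext_formL /= /ext_form /contact_form /ds_form /xdy_form; smooth_rules oT.
Qed.

Definition d_contact_form P v w : R :=
  dlam_s (co_z P) * (co_z v * ds_form P w - co_z w * ds_form P v) +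
  2 * lam_s (co_z P) * (co_u v * co_v w - co_v v * co_u w) +
  dlam_xy (co_z P) * (co_z v * xdy_form P w - co_z w * xdy_form P v) +
  2 * lam_xy (co_z P) * (co_x v * co_y w - co_y v * co_x w).

Lemma is_derive_contact_form P v w : is_derive P v (fun y => contact_form y w : R)
  (dlam_s (co_z P) * co_z v * ds_form P w + lam_s (co_z P) * (co_u v * co_v w - co_v v * co_u w) +
   dlam_xy (co_z P) * co_z v * xdy_form P w + lam_xy (co_z P) * (co_x v * co_y w - co_y v * co_x w)).
Proof.
have hx : is_derive P v co_x (co_x v) by exact: lincont_is_derive lincont_co_x (is_derive_id P v).
have hy : is_derive P v co_y (co_y v) by exact: lincont_is_derive lincont_co_y (is_derive_id P v).
have hz : is_derive P v co_z (co_z v) by exact: lincont_is_derive lincont_co_z (is_derive_id P v).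
have hu : is_derive P v co_u (co_u v) by exact: lincont_is_derive lincont_co_u (is_derive_id P v).
have hv : is_derive P v co_v (co_v v) by exact: lincont_is_derive lincont_co_v (is_derive_id P v).
have hh := is_derive_fcomp (is_derive_lam_s (co_z P)) hz.
have hk := is_derive_fcomp (is_derive_lam_xy (co_z P)) hz.
rewrite /contact_form /ds_form /xdy_form; derive_by_rules; rewrite /=.
move: (lam_s _) (dlam_s _) (lam_xy _) (dlam_xy _) => a b c d; ring.
Qed.

Lemma dext_contact_form P v w : dext contact_formL P v w = d_contact_form P v w.
Proof.
rewrite /dext; have [_ +] := is_derive_contact_form P v w; have [_ +] := is_derive_contact_form P w v.
rewrite /contact_formL /= => -> ->; rewrite /d_contact_form.
move: (lam_s _) (dlam_s _) (lam_xy _) (dlam_xy _) => a b c d; ring.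
Qed.

Lemma dext_ext_form P v w : dext ext_formL P v w =
  co_c v * contact_form P w - co_c w * contact_form P v + (2 + co_c P) * d_contact_form P v w.
Proof.
have main v' w' : is_derive P v' (fun y => ext_form y w' : R) (co_c v' * contact_form P w' + (2 + co_c P) *
  (dlam_s (co_z P) * co_z v' * ds_form P w' + lam_s (co_z P) * (co_u v' * co_v w' - co_v v' * co_u w') +
   dlam_xy (co_z P) * co_z v' * xdy_form P w' + lam_xy (co_z P) * (co_x v' * co_y w' - co_y v' * co_x w'))).
  have hc : is_derive P v' co_c (co_c v') by case: (@lincont_co_c R); exact: is_derive_linear.
  have hl := is_derive_contact_form P v' w'.
  by rewrite /ext_form; derive_by_rules; rewrite /=; ring.
rewrite /dext; have [_ +] := main v w; have [_ +] := main w v.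
rewrite /ext_formL /= => -> ->; rewrite /d_contact_form.
move: (lam_s _) (dlam_s _) (lam_xy _) (dlam_xy _) (contact_form P v) (contact_form P w) => a b c d x y; ring.
Qed.

(** The bundle TF is isomorphic to TS^2 + R, hence trivial: the frame sends a
    vector of R^3 to its component tangent to the sphere, plus its normal
    component times the lift of d/ds to TF. *)
Definition dot_x P (a b c : R) : R := a * co_x P + b * co_y P + c * co_z P.
Definition frame P (a b c : R) : E := mk7 (a - dot_x P a b c * co_x P) (b - dot_x P a b c * co_y P)
  (c - dot_x P a b c * co_z P) (- (dot_x P a b c * co_v P)) (dot_x P a b c * co_u P)
  (- (dot_x P a b c * co_s P ^+ 2)) (dot_x P a b c * (co_s P * co_c P)).
(** The components of lambda in this frame; see [contact_form_frame]. *)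
Definition ell1 P : R := lam_s (co_z P) * co_x P - lam_xy (co_z P) * co_y P.
Definition ell2 P : R := lam_s (co_z P) * co_y P + lam_xy (co_z P) * co_x P.
Definition ell3 P : R := lam_s (co_z P) * co_z P.

Lemma ds_form_frame P a b c : M P -> ds_form P (frame P a b c) = dot_x P a b c.
Proof.
move=> /S2S1S1P[_ h _]; rewrite /ds_form /frame !mk7E.
transitivity (dot_x P a b c * (co_u P ^+ 2 + co_v P ^+ 2)); first ring.
by rewrite h mulr1.
Qed.

Lemma xdy_form_frame P a b c : xdy_form P (frame P a b c) = co_x P * b - co_y P * a.
Proof. by rewrite /xdy_form /frame !mk7E; ring. Qed.

Lemma contact_form_frame P a b c : M P -> contact_form P (frame P a b c) = ell1 P * a + ell2 P * b + ell3 P * c.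
Proof.
move=> MP; rewrite /contact_form ds_form_frame // xdy_form_frame /ell1 /ell2 /ell3 /dot_x.
by move: (lam_s (co_z P)) (lam_xy (co_z P)) => x y; ring.
Qed.

Lemma frame_TF P a b c : M P -> TF P (frame P a b c).
Proof.
move=> MP; have D := ds_form_frame a b c MP; have /S2S1S1P[m1 m2 m3] := MP; split.
- have := erefl (dot_x P a b c); rewrite {1}/dot_x /frame !mk7E.
  move: (dot_x P a b c) => s sE.
  transitivity (a * co_x P + b * co_y P + c * co_z P - s * (co_x P ^+ 2 + co_y P ^+ 2 + co_z P ^+ 2)); first ring.
  by rewrite m1 sE; ring.
- by rewrite /frame !mk7E; ring.
- by rewrite D /frame !mk7E; ring.
- by rewrite D /frame !mk7E; ring.
Qed.

Lemma TF_frame P v : M P -> TF P v -> v = frame P (co_x v + ds_form P v * co_x P) (co_y v + ds_form P v * co_y P)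
   (co_z v + ds_form P v * co_z P).
Proof.
move=> MP [t1 t2 t3 t4]; have /S2S1S1P[m1 m2 m3] := MP.
have [r1 r2] := rot_tangent m2 t2; rewrite -/(ds_form _ _) in r1 r2.
have E : dot_x P (co_x v + ds_form P v * co_x P) (co_y v + ds_form P v * co_y P) (co_z v + ds_form P v * co_z P) = ds_form P v.
  rewrite /dot_x; transitivity ((co_x P * co_x v + co_y P * co_y v + co_z P * co_z v) +
    ds_form P v * (co_x P ^+ 2 + co_y P ^+ 2 + co_z P ^+ 2)); first ring.
  by rewrite t1 m1; ring.
rewrite /frame E; apply: co_inj; rewrite !mk7E ?addrK //.
- by rewrite [LHS]r1; ring.
- by rewrite [LHS]r2; ring.
- by rewrite [LHS]t3; ring.
- by rewrite [LHS]t4; ring.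
Qed.

Lemma frame_inj P a b c a' b' c' : M P -> frame P a b c = frame P a' b' c' ->
  [/\ a = a', b = b' & c = c'].
Proof.
move=> MP E; have D : dot_x P a b c = dot_x P a' b' c' by rewrite -!(ds_form_frame _ _ _ MP) E.
have := congr1 co_x E; have := congr1 co_y E; have := congr1 co_z E.
rewrite /frame !mk7E D => e3 e2 e1.
by split; [move: e1|move: e2|move: e3] => /addIr.
Qed.

(** Were lambda zero at P, both h and h2 would vanish there, contrary to
    [wronskian_lt0]. *)
Lemma ell_neq0 P : M P -> [|| ell1 P != 0, ell2 P != 0 | ell3 P != 0].
Proof.
move=> MP; have W := wronskian_lt0 (co_z_le1 MP); have /S2S1S1P[m1 _ _] := MP.
apply: contraT; rewrite !negb_or !negbK => /and3P[/eqP e1 /eqP e2 /eqP e3].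
suff : wronskian (co_z P) = 0 by move=> W0; rewrite W0 ltxx in W.
have S : lam_s (co_z P) ^+ 2 + lam_xy (co_z P) ^+ 2 * (1 - co_z P ^+ 2) = 0.
  transitivity (ell1 P ^+ 2 + ell2 P ^+ 2 + ell3 P ^+ 2); last by rewrite e1 e2 e3 !expr0n !addr0.
  rewrite /ell1 /ell2 /ell3; move: (lam_s _) (lam_xy _) => a b.
  transitivity (a ^+ 2 * (co_x P ^+ 2 + co_y P ^+ 2 + co_z P ^+ 2) + b ^+ 2 * (co_x P ^+ 2 + co_y P ^+ 2)); last ring.
  by rewrite m1 mulr1; congr (_ + _ * _); rewrite -m1; ring.
have z2 : 0 <= 1 - co_z P ^+ 2 by rewrite -m1 (_ : _ - _ = co_x P ^+ 2 + co_y P ^+ 2); [rewrite addr_ge0 // sqr_ge0|ring].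
have hh : lam_s (co_z P) = 0.
  apply/eqP; rewrite -sqrf_eq0; apply/eqP.
  have := sqr_ge0 (lam_s (co_z P)); have : 0 <= lam_xy (co_z P) ^+ 2 * (1 - co_z P ^+ 2) by rewrite mulr_ge0 ?sqr_ge0.
  by move: S; lra.
have h2' : lam_theta (co_z P) = 0.
  apply/eqP; rewrite -sqrf_eq0; apply/eqP; rewrite /lam_theta exprMn.
  have -> : (1 - co_z P ^+ 2) ^+ 2 * lam_xy (co_z P) ^+ 2 = (1 - co_z P ^+ 2) * (lam_xy (co_z P) ^+ 2 * (1 - co_z P ^+ 2)) by ring.
  by move: S; rewrite hh expr0n add0r => ->; rewrite mulr0.
by rewrite /wronskian hh h2' mul0r mulr0 subr0.
Qed.

(** Two vectors spanning the kernel of (a, b, c), one pair for each component that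
    may be nonzero. This gives local frames of the planes, which is all that
    [distribution] asks for. *)
Definition ker_vec1 (i : nat) (a b c : R) : R * R * R :=
  match i with 0%N => (- b, a, 0) | 1%N => (b, - a, 0) | _ => (c, 0, - a) end.
Definition ker_vec2 (i : nat) (a b c : R) : R * R * R :=
  match i with 0%N => (- c, 0, a) | 1%N => (0, - c, b) | _ => (0, c, - b) end.
Definition pivot (i : nat) (a b c : R) : R :=
  match i with 0%N => a | 1%N => b | _ => c end.

Lemma ker_vecP i a b c x y z : pivot i a b c != 0 -> a * x + b * y + c * z = 0 ->
  exists s t, [/\ x = s * (ker_vec1 i a b c).1.1 + t * (ker_vec2 i a b c).1.1,
   y = s * (ker_vec1 i a b c).1.2 + t * (ker_vec2 i a b c).1.2 &
   z = s * (ker_vec1 i a b c).2 + t * (ker_vec2 i a b c).2].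
Proof.
case: i => [|[|i]] /= p0 h.
- exists (y / a), (z / a); split; [|field|field] => //.
  apply: (mulfI p0); transitivity (- (b * y + c * z)); last by field.
  by move: h; lra.
- exists (x / b), (z / b); split; [field| |field] => //.
  apply: (mulfI p0); transitivity (- (a * x + c * z)); last by field.
  by move: h; lra.
- exists (x / c), (y / c); split; [field|field|] => //.
  apply: (mulfI p0); transitivity (- (a * x + b * y)); last by field.
  by move: h; lra.
Qed.

Lemma ker_vec_in i a b c s t : a * (s * (ker_vec1 i a b c).1.1 + t * (ker_vec2 i a b c).1.1) +
   b * (s * (ker_vec1 i a b c).1.2 + t * (ker_vec2 i a b c).1.2) +
   c * (s * (ker_vec1 i a b c).2 + t * (ker_vec2 i a b c).2) = 0.
Proof. by case: i => [|[|i]] /=; ring. Qed.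

Lemma ker_vec_free i a b c s t : pivot i a b c != 0 ->
  s * (ker_vec1 i a b c).1.1 + t * (ker_vec2 i a b c).1.1 = 0 ->
  s * (ker_vec1 i a b c).1.2 + t * (ker_vec2 i a b c).1.2 = 0 ->
  s * (ker_vec1 i a b c).2 + t * (ker_vec2 i a b c).2 = 0 -> s = 0 /\ t = 0.
Proof.
case: i => [|[|i]] /= p0 q1 q2 q3; split; apply: (mulIf p0); rewrite mul0r; lra.
Qed.

Definition ker_field1 (i : nat) P : E := let c := ker_vec1 i (ell1 P) (ell2 P) (ell3 P) in frame P c.1.1 c.1.2 c.2.
Definition ker_field2 (i : nat) P : E := let c := ker_vec2 i (ell1 P) (ell2 P) (ell3 P) in frame P c.1.1 c.1.2 c.2.
(** The field d/dt. It is transverse to the foliation and lambda vanishes on it, so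
    it completes the planes into the extension. *)
Definition turn_field P : E := mk7 0 0 0 0 0 (- co_s P) (co_c P).

Lemma co_0 : [/\ co_x (0 : E) = 0, co_y (0 : E) = 0, co_z (0 : E) = 0 & co_u (0 : E) = 0] /\
  [/\ co_v (0 : E) = 0, co_c (0 : E) = 0 & co_s (0 : E) = 0].
Proof. by split; split; rewrite /co_x /co_y /co_z /co_u /co_v /co_c /co_s /cx /cy /cz /coord0 /coord1 /= mxE. Qed.

Lemma co_comb s t v w :
  [/\ co_x (s *: v + t *: w) = s * co_x v + t * co_x w, co_y (s *: v + t *: w) = s * co_y v + t * co_y w,
   co_z (s *: v + t *: w) = s * co_z v + t * co_z w & co_u (s *: v + t *: w) = s * co_u v + t * co_u w] /\
  [/\ co_v (s *: v + t *: w) = s * co_v v + t * co_v w, co_c (s *: v + t *: w) = s * co_c v + t * co_c w &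
   co_s (s *: v + t *: w) = s * co_s v + t * co_s w].
Proof.
have [[z1 z2 z3 z4] [z5 z6 z7]] := co_0.
by rewrite -[t *: w]addr0 !co_linear z1 z2 z3 z4 z5 z6 z7 !addr0.
Qed.

Lemma frame_lin P s t a b c a' b' c' : s *: frame P a b c + t *: frame P a' b' c' =
  frame P (s * a + t * a') (s * b + t * b') (s * c + t * c').
Proof.
have [[z1 z2 z3 z4] [z5 z6 z7]] := co_comb s t (frame P a b c) (frame P a' b' c').
apply: co_inj; rewrite ?z1 ?z2 ?z3 ?z4 ?z5 ?z6 ?z7 /frame !mk7E /dot_x; ring.
Qed.

Lemma frame0 P : frame P 0 0 0 = 0.
Proof.
have := frame_lin P 0 0 0 0 0 0 0 0.
by rewrite !scale0r addr0 !mul0r addr0 => ->.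
Qed.

Lemma ker_field_comb i P s t : let A := ker_vec1 i (ell1 P) (ell2 P) (ell3 P) in
  let B := ker_vec2 i (ell1 P) (ell2 P) (ell3 P) in
  s *: ker_field1 i P + t *: ker_field2 i P =
  frame P (s * A.1.1 + t * B.1.1) (s * A.1.2 + t * B.1.2) (s * A.2 + t * B.2).
Proof. exact: frame_lin. Qed.

Lemma ker_field_free i P s t : M P -> pivot i (ell1 P) (ell2 P) (ell3 P) != 0 ->
  s *: ker_field1 i P + t *: ker_field2 i P = 0 -> s = 0 /\ t = 0.
Proof.
move=> MP p0; rewrite ker_field_comb -(frame0 P) => /(frame_inj MP)[]; exact: ker_vec_free p0.
Qed.

Lemma ker_field_in i P s t : M P -> ot_planes P (s *: ker_field1 i P + t *: ker_field2 i P).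
Proof.
move=> MP; rewrite ker_field_comb; split; first exact: frame_TF.
by rewrite /= contact_form_frame // ker_vec_in.
Qed.

Lemma ker_field_span i P v : M P -> pivot i (ell1 P) (ell2 P) (ell3 P) != 0 -> ot_planes P v ->
  exists s t, v = s *: ker_field1 i P + t *: ker_field2 i P.
Proof.
move=> MP p0 [tv /= lv]; move: lv; rewrite (TF_frame MP tv) contact_form_frame //.
set a := co_x v + _; set b := co_y v + _; set c := co_z v + _.
by move=> /(ker_vecP p0)[s [t [-> -> ->]]]; exists s, t; rewrite ker_field_comb.
Qed.

Lemma smooth_on_ell U : open U -> [/\ smooth_on U (ell1 : E -> R), smooth_on U (ell2 : E -> R) & smooth_on U (ell3 : E -> R)].
Proof.
move=> oU; have hh := smooth_on_lam_s_z oU; have hk := smooth_on_lam_xy_z oU.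
by split; [rewrite /ell1|rewrite /ell2|rewrite /ell3]; smooth_rules oU.
Qed.

Lemma smooth_on_frame U (a b c : E -> R) : open U -> smooth_on U a -> smooth_on U b -> smooth_on U c ->
  smooth_on U (fun P => frame P (a P) (b P) (c P)).
Proof. by move=> oU sa sb sc; rewrite /frame /dot_x; smooth_rules oU. Qed.

Lemma smooth_on_ker_field1 i U : open U -> smooth_on U (ker_field1 i).
Proof.
move=> oU; have [s1 s2 s3] := smooth_on_ell oU.
by case: i => [|[|i]]; apply: smooth_on_frame => //=; smooth_rules oU.
Qed.

Lemma smooth_on_ker_field2 i U : open U -> smooth_on U (ker_field2 i).
Proof.
move=> oU; have [s1 s2 s3] := smooth_on_ell oU.
by case: i => [|[|i]]; apply: smooth_on_frame => //=; smooth_rules oU.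
Qed.

Lemma open_pivot i : open [set P : E | pivot i (ell1 P) (ell2 P) (ell3 P) != 0].
Proof.
have [s1 s2 s3] := smooth_on_ell (@openT E).
by apply: smooth_on_open_neq0; case: i => [|[|i]].
Qed.

Lemma exists_pivot P : M P -> exists i, pivot i (ell1 P) (ell2 P) (ell3 P) != 0.
Proof.
by move=> /ell_neq0 /or3P[h|h|h]; [exists 0%N|exists 1%N|exists 2%N].
Qed.

Lemma ot_planes_tangent P : M P -> ot_planes P `<=` tangent M P.
Proof. by move=> MP v [/TF_TM]; rewrite tangentME. Qed.

Lemma inord1_neq0 n : (inord 1 == inord 0 :> 'I_n.+2) = false.
Proof. by rewrite -val_eqE /= !inordK. Qed.
Lemma inord2_neq0 : (inord 2 == inord 0 :> 'I_3) = false.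
Proof. by rewrite -val_eqE /= !inordK. Qed.
Lemma inord2_neq1 : (inord 2 == inord 1 :> 'I_3) = false.
Proof. by rewrite -val_eqE /= !inordK. Qed.

Lemma distribution_ot_planes : Defs.distribution M 2 ot_planes.
Proof.
move=> P MP; have [i hi] := exists_pivot MP.
pose X (j : 'I_2) : E -> E := if j == inord 0 then ker_field1 i else ker_field2 i.
have X0 : X (inord 0) = ker_field1 i by rewrite /X eqxx.
have X1 : X (inord 1) = ker_field2 i by rewrite /X inord1_neq0.
exists [set P | pivot i (ell1 P) (ell2 P) (ell3 P) != 0], X; split => //.
- exact: open_pivot.
- move=> j; have oT := @openT E; apply: (smooth_of_smooth_on oT) => //.
  by rewrite /X; case: ifP => _; [exact: smooth_on_ker_field1|exact: smooth_on_ker_field2].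
- move=> Q [MQ /= pQ]; split.
  + move=> j; apply: ot_planes_tangent => //.
    move: j; apply: ord2P; rewrite ?X0 ?X1.
      by have := ker_field_in i 1 0 MQ; rewrite scale1r scale0r addr0.
    by have := ker_field_in i 0 1 MQ; rewrite scale1r scale0r add0r.
  + move=> a; rewrite sum2E X0 X1 => /(ker_field_free MQ pQ)[a0 a1].
    exact: ord2P.
  + apply/seteqP; split=> v.
      move=> /(ker_field_span MQ pQ)[s [t ->]].
      exists (fun j => if j == inord 0 then s else t).
      by rewrite sum2E X0 X1 eqxx inord1_neq0.
    by move=> [a ->]; rewrite sum2E X0 X1; exact: ker_field_in.
Qed.

(** The form dt - sin t ds, which vanishes on TF and is 1 on [turn_field]. *)
Definition turn_part P v : R := co_c P * co_s v - co_s P * co_c v - co_s P * ds_form P v.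

Lemma ot_ext_dec P v : M P -> ot_ext P v -> ot_planes P (v - turn_part P v *: turn_field P).
Proof.
move=> MP [[t1 t2 t3] /= lv]; have /S2S1S1P[m1 m2 m3] := MP.
have [r3 r4] := rot_tangent m3 t3.
rewrite -[v]scale1r -scaleNr; set T := turn_part P _.
have [[z1 z2 z3 z4] [z5 z6 z7]] := co_comb 1 (- T) v (turn_field P).
have dE : ds_form P (1 *: v + - T *: turn_field P) = ds_form P v.
  by rewrite /ds_form z4 z5 /turn_field !mk7E; ring.
have bE : xdy_form P (1 *: v + - T *: turn_field P) = xdy_form P v.
  by rewrite /xdy_form z1 z2 /turn_field !mk7E; ring.
have TE : T = turn_part P v by rewrite /T scale1r.
split; last by rewrite /= /contact_form dE bE.
split; rewrite ?dE ?z1 ?z2 ?z3 ?z4 ?z5 ?z6 ?z7 TE /turn_field !mk7E.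
- by rewrite -[RHS]t1; ring.
- by rewrite -[RHS]t2; ring.
- by rewrite /turn_part {1}r3; ring.
- by rewrite /turn_part {1}r4; ring.
Qed.

Lemma turn_field_ext P v t : M P -> ot_planes P v -> ot_ext P (v + t *: turn_field P).
Proof.
move=> MP [/TF_TM[t1 t2 t3] /= lv]; rewrite -[v]scale1r.
have [[z1 z2 z3 z4] [z5 z6 z7]] := co_comb 1 t v (turn_field P).
split; last by rewrite /= -[RHS]lv /contact_form /ds_form /xdy_form z1 z2 z4 z5 /turn_field !mk7E; ring.
split; rewrite ?z1 ?z2 ?z3 ?z4 ?z5 ?z6 ?z7 /turn_field !mk7E.
- by rewrite -[RHS]t1; ring.
- by rewrite -[RHS]t2; ring.
- by rewrite -[RHS]t3; ring.
Qed.

Lemma turn_partE P v t : M P -> ot_planes P v -> turn_part P (v + t *: turn_field P) = t.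
Proof.
move=> MP [[_ _ t3 t4] _]; rewrite -[v]scale1r; have /S2S1S1P[m1 m2 m3] := MP.
have [[z1 z2 z3 z4] [z5 z6 z7]] := co_comb 1 t v (turn_field P).
rewrite /turn_part /ds_form z4 z5 z6 z7 /turn_field !mk7E t3 t4 /ds_form.
transitivity (co_s P * (co_c P ^+ 2 + co_s P ^+ 2 - 1) * (co_u P * co_v v - co_v P * co_u v) + t * (co_c P ^+ 2 + co_s P ^+ 2)); first ring.
by rewrite m3; ring.
Qed.

Lemma smooth_on_turn_field U : open U -> smooth_on U turn_field.
Proof. by move=> oU; rewrite /turn_field; smooth_rules oU. Qed.

Lemma distribution_ot_ext : Defs.distribution M 3 ot_ext.
Proof.
move=> P MP; have [i hi] := exists_pivot MP.
pose X (j : 'I_3) : E -> E := if j == inord 0 then ker_field1 i else if j == inord 1 then ker_field2 i else turn_field.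
have X0 : X (inord 0) = ker_field1 i by rewrite /X eqxx.
have X1 : X (inord 1) = ker_field2 i by rewrite /X inord1_neq0 eqxx.
have X2 : X (inord 2) = turn_field by rewrite /X inord2_neq0 inord2_neq1.
exists [set P | pivot i (ell1 P) (ell2 P) (ell3 P) != 0], X; split => //.
- exact: open_pivot.
- move=> j; have oT := @openT E; apply: (smooth_of_smooth_on oT) => //.
  by rewrite /X; case: ifP => _; [exact: smooth_on_ker_field1|case: ifP => _; [exact: smooth_on_ker_field2|exact: smooth_on_turn_field]].
- move=> Q [MQ /= pQ]; split.
  + move=> j; rewrite (tangentME MQ).
    suff [] : ot_ext Q (X j Q) by [].
    move: j; apply: ord3P; rewrite ?X0 ?X1 ?X2.
    * by have := turn_field_ext 0 MQ (ker_field_in i 1 0 MQ); rewrite scale1r !scale0r !addr0.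
    * by have := turn_field_ext 0 MQ (ker_field_in i 0 1 MQ); rewrite scale1r !scale0r !addr0 add0r.
    * by have := turn_field_ext 1 MQ (ker_field_in i 0 0 MQ); rewrite scale1r !scale0r !add0r.
  + move=> a; rewrite sum3E X0 X1 X2 => h.
    have x0 : ot_planes Q 0 by have := ker_field_in i 0 0 MQ; rewrite !scale0r addr0.
    have a2 : a (inord 2) = 0.
      rewrite -(turn_partE (a (inord 2)) MQ (ker_field_in i (a (inord 0)) (a (inord 1)) MQ)) h.
      by have := turn_partE 0 MQ x0; rewrite scale0r addr0.
    move: h; rewrite a2 scale0r addr0 => /(ker_field_free MQ pQ)[a0 a1].
    exact: ord3P.
  + apply/seteqP; split=> v.
      move=> tv; have [s [t vE]] := ker_field_span MQ pQ (ot_ext_dec MQ tv).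
      exists (fun j => if j == inord 0 then s else if j == inord 1 then t else turn_part Q v).
      rewrite sum3E X0 X1 X2 eqxx inord1_neq0 eqxx inord2_neq0 inord2_neq1 -vE subrK //.
    by move=> [a ->]; rewrite sum3E X0 X1 X2; apply: turn_field_ext => //; exact: ker_field_in.
Qed.

Lemma ot_ext_extension : extension M F ot_planes ot_ext.
Proof.
split; first exact: distribution_ot_ext.
move=> P MP; rewrite (tangentFE MP); apply/seteqP; split=> v.
  by move=> [[_ lv] tv]; split.
by move=> [tv lv]; split=> //; split=> //; exact: TF_TM.
Qed.

Lemma ext_form_defining : defining_form M ot_ext ext_formL.
Proof.
split; first by exists setT; split=> //; [exact: openT|exact: smooth_ext_form].
move=> P MP; rewrite (tangentME MP) /ot_ext; congr (_ `&` _).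
apply/seteqP; split=> v /=; rewrite /ext_formL /= /ext_form => h; first by rewrite h mulr0.
move/eqP: h; rewrite mulf_eq0 (gt_eqF (co_c_gtN2 MP)) /= => /eqP.
exact.
Qed.

(** In the coordinates s, z, theta of a leaf, lambda /\ d lambda is, up to sign,
    (h h2' - h' h2) ds dz dtheta. *)
Lemma wedge_frame P : M P -> wedge_d contact_formL P (frame P 1 0 0) (frame P 0 1 0) (frame P 0 0 1) = - wronskian (co_z P).
Proof.
move=> MP; have /S2S1S1P[m1 _ _] := MP.
rewrite /wedge_d !dext_contact_form /contact_formL /= !contact_form_frame // /d_contact_form !ds_form_frame // !xdy_form_frame.
rewrite /frame !mk7E /dot_x /ell1 /ell2 /ell3 /wronskian /dlam_theta /lam_theta.
move: (lam_s _) (dlam_s _) (lam_xy _) (dlam_xy _) => a b c d.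
have -> : 1 - co_z P ^+ 2 = co_x P ^+ 2 + co_y P ^+ 2 by rewrite -m1; ring.
ring.
Qed.

Lemma ot_planes_contact : leafwise_contact M F ot_planes.
Proof.
move=> P c MP Fc DP; exists setT, contact_formL; split=> //; first exact: openT.
  exact: smooth_contact_form.
have [fd _ _] := @foliation_atlas R; have [[U oU cU] _ _ _ _] := fd c Fc.
move=> Q [[DQ _] _]; have MQ : M Q by move: DQ; rewrite cU => -[].
rewrite (tangentFE MQ); split=> //.
exists (frame Q 1 0 0), (frame Q 0 1 0), (frame Q 0 0 1); split; try exact: frame_TF.
by rewrite wedge_frame // oppr_eq0 lt_eqF // wronskian_lt0 // co_z_le1.
Qed.

Lemma ot_planes_foliated_contact : foliated_contact M F ot_planes.
Proof.
split; [exact: distribution_ot_planes| |exact: ot_planes_contact].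
by move=> P MP v [tv _]; rewrite (tangentFE MP).
Qed.

End Forms.

(** * The Reeb field and its closed orbits *)
Section ReebField.
Context {R : realType}.
Local Notation E := (E7 R).
Local Notation M := (@S2S1S1 R).
Local Notation F := (@atlas R).
Implicit Types (P v w : E).

(** The Reeb field is [reeb_scale] times the vector with ds = h2', and dtheta = - h',
    which spans the kernel of d lambda on TF, corrected by a displacement in z
    ([reeb_gamma]) that compensates for the variation of 2 + cos t along the
    leaf. *)
Definition reeb_scale P : R := ((2 + co_c P) * wronskian (co_z P))^-1.
Definition reeb_gamma P : R := - (co_s P ^+ 2 / (2 + co_c P)) * lam_xy (co_z P).
Definition reeb_s P : R := reeb_scale P * dlam_theta (co_z P).
Definition reeb_field P : E := mk7
  (reeb_scale P * (dlam_s (co_z P) * co_y P + reeb_gamma P * co_z P * co_x P))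
  (reeb_scale P * (- (dlam_s (co_z P) * co_x P) + reeb_gamma P * co_z P * co_y P))
  (reeb_scale P * - (reeb_gamma P * (1 - co_z P ^+ 2)))
  (- (reeb_s P * co_v P)) (reeb_s P * co_u P) (- (reeb_s P * co_s P ^+ 2)) (reeb_s P * (co_s P * co_c P)).

Lemma reeb_den_neq0 P : M P -> (2 + co_c P) * wronskian (co_z P) != 0.
Proof.
move=> MP; apply: mulf_neq0; first by rewrite gt_eqF // co_c_gtN2.
by rewrite lt_eqF // wronskian_lt0 // co_z_le1.
Qed.

Lemma ds_form_reeb P : M P -> ds_form P (reeb_field P) = reeb_s P.
Proof.
move=> /S2S1S1P[_ m2 _]; rewrite /ds_form /reeb_field !mk7E.
transitivity (reeb_s P * (co_u P ^+ 2 + co_v P ^+ 2)); first ring.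
by rewrite m2 mulr1.
Qed.

Lemma xdy_form_reeb P : M P -> xdy_form P (reeb_field P) = - (reeb_scale P * dlam_s (co_z P) * (1 - co_z P ^+ 2)).
Proof.
move=> /S2S1S1P[m1 _ _]; rewrite /xdy_form /reeb_field !mk7E.
have -> : 1 - co_z P ^+ 2 = co_x P ^+ 2 + co_y P ^+ 2 by rewrite -m1; ring.
ring.
Qed.

Lemma contact_form_reeb P : M P -> contact_form P (reeb_field P) = reeb_scale P * wronskian (co_z P).
Proof.
move=> MP; rewrite /contact_form ds_form_reeb // xdy_form_reeb // /reeb_s /wronskian /lam_theta.
by move: (lam_s _) (lam_xy _) (dlam_s _) (dlam_theta _) => a b c d; ring.
Qed.

Lemma reeb_field_TF P : M P -> TF P (reeb_field P).
Proof.
move=> MP; have D := ds_form_reeb MP; have /S2S1S1P[m1 m2 m3] := MP.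
split; rewrite ?D; rewrite /reeb_field !mk7E.
- transitivity (reeb_scale P * reeb_gamma P * co_z P * (co_x P ^+ 2 + co_y P ^+ 2 + co_z P ^+ 2 - 1)); first ring.
  by rewrite m1 subrr mulr0.
- ring.
- ring.
- ring.
Qed.

Lemma ext_form_reeb P : M P -> ext_form P (reeb_field P) = 1.
Proof.
move=> MP; rewrite /ext_form contact_form_reeb // /reeb_scale mulrA mulrAC mulfV //.
exact: reeb_den_neq0.
Qed.

Lemma dext_reeb P v : M P -> TF P v -> dext ext_formL P (reeb_field P) v = 0.
Proof.
move=> MP [t1 t2 t3 t4]; have /S2S1S1P[m1 m2 m3] := MP.
have c0 : 2 + co_c P != 0 by rewrite gt_eqF // co_c_gtN2.
have [r1 r2] := rot_tangent m2 t2; rewrite -/(ds_form _ _) in r1 r2.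
rewrite dext_ext_form contact_form_reeb // /d_contact_form ds_form_reeb // xdy_form_reeb // t3.
have ecR : co_c (reeb_field P) = - co_s P ^+ 2 * reeb_s P by rewrite /reeb_field !mk7E; ring.
have ezR : co_z (reeb_field P) = - (reeb_scale P * reeb_gamma P * (1 - co_z P ^+ 2)) by rewrite /reeb_field !mk7E; ring.
have uvR : co_u (reeb_field P) * co_v v - co_v (reeb_field P) * co_u v = 0.
  by rewrite r1 r2 /reeb_field !mk7E; ring.
have xyR : co_x (reeb_field P) * co_y v - co_y (reeb_field P) * co_x v =
    reeb_scale P * (- (dlam_s (co_z P) * co_z P * co_z v) + reeb_gamma P * co_z P * xdy_form P v).
  have zE : co_z P * co_z v = - (co_x P * co_x v + co_y P * co_y v) by move: t1; lra.
  rewrite -(mulrA (dlam_s _)) zE.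
  by rewrite /xdy_form /reeb_field !mk7E; ring.
rewrite ecR ezR uvR xyR /contact_form /reeb_s /wronskian /lam_theta /dlam_theta /reeb_gamma.
move: (lam_s _) (dlam_s _) (lam_xy _) (dlam_xy _) (reeb_scale _) (ds_form P v) (xdy_form P v) => a b c d r s t.
by field.
Qed.

Lemma smooth_reeb_field : smooth M reeb_field.
Proof.
pose U : set E := [set P | (2 + co_c P) * wronskian (co_z P) != 0].
have oT := @openT E.
have oU : open U.
  apply: smooth_on_open_neq0; rewrite /wronskian /lam_theta /dlam_theta.
  have hh := smooth_on_lam_s_z oT; have hk := smooth_on_lam_xy_z oT; have hdh := smooth_on_dlam_s_z oT; have hdk := smooth_on_dlam_xy_z oT.
  smooth_rules oT.
apply: (smooth_of_smooth_on oU) => [P MP|].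
  exact: reeb_den_neq0.
have hh := smooth_on_lam_s_z oU; have hk := smooth_on_lam_xy_z oU; have hdh := smooth_on_dlam_s_z oU; have hdk := smooth_on_dlam_xy_z oU.
have hr : smooth_on U reeb_scale.
  by rewrite /reeb_scale; apply: (smooth_onV oU) => //; rewrite /wronskian /lam_theta /dlam_theta; smooth_rules oU.
have hg : smooth_on U reeb_gamma.
  rewrite /reeb_gamma; smooth_rules oU => P /=; rewrite /U /= mulf_eq0 negb_or => /andP[]//.
by rewrite /reeb_field /reeb_s /dlam_theta; smooth_rules oU.
Qed.

Lemma reeb_field_is_reeb : is_reeb M F ext_formL reeb_field.
Proof.
split; first exact: smooth_reeb_field.
move=> P MP; rewrite (tangentFE MP); split; [exact: reeb_field_TF|exact: ext_form_reeb|].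
by move=> v; exact: dext_reeb.
Qed.

(** Each value is taken again arbitrarily far to the right, so the function cannot
    increase. *)
Lemma periodic_monotone_const (f f' : R -> R) T : 0 < T ->
  (forall t : R, is_derive t (1 : R) f (f' t)) -> (forall t, 0 <= f' t) ->
  (forall t, f (t + T) = f t) -> forall t, f' t = 0.
Proof.
move=> T0 df f'0 fT.
have cf : continuous f.
  by move=> t; apply: differentiable_continuous; apply/derivable1_diffP; case: (df t).
have mono a b : a <= b -> f a <= f b.
  move=> ab.
  have D1 (x : R) : x \in `]a, b[%R -> derivable f x 1 by move=> _; case: (df x).
  have D2 (x : R) : x \in `]a, b[%R -> 0 <= f^`()%classic x.
    by move=> _; rewrite derive1E; case: (df x) => _ ->.
  exact: (ger0_derive1_ndecr D1 D2 (continuous_subspaceT cf) (lexx a) ab (lexx b)).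
have fE t s : f s = f t.
  have ge n t' : f (t' + n%:R * T) = f t'.
    elim: n => [|n IHn]; first by rewrite mul0r addr0.
    by rewrite -addn1 natrD mulrDl mul1r addrA fT.
  have le t' s' : f s' <= f t'.
    pose n := Num.bound (`|s' - t'| / T).
    rewrite -(ge n t'); apply: mono.
    have : `|s' - t'| / T < n%:R by apply: archi_boundP; rewrite divr_ge0 // ltW.
    rewrite ltr_pdivrMr // => h; have := ler_norm (s' - t'); lra.
  by apply/eqP; rewrite eq_le !le.
move=> t; have [_ <-] := df t.
rewrite (_ : f = cst (f t)); first by rewrite derive_cst.
by apply/funext => s; exact: fE.
Qed.

Lemma periodic_antitone_const (f f' : R -> R) T : 0 < T ->
  (forall t : R, is_derive t (1 : R) f (f' t)) -> (forall t, f' t <= 0) ->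
  (forall t, f (t + T) = f t) -> forall t, f' t = 0.
Proof.
move=> T0 df f'0 fT t.
have dN (s : R) : is_derive s (1 : R) (fun s => - f s) (- f' s) by exact: is_derive_fN (df s).
have f'N s : 0 <= - f' s by rewrite oppr_ge0.
have fN s : - f (s + T) = - f s by rewrite fT.
by have /eqP := periodic_monotone_const T0 dN f'N fN t; rewrite oppr_eq0 => /eqP.
Qed.

Lemma derive0_const (f : R -> R) : (forall t : R, is_derive t (1 : R) f 0) -> forall t s, f t = f s.
Proof.
move=> df t s; exact: is_derive_0_is_cst.
Qed.

Section Orbit.
Variables (g : R -> E) (T : R).
Hypotheses (T0 : 0 < T) (gM : forall t, M (g t)).
Hypothesis gD : forall t : R, is_derive t (1 : R) g (reeb_field (g t)).
Hypothesis gT : forall t, g (t + T) = g t.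

Let dz t : is_derive t (1 : R) (fun t => co_z (g t)) (co_z (reeb_field (g t))).
Proof. exact: lincont_is_derive lincont_co_z (gD t). Qed.
Let dc t : is_derive t (1 : R) (fun t => co_c (g t)) (co_c (reeb_field (g t))).
Proof. exact: lincont_is_derive lincont_co_c (gD t). Qed.

(** The value of alpha on the rotation field d/dtheta, which preserves alpha and is
    tangent to the leaves. *)
Let H t := (2 + co_c (g t)) * lam_theta (co_z (g t)).

Lemma is_derive_lam_theta (z : R) : is_derive z (1 : R) lam_theta (dlam_theta z).
Proof.
have hid := is_derive_fid z; have hk := is_derive_lam_xy z.
by rewrite /lam_theta /dlam_theta; derive_by_rules; rewrite /=; move: (lam_xy z) (dlam_xy z) => K K'; ring.
Qed.

Lemma orbit_H_const t s : H t = H s.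
Proof.
apply: derive0_const => r; rewrite /H.
have c0 : 2 + co_c (g r) != 0 by rewrite gt_eqF // co_c_gtN2.
have hc := dc r; have hh := is_derive_fcomp (f := fun t => co_z (g t)) (is_derive_lam_theta (co_z (g r))) (dz r).
derive_by_rules; rewrite /= {hc hh} /reeb_field !mk7E /reeb_s /reeb_gamma /lam_theta.
by move: (dlam_theta _) (reeb_scale _) (lam_xy _) => a b c; field.
Qed.

Lemma reeb_scale_lt0 P : M P -> reeb_scale P < 0.
Proof. by move=> MP; rewrite /reeb_scale invr_lt0 nmulr_llt0 ?co_c_gtN2 // wronskian_lt0 // co_z_le1. Qed.

Lemma co_s_of_reeb_s t : reeb_s (g t) != 0 -> co_c (reeb_field (g t)) = 0 -> co_s (g t) = 0.
Proof.
move=> r0; rewrite /reeb_field mk7E => /eqP; rewrite oppr_eq0 mulf_eq0 (negbTE r0) sqrf_eq0.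
by move=> /eqP.
Qed.

(** If H <> 0 the height z is monotone along the orbit, if H = 0 it is constant
    and cos t is monotone. *)
Lemma orbit_co_s0 t : co_s (g t) = 0.
Proof.
have [H0|H0] := eqVneq (H 0) 0.
  have hz s : lam_theta (co_z (g s)) = 0.
    apply: (mulfI (_ : 2 + co_c (g s) != 0)); first by rewrite gt_eqF // co_c_gtN2.
    by rewrite mulr0 -/(H s) (orbit_H_const s 0).
  have zc : forall s r, co_z (g s) = co_z (g r).
    apply: derive0_const => r; apply: is_derive_eq (dz r) _.
    rewrite /reeb_field !mk7E /reeb_gamma.
    transitivity (reeb_scale (g r) * (co_s (g r) ^+ 2 / (2 + co_c (g r))) * lam_theta (co_z (g r))); last by rewrite hz mulr0.
    by rewrite /lam_theta; ring.
  have d0 s : dlam_theta (co_z (g s)) != 0.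
    have := wronskian_lt0 (co_z_le1 (gM s)); rewrite /wronskian hz mulr0 subr0.
    by apply: contraTneq => ->; rewrite mulr0 ltxx.
  have ecE s : co_c (reeb_field (g s)) = (- reeb_scale (g s)) * co_s (g s) ^+ 2 * dlam_theta (co_z (g 0)).
    by rewrite /reeb_field !mk7E /reeb_s (zc 0 s); ring.
  have e0 s : 0 <= - reeb_scale (g s) * co_s (g s) ^+ 2.
    by rewrite mulr_ge0 ?sqr_ge0 // oppr_ge0 ltW // reeb_scale_lt0.
  apply: co_s_of_reeb_s; first by rewrite /reeb_s mulf_neq0 // lt_eqF // reeb_scale_lt0.
  have [dn|dp] := lerP (dlam_theta (co_z (g 0))) 0.
    apply: (periodic_antitone_const T0 dc) => [s|s]; last by rewrite gT.
    by rewrite ecE mulr_ge0_le0.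
  apply: (periodic_monotone_const T0 dc) => [s|s]; last by rewrite gT.
  by rewrite ecE mulr_ge0 // ltW.
have hn s : lam_theta (co_z (g s)) = H 0 / (2 + co_c (g s)).
  by rewrite (orbit_H_const 0 s) /H mulrC mulKf // gt_eqF // co_c_gtN2.
have ezE s : co_z (reeb_field (g s)) = (- reeb_scale (g s) * (co_s (g s) ^+ 2 / (2 + co_c (g s)) ^+ 2)) * (- H 0).
  have c0 : 2 + co_c (g s) != 0 by rewrite gt_eqF // co_c_gtN2.
  transitivity (reeb_scale (g s) * (co_s (g s) ^+ 2 / (2 + co_c (g s))) * lam_theta (co_z (g s))).
    by rewrite /reeb_field !mk7E /reeb_gamma /lam_theta; ring.
  by rewrite hn; field.
have e0 s : 0 <= - reeb_scale (g s) * (co_s (g s) ^+ 2 / (2 + co_c (g s)) ^+ 2).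
  by rewrite mulr_ge0 ?divr_ge0 ?sqr_ge0 // oppr_ge0 ltW // reeb_scale_lt0.
have z0 : co_z (reeb_field (g t)) = 0.
  have [dn|dp] := lerP (- H 0) 0.
    apply: (periodic_antitone_const T0 dz) => [s|s]; last by rewrite gT.
    by rewrite ezE mulr_ge0_le0.
  apply: (periodic_monotone_const T0 dz) => [s|s]; last by rewrite gT.
  by rewrite ezE mulr_ge0 // ltW.
move: z0; rewrite ezE => /eqP; rewrite mulf_eq0 oppr_eq0 (negbTE H0) orbF mulf_eq0 oppr_eq0.
rewrite (lt_eqF (reeb_scale_lt0 (gM t))) /= mulf_eq0 invr_eq0 !sqrf_eq0.
by rewrite (gt_eqF (co_c_gtN2 (gM t))) orbF => /eqP.
Qed.

Lemma orbit_slice : (forall t, slice 0 (g t)) \/ (forall t, slice pi (g t)).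
Proof.
have ec2 t : co_c (g t) = 1 \/ co_c (g t) = -1.
  have /S2S1S1P[_ _] := gM t; rewrite orbit_co_s0 expr0n addr0 => /eqP.
  by rewrite sqrf_eq1 => /orP[/eqP ->|/eqP ->]; [left|right].
have cc s t : co_c (g s) = co_c (g t).
  apply: (derive0_const (f := fun s => co_c (g s))) => r; apply: is_derive_eq (dc r) _.
  by rewrite /reeb_field mk7E orbit_co_s0 expr0n mulr0 oppr0.
have [h|h] := ec2 0; [left|right] => t; apply/sliceP; have /S2S1S1P[m1 m2 m3] := gM t; split=> //.
- by rewrite cos0 (cc t 0).
- by rewrite sin0 orbit_co_s0.
- by rewrite cospi (cc t 0).
- by rewrite sinpi orbit_co_s0.
Qed.

End Orbit.

Lemma closed_orbit_slice C : closed_orbit M reeb_field C -> C `<=` slice 0 \/ C `<=` slice pi.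
Proof.
move=> [g [T [T0 gM gD gT ->]]].
by have [h|h] := orbit_slice T0 gM gD gT; [left|right] => _ [t _ <-]; exact: h.
Qed.

(** Over the north pole, on the compact leaf cos t = c = 1 or -1, the Reeb field
    is d/ds divided by 2 + c. *)
Lemma pole_orbit (c : R) : is_sign c -> exists2 C, closed_orbit M reeb_field C &
  forall P, C P -> [/\ co_x P ^+ 2 + co_y P ^+ 2 + co_z P ^+ 2 = 1, co_u P ^+ 2 + co_v P ^+ 2 = 1, co_c P = c & co_s P = 0].
Proof.
move=> sc; pose G : R := 2 + c.
have G0 : 0 < G by rewrite /G; case: sc => ->; lra.
pose g (t : R) : E := mk7 0 0 1 (cos (t / G)) (sin (t / G)) c 0.
have gM t : M (g t).
  apply/S2S1S1P; rewrite /g !mk7E; split.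
  - by rewrite !expr0n !add0r expr1n.
  - by rewrite cos2Dsin2.
  - by rewrite expr0n addr0; case: sc => ->; rewrite ?sqrrN expr1n.
exists (range g); last first.
  move=> _ [t _ <-]; rewrite /g !mk7E; split=> //; last by rewrite cos2Dsin2.
  by rewrite !expr0n !add0r expr1n.
exists g, (G * (pi *+ 2)); split=> //.
- by rewrite mulr_gt0 // mulrn_wgt0 // pi_gt0.
- move=> t.
  have RE : reeb_field (g t) = mk7 0 0 0 (- sin (t / G) / G) (cos (t / G) / G) 0 0.
    have rsE : reeb_s (g t) = G^-1.
      have W0 := wronskian_lt0 (lexx (1 : R)).
      have WE : wronskian (1 : R) = dlam_theta 1.
        by rewrite /wronskian lam_s1 mul1r /lam_theta expr1n subrr mul0r mulr0 subr0.
      rewrite /reeb_s /reeb_scale /g !mk7E -/G -WE invfM mulfVK //.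
      by rewrite lt_eqF.
    rewrite /reeb_field rsE /g !mk7E /reeb_gamma !mk7E; apply: co_inj; rewrite !mk7E.
    + by rewrite !mulr0 addr0 mulr0.
    + by rewrite !mulr0 oppr0 addr0 mulr0.
    + by rewrite expr1n subrr mulr0 oppr0 mulr0.
    + by rewrite mulNr mulrC.
    + by rewrite mulrC.
    + by rewrite expr0n mulr0 oppr0.
    + by rewrite mul0r mulr0.
  rewrite RE /g; have hid := is_derive_fid t.
  apply: is_derive_mk7; try exact: is_derive_fcst.
  + by derive_by_rules; rewrite ?gt_eqF //=; field; rewrite gt_eqF.
  + by derive_by_rules; rewrite ?gt_eqF //=; field; rewrite gt_eqF.
- move=> t; rewrite /g; have -> : (t + G * (pi *+ 2)) / G = t / G + pi *+ 2.
    by rewrite mulrDl [G * _]mulrC mulfK // gt_eqF.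
  by rewrite cosD2pi sinD2pi.
Qed.

End ReebField.

(** * Overtwisted discs in the leaves *)
Section Overtwisted.
Context {R : realType}.
Local Notation E := (E7 R).
Local Notation M := (@S2S1S1 R).
Local Notation F := (@atlas R).
Implicit Types (x y v : 'rV[R]_3).

Let pi0 : 0 < (pi : R) := pi_gt0 R.
Let s1 : @is_sign R 1. Proof. by left. Qed.

(** With r^2 = 2 pi^2 (1 - z), the point of the sphere at the angle theta of the
    disc r < 2 pi has the stereographic coordinates (x, y) / sqrt (4 pi^2 - r^2),
    and the third coordinate of the model is the angle s. *)
Definition disc_gap x : R := 4 * pi ^+ 2 - nrm2 x.
Definition ot_nbhd : set 'rV[R]_3 := [set x | 0 < disc_gap x] `&` [set x | 0 < pi - cz x] `&` [set x | 0 < pi + cz x].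
Definition disc_to_chart x : 'rV[R]_3 := row3 (cx x / Num.sqrt (disc_gap x)) (cy x / Num.sqrt (disc_gap x))
  (sin (cz x) / (1 + cos (cz x))).
Definition chart_to_disc y : 'rV[R]_3 := row3 (2 * pi * cx y / Num.sqrt (1 + nrm2 y))
  (2 * pi * cy y / Num.sqrt (1 + nrm2 y)) (2 * atan (cz y)).

Lemma ot_nbhdP x : ot_nbhd x -> [/\ 0 < disc_gap x, 0 < Num.sqrt (disc_gap x), Num.sqrt (disc_gap x) ^+ 2 = disc_gap x,
  0 < 1 + cos (cz x) & 2 * atan (sin (cz x) / (1 + cos (cz x))) = cz x].
Proof.
move=> [[d0 z1] z2]; have [|h1 h2] := @half_tan R (cz x).
  by move: z1 z2; rewrite /= => z1 z2; apply/andP; split; lra.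
by split=> //; rewrite ?sqrtr_gt0 // sqr_sqrtr // ltW.
Qed.

Lemma open_ot_nbhd : open ot_nbhd.
Proof.
have oT := @openT 'rV[R]_3.
by apply: openI; [apply: openI|]; apply: smooth_on_open_gt0; rewrite /disc_gap /nrm2; smooth_rules oT.
Qed.

Lemma ot_disc_nbhd : @ot_disc R `<=` ot_nbhd.
Proof.
move=> x [z0 rx]; rewrite /ot_nbhd /= z0 subr0 addr0; split; [split|] => //.
rewrite /disc_gap subr_gt0 -/(cyl_radius x); rewrite /cyl_radius in rx.
have n0 : 0 <= nrm2 x by rewrite addr_ge0 // sqr_ge0.
have -> : nrm2 x = Num.sqrt (nrm2 x) ^+ 2 by rewrite sqr_sqrtr.
have s0 := sqrtr_ge0 (nrm2 x); rewrite -/(nrm2 x) in rx.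
have p0 := pi0; move: s0 rx p0; move: (pi : R) (Num.sqrt _) => P r s0 rx p0.
by nra.
Qed.

Lemma smooth_on_disc_to_chart : smooth_on ot_nbhd disc_to_chart.
Proof.
have oU := open_ot_nbhd; rewrite /disc_to_chart /disc_gap /nrm2; smooth_rules oU => x /ot_nbhdP[h1 h2 h3 h4 h5] //.
- by rewrite gt_eqF.
- by rewrite gt_eqF.
- by rewrite gt_eqF.
Qed.

Lemma nrm2_disc_to_chart x : ot_nbhd x -> nrm2 (disc_to_chart x) = nrm2 x / disc_gap x.
Proof.
move=> /ot_nbhdP[h1 h2 h3 h4 h5]; rewrite {1}/nrm2 /disc_to_chart !rowcE -[in RHS]h3 /nrm2.
by move: (Num.sqrt _) h2 => S h2; field; rewrite gt_eqF.
Qed.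

Lemma one_nrm2_disc_to_chart x : ot_nbhd x -> 1 + nrm2 (disc_to_chart x) = 4 * pi ^+ 2 / disc_gap x.
Proof.
move=> Ox; rewrite nrm2_disc_to_chart //; have [h1 h2 h3 h4 h5] := ot_nbhdP Ox.
have d0 : disc_gap x != 0 by rewrite gt_eqF.
by apply: (mulIf d0); rewrite mulrDl mul1r !divfK // /disc_gap subrK.
Qed.

Lemma disc_to_chartK x : ot_nbhd x -> chart_to_disc (disc_to_chart x) = x.
Proof.
move=> Ox; have [h1 h2 h3 h4 h5] := ot_nbhdP Ox.
have -> : chart_to_disc (disc_to_chart x) = row3 (2 * pi * cx (disc_to_chart x) / Num.sqrt (1 + nrm2 (disc_to_chart x)))
  (2 * pi * cy (disc_to_chart x) / Num.sqrt (1 + nrm2 (disc_to_chart x))) (2 * atan (cz (disc_to_chart x))) by [].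
have -> : Num.sqrt (1 + nrm2 (disc_to_chart x)) = 2 * pi / Num.sqrt (disc_gap x).
  rewrite one_nrm2_disc_to_chart // -[in LHS]h3 (_ : 4 * pi ^+ 2 / _ ^+ 2 = (2 * pi / Num.sqrt (disc_gap x)) ^+ 2).
    by rewrite sqrtr_sqr ger0_norm // divr_ge0 ?mulr_ge0 // ltW.
  by move: pi (Num.sqrt _) h2 => P S S0; field; rewrite gt_eqF.
have p0 : (pi : R) != 0 by rewrite gt_eqF.
have S0 : Num.sqrt (disc_gap x) != 0 by rewrite gt_eqF.
rewrite /disc_to_chart !rowcE h5 -[RHS]row3_id; congr row3.
- by move: p0 S0; move: (pi : R) (Num.sqrt _) => P S p0 S0; field; rewrite p0 S0.
- by move: p0 S0; move: (pi : R) (Num.sqrt _) => P S p0 S0; field; rewrite p0 S0.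
Qed.

Lemma nrm2_ge0 y : 0 <= nrm2 y. Proof. by rewrite addr_ge0 // sqr_ge0. Qed.

Lemma nrm2_chart_to_disc y : nrm2 (chart_to_disc y) = 4 * pi ^+ 2 * nrm2 y / (1 + nrm2 y).
Proof.
have n0 : 0 < 1 + nrm2 y by rewrite ltr_pwDl // nrm2_ge0.
rewrite {1}/nrm2 /chart_to_disc !rowcE -[in RHS](@sqr_sqrtr _ (1 + nrm2 y)) ?(ltW n0) //.
have := n0; rewrite -sqrtr_gt0 /nrm2; move: (pi : R) (Num.sqrt _) => P S S0; field.
by rewrite gt_eqF.
Qed.

Lemma chart_to_disc_ot y : ot_nbhd (chart_to_disc y).
Proof.
have n0 : 0 < 1 + nrm2 y by rewrite ltr_pwDl // nrm2_ge0.
have a1 := atan_gtNpi2 (cz y); have a2 := atan_ltpi2 (cz y).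
split; [split|]; rewrite /= ?rowcE; [|lra|lra].
rewrite /disc_gap nrm2_chart_to_disc (_ : _ - _ = 4 * pi ^+ 2 / (1 + nrm2 y)); last first.
  by move: (nrm2 y) n0 => n n0; field; rewrite gt_eqF.
by rewrite divr_gt0 // mulr_gt0 // exprn_gt0.
Qed.

Lemma chart_to_discK y : disc_to_chart (chart_to_disc y) = y.
Proof.
have n0 : 0 < 1 + nrm2 y by rewrite ltr_pwDl // nrm2_ge0.
have S0 : 0 < Num.sqrt (1 + nrm2 y) by rewrite sqrtr_gt0.
have Snz : Num.sqrt (1 + nrm2 y) != 0 by rewrite gt_eqF.
have p0 : (pi : R) != 0 by rewrite gt_eqF.
have -> : disc_to_chart (chart_to_disc y) = row3 (cx (chart_to_disc y) / Num.sqrt (disc_gap (chart_to_disc y))) (cy (chart_to_disc y) / Num.sqrt (disc_gap (chart_to_disc y)))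
  (sin (cz (chart_to_disc y)) / (1 + cos (cz (chart_to_disc y)))) by [].
have -> : Num.sqrt (disc_gap (chart_to_disc y)) = 2 * pi / Num.sqrt (1 + nrm2 y).
  rewrite /disc_gap nrm2_chart_to_disc (_ : _ - _ = (2 * pi / Num.sqrt (1 + nrm2 y)) ^+ 2).
    by rewrite sqrtr_sqr ger0_norm // divr_ge0 ?mulr_ge0 // ltW.
  rewrite expr_div_n sqr_sqrtr ?(ltW n0) //.
  by move: (nrm2 y) n0 {S0 Snz} => n n0; field; rewrite gt_eqF.
rewrite /chart_to_disc !rowcE -[RHS]row3_id; congr row3.
- by move: p0 Snz; move: (pi : R) (Num.sqrt _) => P S p0 Snz; field; rewrite p0 Snz.
- by move: p0 Snz; move: (pi : R) (Num.sqrt _) => P S p0 Snz; field; rewrite p0 Snz.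
- rewrite cos2atan sin2atan.
  by have [_ _] := slope_of_circ (cz y) s1; rewrite !mul1r.
Qed.

Lemma continuous_pairc (T : topologicalType) (f : T -> 'rV[R]_3) (c : R) (x : T) :
  {for x, continuous f} -> {for x, continuous (fun z => (f z, c))}.
Proof.
move=> cf; have : (fun z => (f z, c)) @ x --> (f x, c).
  exact: (cvg_pair cf (cvg_cst c)).
by [].
Qed.

Section Leaf.
Variables (k c : R).
Hypothesis sk : is_sign k.

(** The embedding of the model in the leaf, read in the chart that omits the south
    pole and the angle pi; its image is a whole plaque of that chart. *)
Definition ot_embed x : E := chart_inv 1 1 k (disc_to_chart x, c).
Definition ot_retract (P : E) : 'rV[R]_3 := chart_to_disc (chart_map 1 1 k P).1.

Lemma chart_inv_Leaf y : Leaf k c (chart_inv 1 1 k (y, c)).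
Proof.
have MP := chart_inv_M (y, c) s1 s1 sk; have /S2S1S1P[m1 m2 m3] := MP.
split=> //; exists (2 * atan (cz y)); rewrite /chart_inv !mk7E cos2atan sin2atan /= !mul1r.
by split.
Qed.

Lemma ot_embed_image : ot_embed @` ot_nbhd = [set P | exists y, P = chart_inv 1 1 k (y, c)].
Proof.
apply/seteqP; split=> [_ [x _ <-]|_ [y ->]]; first by exists (disc_to_chart x).
by exists (chart_to_disc y); [exact: chart_to_disc_ot|rewrite /ot_embed chart_to_discK].
Qed.

Lemma ot_embedK x : ot_nbhd x -> ot_retract (ot_embed x) = x.
Proof. by move=> Ox; rewrite /ot_retract /ot_embed chart_invK //=; exact: disc_to_chartK. Qed.

(** Near P, the transverse transition maps the plaque through P of any chart into
    the plaque of transverse coordinate c of the chart (1, 1, k). *)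
Lemma ot_embed_leaf_open : leaf_open M F (ot_embed @` ot_nbhd).
Proof.
rewrite ot_embed_image; split; first by move=> _ [y ->]; exact: chart_inv_M.
move=> _ _ [y ->] [e [d [k' [se sd sk' ->]]]]; set P := chart_inv 1 1 k (y, c) => -[MP DP].
have PE := chart_mapK se sd sk' MP DP.
have DP1 : cdom (chart 1 1 k) P by split=> //; exact: chart_inv_dom.
have := chart_compat se sd sk' s1 s1 sk; rewrite /fcompatible => /(_ (chart_map e d k' P)).
case; first by split.
  by rewrite /= PE.
move=> _ [g [ng _]].
have cc : {for P, continuous (chart_map e d k')}.
  exact: differentiable_continuous (@smooth_on_chart_map R e d k' [::] P DP).
have : nbhs P [set Q | (transition (chart e d k') (chart 1 1 k) (chart_map e d k' Q)).2 = g (chart_map e d k' Q).2].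
  exact: cc _ ng.
rewrite nbhsE => -[U [oU UP] hU].
exists (U `&` chart_dom 1 1 k `&` chart_dom e d k'); split.
- by apply: openI; [apply: openI|]; rewrite //; exact: open_chart_dom.
- by split; [split=> //; exact: chart_inv_dom|].
- move=> Q [[[MQ DQ] /= hE] [[UQ DQ1] _]].
  have := hU Q UQ; rewrite /= /transition /= chart_mapK // => h.
  have := hU P UP; rewrite /= /transition /= chart_mapK // => h'.
  exists (chart_map 1 1 k Q).1.
  have E2 : (chart_map 1 1 k Q).2 = c.
    transitivity (chart_map 1 1 k P).2; last by rewrite /P chart_invK.
    by rewrite /= h h'; congr g; exact: hE.
  by rewrite -E2 -[LHS](chart_mapK s1 s1 sk MQ DQ1); congr chart_inv; case: (chart_map 1 1 k Q).
Qed.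

Lemma ot_embed_smooth : smooth_to_leaf F ot_nbhd ot_embed.
Proof.
move=> _ y [e [d [k' [se sd sk' ->]]]]; set N := [set x | _].
have NO : N `<=` ot_nbhd by move=> x [].
have tE x : chart_map e d k' (ot_embed x) = _ := transE s1 s1 sk se sd sk' (disc_to_chart x, c).
have cPhi x : ot_nbhd x -> {for x, continuous disc_to_chart}.
  by move=> Ox; exact: differentiable_continuous (@smooth_on_disc_to_chart [::] x Ox).
have coth x : ot_nbhd x -> {for x, continuous ot_embed}.
  move=> Ox; apply: (@continuous_comp _ _ _ (fun x => (disc_to_chart x, c)) (chart_inv 1 1 k)).
    by apply: continuous_pairc; exact: cPhi.
  by have := smooth_on_continuous (@smooth_on_chart_inv R 1 1 k setT (@openT _)); apply.
have oN : open N.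
  rewrite openE => x [Ox [Mx Dx'] hy].
  have n1 : nbhs x ot_nbhd by apply: open_nbhs_nbhs; split=> //; exact: open_ot_nbhd.
  have n2 : nbhs x [set z | chart_dom e d k' (ot_embed z)].
    by apply: (coth x Ox); apply: open_nbhs_nbhs; split=> //; exact: open_chart_dom.
  have := chart_compat s1 s1 sk se sd sk' (u := (disc_to_chart x, c)).
  case; [by []|by split|] => _ [g [ng _]].
  have n3 : nbhs x [set z | (transition (chart 1 1 k) (chart e d k') (disc_to_chart z, c)).2 = g c].
    have : (fun z => (disc_to_chart z, c)) @ x --> (disc_to_chart x, c).
      by apply: continuous_pairc; exact: cPhi.
    by move=> /(_ _ ng).
  have hx : g c = y by rewrite -hy -(nbhs_singleton n3).
  apply: filterS (filterI n1 (filterI n2 n3)) => z [Oz [Dz /= hz]].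
  by split=> //; [split=> //; exact: chart_inv_M|rewrite -hx -hz].
split=> //.
have cond x : N x -> ((e == 1) || (nrm2 (disc_to_chart x) != 0)) /\ ((d == 1) || (cz (disc_to_chart x) != 0)).
  by move=> [_ [_ Dx'] _]; have [] := trans_dom s1 s1 sk se sd sk' Dx'.
have sP := smooth_on_subset NO smooth_on_disc_to_chart.
have sx : smooth_on N (fun x => cx (disc_to_chart x)) := smooth_on_lincont oN lincont_cx sP.
have sy : smooth_on N (fun x => cy (disc_to_chart x)) := smooth_on_lincont oN lincont_cy sP.
have sz : smooth_on N (fun x => cz (disc_to_chart x)) := smooth_on_lincont oN lincont_cz sP.
have -> : (fun x => (cphi (chart e d k') (ot_embed x)).1) = (fun x =>
    row3 (trans_a (e == 1) (disc_to_chart x)) (trans_b (e == 1) (disc_to_chart x)) (trans_slope (d == 1) (cz (disc_to_chart x)))).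
  by apply/funext => x; rewrite -[cphi _]/(chart_map e d k') tE.
apply: (smooth_on_row3 oN).
- rewrite /trans_a; case: eqP cond => [_ _|_ cond] //; rewrite /nrm2; smooth_rules oN => x /cond[].
  by [].
- rewrite /trans_b; case: eqP cond => [_ _|_ cond] //; rewrite /nrm2; smooth_rules oN => x /cond[].
  by [].
- rewrite /trans_slope; case: (d =P 1) cond => [_ _|_ cond]; first exact: sz.
  smooth_rules oN => x /cond[_].
  by [].
Qed.

Lemma ot_retract_smooth : smooth_from_leaf F (ot_embed @` ot_nbhd) ot_retract.
Proof.
move=> _ y [e [d [k' [se sd sk' ->]]]] _; rewrite ot_embed_image.
have tE x : chart_map 1 1 k (chart_inv e d k' (x, y)) = _ := transE se sd sk' s1 s1 sk (x, y).
pose U : set 'rV[R]_3 := [set x | chart_dom 1 1 k (chart_inv e d k' (x, y))].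
have oU : open U.
  apply: (@open_comp _ _ (fun x => chart_inv e d k' (x, y)) (chart_dom 1 1 k)); last exact: open_chart_dom.
  move=> x _; apply: (@continuous_comp _ _ _ (fun x => (x, y)) (chart_inv e d k')).
    by apply: (@continuous_pairc _ id) => //; exact: cvg_id.
  by have := smooth_on_continuous (@smooth_on_chart_inv R e d k' setT (@openT _)); apply.
apply: (@smooth_on_subset _ _ U) => [x [_ [z /= zE]]|].
  by rewrite /U /= zE; exact: chart_inv_dom.
have -> : (fun x => ot_retract (cpsi (chart e d k') (x, y))) = (fun x =>
    chart_to_disc (row3 (trans_a (1 == e) x) (trans_b (1 == e) x) (trans_slope (1 == d) (cz x)))).
  by apply/funext => x; rewrite /ot_retract -[cpsi _]/(chart_inv e d k') tE.
have cond x : U x -> ((1 == e) || (nrm2 x != 0)) /\ ((1 == d) || (cz x != 0)).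
  by move=> Dx'; have [] := trans_dom se sd sk' s1 s1 sk Dx'.
have sA : smooth_on U (trans_a (1 == e)).
  rewrite /trans_a; case: eqP cond => [_ _|_ cond]; rewrite /nrm2; smooth_rules oU => x /cond[].
  by [].
have sB : smooth_on U (trans_b (1 == e)).
  rewrite /trans_b; case: eqP cond => [_ _|_ cond]; rewrite /nrm2; smooth_rules oU => x /cond[].
  by [].
have sS : smooth_on U (fun x => trans_slope (1 == d) (cz x)).
  rewrite /trans_slope; case: (1 =P d) cond => [_ _|_ cond]; first by smooth_rules oU.
  smooth_rules oU => x /cond[_].
  by [].
rewrite /chart_to_disc /nrm2; under eq_fun do rewrite !rowcE.
rewrite -/(smooth_on _ _); smooth_rules oU => x Ux.
all: have q0 := nrm2_ge0 (row3 (trans_a (1 == e) x) (trans_b (1 == e) x) 0);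
  rewrite /nrm2 !rowcE in q0.
all: by first [rewrite ltr_pwDl|rewrite gt_eqF // sqrtr_gt0 ltr_pwDl].
Qed.

(** The embedding in closed form, from which the derivative is computed. *)
Definition ot_formula x : E := mk7 (cx x * (Num.sqrt (disc_gap x) / (2 * pi ^+ 2)))
  (cy x * (Num.sqrt (disc_gap x) / (2 * pi ^+ 2))) (1 - nrm2 x / (2 * pi ^+ 2))
  (cos (cz x)) (sin (cz x)) (k * cosT (c * expR (k * cz x))) (k * sinT (c * expR (k * cz x))).

Lemma ot_embedE x : ot_nbhd x -> ot_embed x = ot_formula x.
Proof.
move=> Ox; have [h1 h2 h3 h4 h5] := ot_nbhdP Ox.
have p0 : (pi : R) != 0 by rewrite gt_eqF.
have S0 : Num.sqrt (disc_gap x) != 0 by rewrite gt_eqF.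
have cZ : cz (disc_to_chart x) = sin (cz x) / (1 + cos (cz x)) by rewrite /disc_to_chart rowcE.
have hE : inv_height k (disc_to_chart x, c) = c * expR (k * cz x) by rewrite /inv_height /= cZ h5.
rewrite /ot_embed /chart_inv hE /ot_formula /=; congr mk7.
- rewrite one_nrm2_disc_to_chart // /disc_to_chart rowcE; set S' := Num.sqrt _ in S0 h3 *; rewrite -h3.
  by move: p0 S0; clear; move: (pi : R) S' => P S p0 S0; field; rewrite p0 S0.
- rewrite one_nrm2_disc_to_chart // /disc_to_chart rowcE; set S' := Num.sqrt _ in S0 h3 *; rewrite -h3 mul1r.
  by move: p0 S0; clear; move: (pi : R) S' => P S p0 S0; field; rewrite p0 S0.
- rewrite one_nrm2_disc_to_chart // nrm2_disc_to_chart // mul1r.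
  have d0 : disc_gap x != 0 by rewrite gt_eqF.
  have -> : 1 - nrm2 x / disc_gap x = (disc_gap x - nrm2 x) / disc_gap x by rewrite mulrBl divff.
  have nE : nrm2 x = 4 * pi ^+ 2 - disc_gap x by rewrite /disc_gap; ring.
  by rewrite nE; move: p0 d0; move: (pi : R) (disc_gap x) => P d p0 d0; field; rewrite p0 d0.
- by rewrite mul1r -cos2atan cZ h5.
- by rewrite mul1r -sin2atan cZ h5.
Qed.

Lemma is_derive_ot_formula x v : ot_nbhd x -> is_derive x v ot_formula (mk7
  (cx v * (Num.sqrt (disc_gap x) / (2 * pi ^+ 2)) - cx x * ((cx x * cx v + cy x * cy v) / (Num.sqrt (disc_gap x) * (2 * pi ^+ 2))))
  (cy v * (Num.sqrt (disc_gap x) / (2 * pi ^+ 2)) - cy x * ((cx x * cx v + cy x * cy v) / (Num.sqrt (disc_gap x) * (2 * pi ^+ 2))))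
  (- (cx x * cx v + cy x * cy v) / pi ^+ 2)
  (- (sin (cz x) * cz v)) (cos (cz x) * cz v)
  (- co_s (ot_formula x) ^+ 2 * cz v) (co_s (ot_formula x) * co_c (ot_formula x) * cz v)).
Proof.
move=> Ox; have [d0 h2 h3 h4 h5] := ot_nbhdP Ox.
have p0 : (pi : R) != 0 by rewrite gt_eqF.
have S0 : Num.sqrt (disc_gap x) != 0 by rewrite gt_eqF.
have hx := is_derive_cx x v; have hy := is_derive_cy x v; have hz := is_derive_cz x v.
have hn : is_derive x v nrm2 (2 * (cx x * cx v + cy x * cy v)).
  by rewrite /nrm2; derive_by_rules; rewrite /=; ring.
have hD : is_derive x v disc_gap (- (2 * (cx x * cx v + cy x * cy v))).
  by rewrite /disc_gap; derive_by_rules; rewrite /=; ring.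
have hS : is_derive x v (fun x => Num.sqrt (disc_gap x)) (- (cx x * cx v + cy x * cy v) / Num.sqrt (disc_gap x)).
  by notypeclasses refine (is_derive_eq (is_derive_fsqrt d0 hD) _); field.
have hm : is_derive x v (fun x => Num.sqrt (disc_gap x) / (2 * pi ^+ 2))
   (- (cx x * cx v + cy x * cy v) / (Num.sqrt (disc_gap x) * (2 * pi ^+ 2))).
  notypeclasses refine (is_derive_eq (is_derive_fM hS (is_derive_fcst x v (2 * pi ^+ 2)^-1)) _).
  by move: p0 S0; move: (pi : R) (Num.sqrt _) => P S p0 S0; field; rewrite p0 S0.
pose T (y : 'rV[R]_3) := c * expR (k * cz y).
have hT : is_derive x v T (k * T x * cz v).
  by rewrite /T; derive_by_rules; rewrite /=; ring.
have kk : k * k = 1 by case: sk => ->; rewrite ?mulrNN mulr1.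
rewrite {1}/ot_formula /ot_formula !mk7E -!/(T _).
have T0 := one_sqr_neq0 (T x).
apply: is_derive_mk7.
- by derive_by_rules; rewrite /=; ring.
- by derive_by_rules; rewrite /=; ring.
- have hw := is_derive_fM hn (is_derive_fcst x v (2 * pi ^+ 2)^-1).
  notypeclasses refine (is_derive_eq (is_derive_fD (is_derive_fcst x v (1 : R)) (is_derive_fN hw)) _) => /=.
  by move: p0; move: (pi : R) => P p0; field.
- by derive_by_rules; rewrite /=; ring.
- by derive_by_rules.
- rewrite /cosT /sinT; derive_by_rules => //=; rewrite /T in T0 *; move: (expR _) T0 => X T0.
  by transitivity (- (k * k) * (2 * (c * X) / (1 + (c * X) ^+ 2)) ^+ 2 * cz v); [field|ring].
- rewrite /cosT /sinT; derive_by_rules => //=; rewrite /T in T0 *; move: (expR _) T0 => X T0.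
  by transitivity (k * k * (2 * (c * X) / (1 + (c * X) ^+ 2)) *
    ((1 - (c * X) ^+ 2) / (1 + (c * X) ^+ 2)) * cz v); [field|ring].
Qed.

(** The model form without its singular expression on the axis. *)
Lemma ot_modelE x v : ot_model x v <->
  cos_sqrt (nrm2 x) * cz v + sinc_sqrt (nrm2 x) * (cx x * cy v - cy x * cx v) = 0.
Proof.
rewrite /ot_model /= -/(nrm2 x) /cyl_radius -/(nrm2 x) cos_sqrtE ?nrm2_ge0 //.
have [n0|n0] := eqVneq (nrm2 x) 0.
  have x2 := sqr_ge0 (cx x); have y2 := sqr_ge0 (cy x); rewrite /nrm2 in n0.
  have x0 : cx x = 0 by apply/eqP; rewrite -sqrf_eq0; apply/eqP; lra.
  have y0 : cy x = 0 by apply/eqP; rewrite -sqrf_eq0; apply/eqP; lra.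
  by rewrite x0 y0 !mul0r subr0 !mulr0.
by rewrite sinc_sqrtE // lt_neqAle eq_sym n0 nrm2_ge0.
Qed.

(** The embedding pulls lambda back to cos r dz + r sin r dtheta exactly, thanks to
    the choice of the coefficients. *)
Lemma ot_embed_contact x v : ot_nbhd x -> (ot_model x v <-> ot_planes (ot_embed x) ('D_v ot_embed x)).
Proof.
move=> Ox; have [d0 h2 h3 h4 h5] := ot_nbhdP Ox.
have p0 : (pi : R) != 0 by rewrite gt_eqF.
have S0 : Num.sqrt (disc_gap x) != 0 by rewrite gt_eqF.
have -> : 'D_v ot_embed x = 'D_v ot_formula x.
  apply: near_eq_derive; have : nbhs x ot_nbhd by apply: open_nbhs_nbhs; split=> //; exact: open_ot_nbhd.
  by apply: filterS => y; exact: ot_embedE.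
rewrite (ot_embedE Ox); have [_ ->] := is_derive_ot_formula v Ox; set V := mk7 _ _ _ _ _ _ _.
have MH : M (ot_formula x) by rewrite -ot_embedE //; exact: chart_inv_M.
have dV : ds_form (ot_formula x) V = cz v.
  rewrite /ds_form /V /ot_formula !mk7E; transitivity ((cos (cz x) ^+ 2 + sin (cz x) ^+ 2) * cz v); first ring.
  by rewrite cos2Dsin2 mul1r.
have tV : TF (ot_formula x) V.
  split; rewrite ?dV.
  - rewrite /V /ot_formula !mk7E.
    have nE : nrm2 x = cx x ^+ 2 + cy x ^+ 2 by [].
    have DE : disc_gap x = 4 * pi ^+ 2 - nrm2 x by [].
    move: p0 S0 h3 nE DE; move: (pi : R) (Num.sqrt _) => P S; move: (disc_gap x) (nrm2 x) => d n p0 S0 Sd nE dE.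
    transitivity ((cx x * cx v + cy x * cy v) * (S ^+ 2 - (cx x ^+ 2 + cy x ^+ 2) - 4 * P ^+ 2 * (1 - n / (2 * P ^+ 2))) / (4 * P ^+ 4)).
      by field; rewrite p0 S0.
    by rewrite Sd -nE dE; field.
  - by rewrite /V /ot_formula !mk7E; ring.
  - by rewrite {1}/V mk7E.
  - by rewrite {1}/V mk7E.
have lV : contact_form (ot_formula x) V = cos_sqrt (nrm2 x) * cz v + sinc_sqrt (nrm2 x) * (cx x * cy v - cy x * cx v).
  rewrite /contact_form dV.
  have -> : co_z (ot_formula x) = 1 - nrm2 x / (2 * pi ^+ 2) by rewrite /ot_formula mk7E.
  rewrite lam_s_w; congr (_ + _).
  have bE : xdy_form (ot_formula x) V = (cx x * cy v - cy x * cx v) * (disc_gap x / (4 * pi ^+ 4)).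
    rewrite /xdy_form /V /ot_formula !mk7E; have -> : disc_gap x / (4 * pi ^+ 4) = Num.sqrt (disc_gap x) ^+ 2 / (4 * pi ^+ 4) by rewrite h3.
    by move: p0 S0; move: (pi : R) (Num.sqrt _) => P S p0 S0; field; rewrite p0 S0.
  have wb : 0 <= nrm2 x < 4 * pi ^+ 2 by rewrite nrm2_ge0 /= -subr_gt0.
  have kE := lam_xy_w wb.
  transitivity (lam_xy (1 - nrm2 x / (2 * pi ^+ 2)) * (4 * pi ^+ 2 - nrm2 x) / (4 * pi ^+ 4) * (cx x * cy v - cy x * cx v)).
    by rewrite bE /disc_gap; ring.
  rewrite kE; move: (sinc_sqrt _) => S.
  by move: p0; move: (pi : R) => P p0; field.
rewrite ot_modelE -lV; split; first by split.
by case.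
Qed.

Lemma Leaf_overtwisted : overtwisted M F ot_planes (Leaf k c).
Proof.
exists ot_nbhd, ot_embed, ot_retract; split.
- by split; [exact: open_ot_nbhd|exact: ot_disc_nbhd].
- by split; [rewrite ot_embed_image => _ [y ->]; exact: chart_inv_Leaf|exact: ot_embed_leaf_open].
- exact: ot_embedK.
- by split; [exact: ot_embed_smooth|exact: ot_retract_smooth].
- by move=> x v; exact: ot_embed_contact.
Qed.

End Leaf.
End Overtwisted.

(** * The theorem *)
Theorem mainTheorem5 (R : realType) :
  let M := @S2S1S1 R in
  let L0 := @slice R 0 in
  let Lpi := @slice R pi in
  exists (F : set (@fchart R (E7 R))) (xi Theta : E7 R -> set (E7 R))
         (alpha : E7 R -> {linear E7 R -> R}) (Reeb : E7 R -> E7 R),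
    (foliation M F /\ foliated_contact M F xi /\ extension M F xi Theta /\
     defining_form M Theta alpha /\ is_reeb M F alpha Reeb) /\
    [/\ [/\ is_leaf M F L0, is_leaf M F Lpi,
            forall L, is_leaf M F L ->
              (leaf_compact M F L <-> L = L0 \/ L = Lpi) &
            forall L, is_leaf M F L -> L <> L0 -> L <> Lpi ->
              adheres_to L L0 /\ adheres_to L Lpi],
        forall L, is_leaf M F L -> overtwisted M F xi L &
        [/\ exists C, closed_orbit M Reeb C /\ C `<=` L0,
            exists C, closed_orbit M Reeb C /\ C `<=` Lpi,
            forall C, closed_orbit M Reeb C -> C `<=` L0 \/ C `<=` Lpi &
            forall L, is_leaf M F L -> ~ leaf_compact M F L ->
              overtwisted M F xi L /\
              ~ exists C, closed_orbit M Reeb C /\ C `<=` L]].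
Proof.
move=> M L0 Lpi; exists (@atlas R), (@ot_planes R), (@ot_ext R), (@ext_formL R), (@reeb_field R).
have s1 : @is_sign R 1 by left.
have sN1 : @is_sign R (-1) by right.
have Leaf0E (k : R) : is_sign k -> Leaf k 0 = L0 \/ Leaf k 0 = Lpi.
  by case=> ->; [left; exact: Leaf10|right; exact: LeafN10].
have OT L : is_leaf M (@atlas R) L -> overtwisted M (@atlas R) (@ot_planes R) L.
  by move=> /is_leafP[k [c [sk _ ->]]]; exact: Leaf_overtwisted.
split.
  split; first exact: foliation_atlas.
  split; first exact: ot_planes_foliated_contact.
  split; first exact: ot_ext_extension.
  by split; [exact: ext_form_defining|exact: reeb_field_is_reeb].
split => //.
- split.
  + by apply/is_leafP; exists 1, 0; split=> //; [left|rewrite Leaf10].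
  + by apply/is_leafP; exists (-1), 0; split=> //; [right|rewrite LeafN10].
  + move=> _ /is_leafP[k [c [sk _ ->]]]; split=> [cpt|[->|->]].
    * have [->|c0] := eqVneq c 0; first exact: Leaf0E.
      by case: (Leaf_noncompact sk c0).
    * by rewrite /L0 -Leaf10; exact: Leaf0_leaf_compact.
    * by rewrite /Lpi -LeafN10; exact: Leaf0_leaf_compact.
  + move=> _ /is_leafP[k [c [sk kc ->]]] n0 npi.
    have c0 : c != 0 by apply/eqP => c0; move: n0 npi; rewrite c0; case: (Leaf0E k sk).
    case: kc => [k1|cz]; last by rewrite cz eqxx in c0.
    rewrite k1; split; first by rewrite /L0 -Leaf10; exact: Leaf_adheres.
    by rewrite (Leaf_switchE 1 c0) /Lpi -LeafN10; exact: Leaf_adheres.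
- split.
  + have [C oC hC] := @pole_orbit R 1 s1; exists C; split=> // P /hC[h1 h2 h3 h4].
    by apply/sliceP; rewrite cos0 sin0.
  + have [C oC hC] := @pole_orbit R (-1) sN1; exists C; split=> // P /hC[h1 h2 h3 h4].
    by apply/sliceP; rewrite cospi sinpi.
  + exact: closed_orbit_slice.
  + move=> L lL nc; split; first exact: OT.
    move: lL nc => /is_leafP[k [c [sk _ ->]]] nc [C [oC CL]].
    have c0 : c != 0.
      by apply/eqP => c0; apply: nc; rewrite c0; exact: Leaf0_leaf_compact.
    have sl := closed_orbit_slice oC; have [g [T [_ _ _ _ CE]]] := oC.
    have C0 : C (g 0) by rewrite CE; exists 0.
    have e0 : co_s (g 0) = 0.
      by case: sl => h; have /sliceP[_ _ _ ->] := h _ C0; rewrite ?sin0 ?sinpi.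
    by have := co_s_Leaf_neq0 sk c0 (CL _ C0); rewrite e0 eqxx.
Qed.
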